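(* Let $n\ge1$, let $a\ge0$ and let $$\mathcal Q_{a,n}=\mathrm{Op}_{\rm w}\bigl(\mathbf 1\{2\pi(|x|^2+|\xi|^2)\le a\}\bigr)$$ be the Weyl quantization of the characteristic function of the Euclidean ball of $\mathbb R^{2n}$ with center $0$ and radius $\sqrt{a/(2\pi)}$. Then $$\mathcal Q_{a,n}=\sum_{k\ge0}F_{k;n}(a)\,\mathbb P_{k;n},\qquad \mathbb P_{k;n}=\sum_{\alpha\in\mathbb N^n,\ |\alpha|=k}\mathbb P_\alpha ,$$ where $\mathbb P_\alpha$ is the orthogonal projection of $L^2(\mathbb R^n)$ onto (the line spanned by) the Hermite function $\Psi_\alpha$, $|\alpha|=\sum_{1\le j\le n}\alpha_j$, and $$F_{k;n}(a)=\int_{\mathbb R}\frac{\sin a\tau}{\pi\tau}\,\frac{(1+i\tau)^k}{(1-i\tau)^{k+n}}\,d\tau .$$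
   Context: For $u,v\in L^2(\mathbb R^n)$ the Wigner distribution is $\mathcal W(u,v)(x,\xi)=\int_{\mathbb R^n}e^{-2i\pi z\cdot\xi}u(x+\frac z2)\overline{v(x-\frac z2)}\,dz$. For $a\in\mathscr S'(\mathbb R^{2n})$, $\mathrm{Op}_{\rm w}(a)$ is defined by $\langle \mathrm{Op}_{\rm w}(a)u,\bar v\rangle_{\mathscr S',\mathscr S}=\langle a,\mathcal W(u,v)\rangle_{\mathscr S',\mathscr S}$ for $u,v\in\mathscr S(\mathbb R^n)$, extended to $L^2(\mathbb R^n)$ when bounded. The Hermite functions are $\psi_k(x)=\frac{(-1)^k}{2^k\sqrt{k!}}2^{1/4}e^{\pi x^2}\bigl(\frac{d}{\sqrt\pi\,dx}\bigr)^k(e^{-2\pi x^2})$, $k\in\mathbb N=\{0,1,2,\dots\}$, an orthonormal basis of $L^2(\mathbb R)$, and $\Psi_\alpha(x)=\prod_{1\le j\le n}\psi_{\alpha_j}(x_j)$ for $\alpha\in\mathbb N^n$. *)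

(* Defs.v *)
From HB Require Import structures.
From mathcomp Require Import all_boot all_order all_algebra.
From mathcomp Require Import complex.
From mathcomp Require Import all_classical all_reals all_analysis.

Set Implicit Arguments.
Unset Strict Implicit.
Unset Printing Implicit Defensive.

Import Order.TTheory GRing.Theory Num.Theory.
Import numFieldNormedType.Exports.
Import ComplexField.Normc.

Local Open Scope classical_set_scope.
Local Open Scope complex_scope.
Local Open Scope ring_scope.

(* The product sigma-algebra on row vectors, generated by the coordinates; the
   library only has the analogous instance on tuples. *)
Definition measure_row_display : measure_display -> measure_display.
Proof. exact. Qed.

Section measurable_row.
Context {d} {T : measurableType d}.
Variable n : nat.

Let coors : 'I_n -> 'rV[T]_n -> T := fun i x => x ord0 i.

Let row_set0 : g_sigma_preimage coors set0.
Proof. exact: sigma_algebra0. Qed.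

Let row_setC A : g_sigma_preimage coors A -> g_sigma_preimage coors (~` A).
Proof. exact: sigma_algebraC. Qed.

Let row_bigcup (F : _^nat) : (forall i, g_sigma_preimage coors (F i)) ->
  g_sigma_preimage coors (\bigcup_i (F i)).
Proof. exact: sigma_algebra_bigcup. Qed.

HB.instance Definition _ := @isMeasurable.Build (measure_row_display d)
  'rV[T]_n (g_sigma_preimage coors) row_set0 row_setC row_bigcup.

End measurable_row.

Lemma measurable_row_coord d (T : measurableType d) n (i : 'I_n) :
  measurable_fun [set: 'rV[T]_n] (fun x : 'rV[T]_n => x ord0 i).
Proof.
move=> _ Y mY; rewrite setTI; apply: sub_sigma_algebra => /=.
rewrite -bigcup_seq/=; exists i => /=; first by rewrite mem_index_enum.
by exists Y => //; rewrite setTI.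
Qed.

Lemma measurable_fun_row d1 d2 (T1 : measurableType d1)
    (T2 : measurableType d2) n (f : T1 -> 'rV[T2]_n) :
  (forall i, measurable_fun [set: T1] (fun x => f x ord0 i)) ->
  measurable_fun [set: T1] f.
Proof.
move=> mf _ A mA; rewrite setTI.
suff : preimage_set_system [set: T1] f measurable `<=` measurable.
  by apply; exists A => //; rewrite setTI.
rewrite -[X in X `<=` _](@g_sigma_preimage_comp _ T2 n 'rV[T2]_n
  (fun i x => x ord0 i) T1 f).
apply: smallest_sub; first exact: sigma_algebra_measurable.
case: n => [|n] in f mf A mA *; first by rewrite big_ord0.
rewrite -bigcup_mkord_ord; apply: bigcup_sub => i Ii.
by move=> _ [B mB <-]; exact: mf.
Qed.

Section lebesgue_row.
Context {R : realType}.

Definition consr n (p : measurableTypeR R * 'rV[R]_n) : 'rV[R]_(1 + n) :=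
  row_mx (p.1 : R)%:M p.2.

Lemma consrE n (p : measurableTypeR R * 'rV[R]_n) (i : 'I_(1 + n)) :
  consr p ord0 i = match fintype.split i with inl _ => p.1 | inr j => p.2 ord0 j end.
Proof.
case: (splitP i) => j ij.
  rewrite (_ : i = lshift n j); last exact/val_inj.
  by rewrite /consr row_mxEl mxE !ord1 eqxx.
rewrite (_ : i = rshift 1 j); last exact/val_inj.
by rewrite /consr row_mxEr.
Qed.

Lemma measurable_consr n : measurable_fun [set: _] (@consr n).
Proof.
apply: measurable_fun_row => i.
under eq_fun do rewrite consrE.
case: (fintype.split i) => j; first exact: measurable_fst.
exact: (measurableT_comp (@measurable_row_coord _ R n j)).
Qed.

(* Lebesgue measure on R^n, as the n-fold product of the one-dimensional
   Lebesgue measure. *)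
Fixpoint lebesgue_row (n : nat) : set 'rV[R]_n -> \bar R :=
  match n return set 'rV[R]_n -> \bar R with
  | 0 => \d_ (0 : 'rV[R]_0)
  | m.+1 => pushforward (lebesgue_measure \x @lebesgue_row m)%E (@consr m)
  end.

Definition box n (k : nat) : set 'rV[R]_n :=
  [set x | forall i, `[- k%:R, k%:R]%classic (x ord0 i)].

Lemma measurable_box n k : measurable (@box n k).
Proof.
rewrite (_ : box k = \bigcap_(i in [set: 'I_n])
  ((fun x : 'rV[R]_n => x ord0 i) @^-1` `[- k%:R, k%:R]%classic)).
  apply: fin_bigcap_measurable => // i _.
  rewrite -[X in measurable X]setTI.
  by apply: measurable_row_coord => //; exact: measurable_itv.
by apply/seteqP; split => x xk i => [_|]; exact: xk.
Qed.

Lemma consr_box n k :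
  @consr n @^-1` box k = `[- k%:R, k%:R]%classic `*` box k.
Proof.
apply/seteqP; split => -[t v] /=.
  move=> h; split => /=.
    have := h (lshift n ord0); rewrite consrE.
    by case: splitP => // j /= ij; have := ltn_ord j; rewrite ij.
  move=> i; have := h (rshift 1 i); rewrite consrE /=.
  case: splitP => j /= ij; first by have := ltn_ord j; rewrite -ij.
  by rewrite (_ : i = j) //; apply/val_inj/(@addnI 1).
by move=> [/= ht hv] i; rewrite consrE; case: fintype.split => j.
Qed.

Definition finite_on_boxes n (mu : set 'rV[R]_n -> \bar R) :=
  forall k, (mu (box k) < +oo)%E.

Lemma sigma_finite_boxes n (mu : set 'rV[R]_n -> \bar R) :
  finite_on_boxes mu -> sigma_finite [set: 'rV[R]_n] mu.
Proof.
move=> fin; exists (@box n); last by move=> k; split; [exact: measurable_box|].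
apply/esym/seteqP; split => // x _.
exists (Num.bound (\sum_i `|x ord0 i|)) => // i /=.
rewrite in_itv /= -ler_norml.
have le0 : 0 <= \sum_i `|x ord0 i| by apply: sumr_ge0.
apply: le_trans (ltW (archi_boundP le0)).
by rewrite (bigD1 i) //= lerDl sumr_ge0.
Qed.

Lemma consr_measure n (mu : {sigma_finite_measure set 'rV[R]_n -> \bar R})
    (nu := pushforward (lebesgue_measure \x mu)%E (@consr n)) :
  [/\ nu set0 = 0%E, (forall A, (0 <= nu A)%E), semi_sigma_additive nu
    & finite_on_boxes mu -> finite_on_boxes nu].
Proof.
have mconsr := @measurable_consr n.
split.
- exact: measure0.
- by move=> A; exact: measure_ge0.
- exact: measure_semi_sigma_additive.
- move=> mu_box k; rewrite /nu /pushforward consr_box product_measure1E //;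
    last exact: measurable_box.
  rewrite lte_mul_pinfty //.
  rewrite [X in X \is a _]lebesgue_measure_itv /=.
  by case: ifP => // _; rewrite fin_numD.
Qed.

Lemma lebesgue_row_measure n :
  [/\ @lebesgue_row n set0 = 0%E, (forall A, (0 <= @lebesgue_row n A)%E),
      semi_sigma_additive (@lebesgue_row n) & finite_on_boxes (@lebesgue_row n)].
Proof.
elim: n => [|n [mu0 mu_ge0 mu_add mu_box]].
  split => /=.
  - exact: measure0.
  - by move=> A; exact: measure_ge0.
  - exact: measure_semi_sigma_additive.
  - by move=> k; rewrite /= diracE ltry.
pose M := isMeasure.Build _ _ _ (@lebesgue_row n) mu0 mu_ge0 mu_add.
pose mu : {measure set 'rV[R]_n -> \bar R} := HB.pack (@lebesgue_row n) M.
pose S := Measure_isSigmaFinite.Build _ _ _ mu (sigma_finite_boxes mu_box).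
pose smu : {sigma_finite_measure set 'rV[R]_n -> \bar R} :=
  HB.pack (@lebesgue_row n) M S.
have [nu0 nu_ge0 nu_add nu_box] := consr_measure smu.
by split => //; exact: nu_box.
Qed.

Let lebesgue_row0 n : @lebesgue_row n set0 = 0%E.
Proof. by have [] := lebesgue_row_measure n. Qed.

Let lebesgue_row_ge0 n A : (0 <= @lebesgue_row n A)%E.
Proof. by have [_ ->] := lebesgue_row_measure n. Qed.

Let lebesgue_row_sigma_additive n : semi_sigma_additive (@lebesgue_row n).
Proof. by have [] := lebesgue_row_measure n. Qed.

HB.instance Definition _ n := isMeasure.Build _ _ _ (@lebesgue_row n)
  (lebesgue_row0 n) (@lebesgue_row_ge0 n) (@lebesgue_row_sigma_additive n).

Let lebesgue_row_sigma_finite n : sigma_finite setT (@lebesgue_row n).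
Proof. by apply: sigma_finite_boxes; have [] := lebesgue_row_measure n. Qed.

HB.instance Definition _ n := Measure_isSigmaFinite.Build _ _ _
  (@lebesgue_row n) (@lebesgue_row_sigma_finite n).

End lebesgue_row.

Section L2.
Context {R : realType}.
Local Notation C := R[i].

Definition Cintegral d (T : measurableType d) (mu : {measure set T -> \bar R})
    (f : T -> C) : C :=
  (\int[mu]_x complex.Re (f x)) +i* (\int[mu]_x complex.Im (f x)).

Variable n : nat.
Local Notation En := 'rV[R]_n.
Local Notation mu := (@lebesgue_row R n).
Implicit Types (u v e : En -> C).

Definition L2norm u : \bar R := Lnorm mu 2%:E (fun x => (normc (u x))%:E).

Definition L2 u : Prop :=
  [/\ measurable_fun [set: En] (@complex.Re R \o u),
      measurable_fun [set: En] (@complex.Im R \o u) & (L2norm u < +oo)%E].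

Definition L2inner u v : C := Cintegral mu (fun x => u x * (v x)^*%C).

(* Orthogonal projection onto the line spanned by e. *)
Definition line_proj e u : En -> C :=
  fun x => L2inner u e / L2inner e e * e x.

(* A bounded operator on L^2(R^n), acting on representatives: boundedness and
   linearity almost everywhere imply compatibility with a.e. equality. *)
Definition bounded_L2_operator (Q : (En -> C) -> (En -> C)) : Prop :=
  [/\ forall u, L2 u -> L2 (Q u),
      forall (c : C) u v, L2 u -> L2 v ->
        {ae mu, forall x, Q (fun y => c * u y + v y) x = c * Q u x + Q v x}
    & exists M : R, forall u, L2 u -> (L2norm (Q u) <= M%:E * L2norm u)%E].

End L2.

Section distributions.
Context {R : realType}.
Local Notation C := R[i].

Section schwartz.
Variable m : nat.
Local Notation Em := 'rV[R]_m.
Implicit Types (s : seq 'I_m).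

Definition partials s (f : Em -> R) : Em -> R :=
  foldr (fun j g => 'D_(delta_mx ord0 j) g) f s.

Definition smooth (f : Em -> R) : Prop :=
  forall s x, differentiable (partials s f) x.

Definition Cpartials s (phi : Em -> C) : Em -> C := fun x =>
  partials s (@complex.Re R \o phi) x +i* partials s (@complex.Im R \o phi) x.

(* On row vectors `|x| is the sup norm, which is equivalent to the Euclidean
   norm and so yields the same space. *)
Definition schwartz (phi : Em -> C) : Prop :=
  [/\ smooth (@complex.Re R \o phi), smooth (@complex.Im R \o phi)
    & forall s k, exists M : R, forall x,
        `|x| ^+ k * normc (Cpartials s phi x) <= M].

(* Membership in S'(R^m): linearity, and continuity expressed by a bound
   |T phi| <= M B as soon as B bounds finitely many seminorms of phi. *)
Definition tempered (T : (Em -> C) -> C) : Prop :=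
  (forall (c : C) phi psi, schwartz phi -> schwartz psi ->
     T (fun x => c * phi x + psi x) = c * T phi + T psi) /\
  (exists (N : nat) (M : R), forall phi (B : R), schwartz phi ->
     (forall s k x, (size s <= N)%N -> (k <= N)%N ->
        `|x| ^+ k * normc (Cpartials s phi x) <= B) ->
     normc (T phi) <= M * B).

Definition distribution_of (f : Em -> C) : (Em -> C) -> C :=
  fun phi => Cintegral (@lebesgue_row R m) (fun x => f x * phi x).

End schwartz.

Variable n : nat.
Local Notation En := 'rV[R]_n.
(* The phase space R^{2n}; a point X stands for (x, xi) with
   x = lsubmx X and xi = rsubmx X. *)
Local Notation E2n := 'rV[R]_(n + n).

Definition dotr (x y : En) : R := \sum_j x ord0 j * y ord0 j.

Definition cis (t : R) : C := cos t +i* sin t.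

Definition wigner (u v : En -> C) : E2n -> C := fun X =>
  let x := lsubmx X in let xi := rsubmx X in
  Cintegral (@lebesgue_row R n) (fun z =>
    cis (- (2 * pi * dotr z xi)) * u (x + 2^-1 *: z)
      * (v (x - 2^-1 *: z))^*%C).

(* Op_w(a) u as a functional on S(R^n): <Op_w(a) u, phi> = <a, W(u, v)>
   where phi is the complex conjugate of v. *)
Definition Op_w (a : (E2n -> C) -> C) (u : En -> C) : (En -> C) -> C :=
  fun phi => a (wigner u (fun x => (phi x)^*%C)).

(* Q is the extension of Op_w(a) to a bounded operator on L^2(R^n). *)
Definition Op_w_L2 (a : (E2n -> C) -> C) (Q : (En -> C) -> (En -> C)) : Prop :=
  [/\ tempered a, bounded_L2_operator Q
    & forall u phi, schwartz u -> schwartz phi ->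
        distribution_of (Q u) phi = Op_w a u phi].

Definition ball_symbol (a : R) : E2n -> C := fun X =>
  (\1_[set X : E2n | 2 * pi * (dotr (lsubmx X) (lsubmx X)
                     + dotr (rsubmx X) (rsubmx X)) <= a] X)%:C.

End distributions.

Section hermite.
Context {R : realType}.
Local Notation C := R[i].

Definition hermite (k : nat) (x : R) : R :=
  (-1) ^+ k / (2 ^+ k * Num.sqrt k`!%:R) * 2 `^ 4^-1 * expR (pi * x ^+ 2)
  * ((Num.sqrt pi)^-1 ^+ k
     * derive1n k (fun y : R => expR (- (2 * pi * y ^+ 2))) x).

Definition Hermite n (alpha : 'I_n -> nat) : 'rV[R]_n -> C :=
  fun x => (\prod_j hermite (alpha j) (x ord0 j))%:C.

(* The multi-indices with |alpha| = k all have entries at most k. *)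
Definition hermite_proj n (k : nat) (u : 'rV[R]_n -> C) : 'rV[R]_n -> C :=
  fun x => \sum_(alpha : {ffun 'I_n -> 'I_k.+1} | (\sum_j alpha j == k)%N)
             line_proj (Hermite (fun j => alpha j : nat)) u x.

(* The integrand takes the value 0 at tau = 0, by totality of division. *)
Definition F (k n : nat) (a : R) : C :=
  Cintegral (@lebesgue_measure R) (fun tau : R =>
    (sin (a * tau) / (pi * tau))%:C
    * ((1 +i* tau) ^+ k / (1 -i* tau) ^+ (k + n))).

End hermite.

(* Main.v *)
Require Import Defs.
From mathcomp Require Import all_boot all_order all_algebra.
From mathcomp Require Import complex ring lra.
From mathcomp Require Import all_classical all_reals all_analysis.
From mathcomp Require Import measurable_realfun.

Set Implicit Arguments.
Unset Strict Implicit.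
Unset Printing Implicit Defensive.

Import Order.TTheory GRing.Theory Num.Theory.
Import numFieldNormedType.Exports.
Import ComplexField.Normc.

Local Open Scope classical_set_scope.
Local Open Scope complex_scope.
Local Open Scope ring_scope.

(** Write [q = 2 pi (|x|^2 + |xi|^2)] on phase space, so that the symbol is the
    indicator of [q <= a].

    Existence of the operator.  The substitution [z = 2 (x - y)] in the Wigner
    distribution turns the Weyl quantization of the ball into the average, over
    the points [(x, xi)] of the ball, of the operators sending [u] to
    [y |-> 2^n e^{4 i pi (y - x) . xi} u (2 x - y)].  Each of them is a multiple
    of an isometry of L^2 and the ball has finite volume, so Cauchy-Schwarz and
    Tonelli bound the average ([sqnorm_weyl_ball]); Fubini shows that it is the
    quantization in the weak sense ([weyl_ball_Op]).

    Matrix coefficients.  The radial chirps [e^{i tau q}] generate all radial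
    symbols, and their coefficients between Hermite functions are explicit: the
    phase-space integral factorises over the coordinates, and in dimension one
    [wigner1_chirp] gives
    [(1 + i tau)^k / (1 - i tau)^(k + 1)] on the diagonal and 0 off it.  That
    computation is algebraic.  A Gaussian integral [E], possibly with complex
    coefficients, is a linear functional on polynomials characterised up to
    scale by a relation [E p' = E (l p)] with [l] of degree one
    ([gaussian_functional_deriv]); the recurrences of the Hermite polynomials
    then become recurrences for the integrals.  The indicator of [-a, a] being
    the Fourier transform of [sin (a tau) / (pi tau)], integrating the chirps
    against this kernel yields the eigenvalue F ([ball_wigner_Hermite]).  The
    kernel is not absolutely integrable, hence the exchange of integrals is
    done with an additional Gaussian factor, which replaces the indicator by a
    mollification ([damped_fourier]), and the factor is then removed by
    dominated convergence on both sides; the mollifications converge off the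
    sphere [q = a], which is negligible.

    Completeness of the Hermite functions.  The squared coefficients of the
    waves [e^{- pi x^2 + i b x}] are the terms of an exponential series, and
    their sum is the squared norm: the waves are limits of their Hermite
    expansions ([expands_wavec]).  Superposing waves gives the Gaussian times a
    mollified interval, limits give the Gaussian times an interval, and a
    Dynkin-class argument gives every square-integrable function ([expands_all],
    [hermite_complete]).  Products of one-variable functions pass the property
    on to several variables ([expands_row_prod], [hermite_row_complete]).

    Conclusion.  For any operator Q quantizing the ball, the function
    [Q Psi_alpha - F Psi_alpha] is orthogonal to all Hermite functions, so it
    vanishes almost everywhere ([quantized_Hermite]).  By linearity, subtracting
    the partial sum of the asserted series from [Q u] amounts to applying Q to
    the remainder of the Hermite expansion of [u], and that tends to 0 because
    Q is bounded ([quantized_expansion]). *)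

(** * Complex-valued integrals *)

Section complex_numbers.
Context {R : realType}.
Local Notation C := R[i].
Implicit Types (x y : C) (a b : R).

Lemma ReCM x y : complex.Re (x * y) =
  complex.Re x * complex.Re y - complex.Im x * complex.Im y.
Proof. by case: x y => [a b] [c e]. Qed.

Lemma ImCM x y : complex.Im (x * y) =
  complex.Re x * complex.Im y + complex.Im x * complex.Re y.
Proof. by case: x y => [a b] [c e]. Qed.

Lemma real_complexM a b : (a * b)%:C = a%:C * b%:C :> C.
Proof. exact: rmorphM. Qed.

Lemma ReCD x y : complex.Re (x + y) = complex.Re x + complex.Re y.
Proof. by case: x y => [a b] [c e]. Qed.

Lemma ImCD x y : complex.Im (x + y) = complex.Im x + complex.Im y.
Proof. by case: x y => [a b] [c e]. Qed.

Lemma ReC_conj x : complex.Re (x^*)%C = complex.Re x.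
Proof. by case: x. Qed.

Lemma ImC_conj x : complex.Im (x^*)%C = - complex.Im x.
Proof. by case: x. Qed.

Lemma complex_ext x y :
  complex.Re x = complex.Re y -> complex.Im x = complex.Im y -> x = y.
Proof. by case: x y => [a b] [c e] /= -> ->. Qed.

Lemma normc_sqrE x : normc x ^+ 2 = complex.Re x ^+ 2 + complex.Im x ^+ 2.
Proof. by case: x => a b /=; rewrite sqr_sqrtr// addr_ge0// sqr_ge0. Qed.

Lemma normc_ge0 x : 0 <= normc x.
Proof. by case: x => a b; exact: sqrtr_ge0. Qed.

Lemma normc_eqE x : normc x = Num.sqrt (complex.Re x ^+ 2 + complex.Im x ^+ 2).
Proof. by case: x. Qed.

Lemma ler_Re_normc x : `|complex.Re x| <= normc x.
Proof.
by case: x => a b /=; rewrite -sqrtr_sqr ler_wsqrtr// lerDl sqr_ge0.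
Qed.

Lemma ler_Im_normc x : `|complex.Im x| <= normc x.
Proof.
by case: x => a b /=; rewrite -sqrtr_sqr ler_wsqrtr// lerDr sqr_ge0.
Qed.

Lemma ler_normc_ReIm x : normc x <= `|complex.Re x| + `|complex.Im x|.
Proof.
rewrite -[leRHS]ger0_norm ?addr_ge0// -sqrtr_sqr normc_eqE ler_wsqrtr//.
rewrite sqrrD !real_normK ?num_real// lerD2r lerDl.
by rewrite mulrn_wge0// mulr_ge0.
Qed.

Lemma normc_realE a : normc (a%:C) = `|a|.
Proof. by rewrite /= expr0n/= addr0 sqrtr_sqr. Qed.

Lemma cisD a b : cis (a + b) = cis a * cis b.
Proof. by rewrite /cis sinD cosD; apply: complex_ext => /=; ring. Qed.

Lemma cis0 : cis (0 : R) = 1.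
Proof. by rewrite /cis cos0 sin0. Qed.

Lemma normc_cis a : normc (cis a) = 1.
Proof. by rewrite /= cos2Dsin2 sqrtr1. Qed.

Lemma cis_sum I (s : seq I) (P : pred I) (F : I -> R) :
  cis (\sum_(i <- s | P i) F i) = \prod_(i <- s | P i) cis (F i).
Proof. by elim/big_rec2 : _ => [|i u v _ <-]; rewrite ?cis0// cisD. Qed.

Lemma ReC_sum I (s : seq I) (P : pred I) (F : I -> C) :
  complex.Re (\sum_(i <- s | P i) F i) = \sum_(i <- s | P i) complex.Re (F i).
Proof. by elim/big_rec2 : _ => // i u v _ <-; rewrite ReCD. Qed.

Lemma ImC_sum I (s : seq I) (P : pred I) (F : I -> C) :
  complex.Im (\sum_(i <- s | P i) F i) = \sum_(i <- s | P i) complex.Im (F i).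
Proof. by elim/big_rec2 : _ => // i u v _ <-; rewrite ImCD. Qed.

Lemma normc_prod I (s : seq I) (P : pred I) (F : I -> C) :
  normc (\prod_(i <- s | P i) F i) = \prod_(i <- s | P i) normc (F i).
Proof. by elim/big_rec2 : _ => [|i u v _ <-]; rewrite ?normc1// normcM. Qed.

End complex_numbers.

Section measurability.
Context d (T : measurableType d) {R : realType}.
Local Notation C := R[i].
Implicit Types (f g : T -> C).

Definition Cmeasurable f :=
  measurable_fun [set: T] (fun x => complex.Re (f x)) /\
  measurable_fun [set: T] (fun x => complex.Im (f x)).

Lemma Cmeasurable_real (f : T -> R) :
  measurable_fun [set: T] f -> Cmeasurable (fun x => (f x)%:C).
Proof. by move=> mf; split => //=; exact: measurable_cst. Qed.

Lemma Cmeasurable_cst (c : C) : Cmeasurable (fun=> c).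
Proof. by split; exact: measurable_cst. Qed.

Lemma CmeasurableD f g :
  Cmeasurable f -> Cmeasurable g -> Cmeasurable (fun x => f x + g x).
Proof.
move=> [f1 f2] [g1 g2]; split.
- by under eq_fun do rewrite ReCD; exact: measurable_funD.
- by under eq_fun do rewrite ImCD; exact: measurable_funD.
Qed.

Lemma CmeasurableM f g :
  Cmeasurable f -> Cmeasurable g -> Cmeasurable (fun x => f x * g x).
Proof.
move=> [f1 f2] [g1 g2]; split.
- under eq_fun do rewrite ReCM.
  by apply: measurable_funB; exact: measurable_funM.
- under eq_fun do rewrite ImCM.
  by apply: measurable_funD; exact: measurable_funM.
Qed.

Lemma Cmeasurable_conj f : Cmeasurable f -> Cmeasurable (fun x => (f x)^*)%C.
Proof.
move=> [f1 f2]; split; first by under eq_fun do rewrite ReC_conj.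
by under eq_fun do rewrite ImC_conj; exact: measurableT_comp.
Qed.

Lemma Cmeasurable_cis (f : T -> R) :
  measurable_fun [set: T] f -> Cmeasurable (fun x => cis (f x)).
Proof.
move=> mf; split => /=.
- by apply: measurableT_comp mf; exact: (continuous_measurable_fun (@continuous_cos R)).
- by apply: measurableT_comp mf; exact: (continuous_measurable_fun (@continuous_sin R)).
Qed.

Lemma Cmeasurable_sum I (s : seq I) (F : I -> T -> C) :
  (forall i, Cmeasurable (F i)) -> Cmeasurable (fun x => \sum_(i <- s) F i x).
Proof.
move=> mF; elim: s => [|i s IH].
  by under eq_fun do rewrite big_nil; exact: Cmeasurable_cst.
by under eq_fun do rewrite big_cons; exact: CmeasurableD.
Qed.

Lemma Cmeasurable_prod I (s : seq I) (F : I -> T -> C) :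
  (forall i, Cmeasurable (F i)) -> Cmeasurable (fun x => \prod_(i <- s) F i x).
Proof.
move=> mF; elim: s => [|i s IH].
  by under eq_fun do rewrite big_nil; exact: Cmeasurable_cst.
by under eq_fun do rewrite big_cons; exact: CmeasurableM.
Qed.

Lemma measurable_normc f :
  Cmeasurable f -> measurable_fun [set: T] (fun x => normc (f x)).
Proof.
move=> [f1 f2]; under eq_fun do rewrite normc_eqE.
apply: (@measurableT_comp _ _ _ _ _ _ (@Num.sqrt R)).
  exact: (continuous_measurable_fun (@sqrt_continuous R)).
by apply: measurable_funD; exact: measurable_funX.
Qed.

End measurability.

Lemma Cmeasurable_comp d1 d2 (T1 : measurableType d1) (T2 : measurableType d2)
    (R : realType) (f : T2 -> R[i]) (phi : T1 -> T2) :
  measurable_fun [set: T1] phi -> Cmeasurable f -> Cmeasurable (fun x => f (phi x)).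
Proof.
move=> mphi [f1 f2]; split.
- exact: (measurableT_comp f1 mphi).
- exact: (measurableT_comp f2 mphi).
Qed.

Section complex_integral.
Context d (T : measurableType d) {R : realType}.
Variable mu : {measure set T -> \bar R}.
Local Notation C := R[i].
Implicit Types (f g : T -> C) (h k : T -> R).

Definition rintegrable h := mu.-integrable [set: T] (fun x => (h x)%:E).

Definition Cintegrable f :=
  rintegrable (fun x => complex.Re (f x)) /\
  rintegrable (fun x => complex.Im (f x)).

Lemma rintegrable_measurable h : rintegrable h -> measurable_fun [set: T] h.
Proof. by move=> /integrableP[+ _]; move/measurable_EFinP. Qed.

Lemma rintegrable_dominated h k : measurable_fun [set: T] h ->
  rintegrable k -> (forall x, `|h x| <= k x) -> rintegrable h.
Proof.
move=> mh ik hk; apply: (le_integrable measurableT _ _ ik).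
  exact/measurable_EFinP.
by move=> x _ /=; rewrite lee_fin (le_trans (hk x))// ler_norm.
Qed.

Lemma rintegrableD h k : rintegrable h -> rintegrable k ->
  rintegrable (fun x => h x + k x).
Proof. exact: integrableD. Qed.

Lemma rintegrableB h k : rintegrable h -> rintegrable k ->
  rintegrable (fun x => h x - k x).
Proof. exact: integrableB. Qed.

Lemma rintegrableZl c h : rintegrable h -> rintegrable (fun x => c * h x).
Proof. exact: integrableZl. Qed.

Lemma rintegrable_norm h : rintegrable h -> rintegrable (fun x => `|h x|).
Proof. exact: integrable_norm. Qed.

Lemma rintegrable_ge0 h : measurable_fun [set: T] h -> (forall x, 0 <= h x) ->
  (\int[mu]_x (h x)%:E < +oo)%E -> rintegrable h.
Proof.
move=> mh h0 hoo; apply/integrableP; split; first exact/measurable_EFinP.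
by under eq_integral do rewrite /= ger0_norm//.
Qed.

Lemma rintegrable_lty h : rintegrable h -> (\int[mu]_x (h x)%:E < +oo)%E.
Proof. by move=> /integrable_lty; apply. Qed.

Lemma EFin_Rintegral h : rintegrable h ->
  (\int[mu]_x h x)%:E = (\int[mu]_x (h x)%:E)%E.
Proof. by move=> ih; rewrite /Rintegral fineK//; exact: integrable_fin_num. Qed.

Lemma rintegralZl c h : rintegrable h ->
  \int[mu]_x (c * h x) = c * \int[mu]_x h x.
Proof. by move=> ih; rewrite RintegralZl. Qed.

Lemma rintegralD h k : rintegrable h -> rintegrable k ->
  \int[mu]_x (h x + k x) = \int[mu]_x h x + \int[mu]_x k x.
Proof. by move=> ih ik; rewrite RintegralD. Qed.

Lemma rintegralB h k : rintegrable h -> rintegrable k ->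
  \int[mu]_x (h x - k x) = \int[mu]_x h x - \int[mu]_x k x.
Proof. by move=> ih ik; rewrite RintegralB. Qed.

Lemma Cintegrable_measurable f : Cintegrable f -> Cmeasurable f.
Proof. by move=> [f1 f2]; split; exact: rintegrable_measurable. Qed.

Lemma Cintegrable_dominated f k : Cmeasurable f ->
  rintegrable k -> (forall x, normc (f x) <= k x) -> Cintegrable f.
Proof.
move=> [f1 f2] ik fk; split; apply: (rintegrable_dominated _ ik) => // x.
- exact: le_trans (ler_Re_normc _) _.
- exact: le_trans (ler_Im_normc _) _.
Qed.

Lemma Cintegrable_normc f : Cintegrable f -> rintegrable (fun x => normc (f x)).
Proof.
move=> [f1 f2].
have mf : Cmeasurable f by exact: Cintegrable_measurable.
apply: (rintegrable_dominated (measurable_normc mf)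
  (rintegrableD (rintegrable_norm f1) (rintegrable_norm f2))) => x.
by rewrite ger0_norm ?normc_ge0//; exact: ler_normc_ReIm.
Qed.

Lemma Cintegrable_real h : rintegrable h -> Cintegrable (fun x => (h x)%:C).
Proof. by move=> ih; split => //=; exact: integrable0. Qed.

Lemma CintegrableZl (c : C) f : Cintegrable f -> Cintegrable (fun x => c * f x).
Proof.
move=> [f1 f2]; split.
- under eq_fun do rewrite ReCM.
  by apply: rintegrableB; exact: rintegrableZl.
- under eq_fun do rewrite ImCM.
  by apply: rintegrableD; exact: rintegrableZl.
Qed.

Lemma eq_Cintegral f g : f =1 g -> Cintegral mu f = Cintegral mu g.
Proof. by move=> /funext ->. Qed.

Lemma Cintegral0 : Cintegral mu (fun=> 0) = 0.
Proof. by rewrite /Cintegral /= /Rintegral integral0. Qed.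

Lemma Cintegral_real h : Cintegral mu (fun x => (h x)%:C) = (\int[mu]_x h x)%:C.
Proof. by rewrite /Cintegral /= {2}/Rintegral integral0. Qed.

Lemma CintegralD f g : Cintegrable f -> Cintegrable g ->
  Cintegral mu (fun x => f x + g x) = Cintegral mu f + Cintegral mu g.
Proof.
move=> [f1 f2] [g1 g2]; apply: complex_ext; rewrite /Cintegral /=.
- by under eq_Rintegral do rewrite ReCD; rewrite RintegralD.
- by under eq_Rintegral do rewrite ImCD; rewrite RintegralD.
Qed.

Lemma CintegralZl (c : C) f : Cintegrable f ->
  Cintegral mu (fun x => c * f x) = c * Cintegral mu f.
Proof.
move=> [f1 f2]; apply: complex_ext; rewrite ?ReCM ?ImCM /Cintegral /=.
- under eq_Rintegral do rewrite ReCM.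
  by rewrite RintegralB ?RintegralZl//; exact: rintegrableZl.
- under eq_Rintegral do rewrite ImCM.
  by rewrite RintegralD ?RintegralZl//; exact: rintegrableZl.
Qed.

(** The factor 2 comes from bounding the real and imaginary parts separately. *)
Lemma normc_Cintegral_le f : Cintegrable f ->
  normc (Cintegral mu f) <= 2 * \int[mu]_x normc (f x).
Proof.
move=> fi; have [f1 f2] := fi; have nf := Cintegrable_normc fi.
rewrite (le_trans (ler_normc_ReIm _))// mulr_natl mulr2n lerD//.
- rewrite (le_trans (le_normr_Rintegral _ _))// le_Rintegral//.
  + exact: rintegrable_norm f1.
  + by move=> x _; exact: ler_Re_normc.
- rewrite (le_trans (le_normr_Rintegral _ _))// le_Rintegral//.
  + exact: rintegrable_norm f2.
  + by move=> x _; exact: ler_Im_normc.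
Qed.

End complex_integral.

Lemma ae_eq_Cintegral d (T : measurableType d) (R : realType)
    (mu : {measure set T -> \bar R}) (f g : T -> R[i]) :
  Cmeasurable f -> Cmeasurable g -> {ae mu, forall x, f x = g x} ->
  Cintegral mu f = Cintegral mu g.
Proof.
move=> [f1 f2] [g1 g2] fg; rewrite /Cintegral /Rintegral; congr (fine _ +i* fine _).
- apply: ae_eq_integral => //; [exact/measurable_EFinP..|].
  by apply: filterS fg => x ->.
- apply: ae_eq_integral => //; [exact/measurable_EFinP..|].
  by apply: filterS fg => x ->.
Qed.

Section fubini.
Context d1 d2 (T1 : measurableType d1) (T2 : measurableType d2) {R : realType}.
Variable m1 : {sigma_finite_measure set T1 -> \bar R}.
Variable m2 : {sigma_finite_measure set T2 -> \bar R}.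
Local Notation C := R[i].

(** The product of two integrable majorants dominates on a product space, which
    is how absolute convergence of the double integrals below is obtained. *)
Lemma rintegrable_prod (g : T1 -> R) (h : T2 -> R) :
  rintegrable m1 g -> rintegrable m2 h ->
  rintegrable (m1 \x m2)%E (fun z => g z.1 * h z.2).
Proof.
move=> ig ih.
have mg := rintegrable_measurable ig; have mh := rintegrable_measurable ih.
have mgh : measurable_fun [set: T1 * T2] (fun z => (g z.1 * h z.2)%:E).
  apply/measurable_EFinP; apply: measurable_funM.
  - exact: (measurableT_comp mg measurable_fst).
  - exact: (measurableT_comp mh measurable_snd).
apply: (integrable12ltyP _ _ mgh).2.
under eq_integral => x _.
  under eq_integral => y _ do rewrite /= normrM EFinM.
  rewrite ge0_integralZl//; last first.
    by apply/measurable_EFinP; exact: measurableT_comp.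
  over.
rewrite /= ge0_integralZr//.
- rewrite lte_mul_pinfty//.
  + exact: integral_ge0.
  + by have /integrable_norm/integrable_fin_num := ig; apply.
  + exact: rintegrable_lty (rintegrable_norm ih).
- by apply/measurable_EFinP; exact: measurableT_comp.
- exact: integral_ge0.
Qed.

Lemma Rintegral_fubini (f : T1 * T2 -> R) : rintegrable (m1 \x m2)%E f ->
  \int[m1]_x \int[m2]_y f (x, y) = \int[m2]_y \int[m1]_x f (x, y).
Proof.
move=> fi.
have -> : \int[m1]_x \int[m2]_y f (x, y) =
    fine (\int[m1]_x \int[m2]_y (f (x, y))%:E)%E.
  congr fine; apply: ae_eq_integral => //.
  - apply/measurable_EFinP; apply: (measurableT_comp (fine_measurable measurableT)).
    exact: (measurable_fubini_F fi).
  - exact: (measurable_fubini_F fi).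
  - apply: filterS (ae_integrable1 fi) => x /= + _ => ix.
    by rewrite EFin_Rintegral.
have -> : \int[m2]_y \int[m1]_x f (x, y) =
    fine (\int[m2]_y \int[m1]_x (f (x, y))%:E)%E.
  congr fine; apply: ae_eq_integral => //.
  - apply/measurable_EFinP; apply: (measurableT_comp (fine_measurable measurableT)).
    exact: (measurable_fubini_G fi).
  - exact: (measurable_fubini_G fi).
  - apply: filterS (ae_integrable2 fi) => x /= + _ => ix.
    by rewrite EFin_Rintegral.
by rewrite (Fubini fi).
Qed.

Lemma Rintegral_prod (f : T1 * T2 -> R) : rintegrable (m1 \x m2)%E f ->
  \int[(m1 \x m2)%E]_z f z = \int[m1]_x \int[m2]_y f (x, y).
Proof.
move=> fi; rewrite {1}/Rintegral -(integral12_prod_meas1 fi); congr fine.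
apply: ae_eq_integral => //.
- exact: (measurable_fubini_F fi).
- apply/measurable_EFinP; apply: (measurableT_comp (fine_measurable measurableT)).
  exact: (measurable_fubini_F fi).
- apply: filterS (ae_integrable1 fi) => x /= + _ => ix.
  by rewrite EFin_Rintegral.
Qed.

(** Tonelli applies to the positive and negative parts, and the difference of
    the two extended-real partial integrals is measurable whatever their
    values. *)
Lemma emeasurable_partial_integral1 (f : T1 * T2 -> \bar R) :
  measurable_fun [set: T1 * T2] f ->
  measurable_fun [set: T1] (fun x => \int[m2]_y f (x, y))%E.
Proof.
move=> mf; under eq_fun => x.
  rewrite integralE; under eq_integral do rewrite funepos_comp/=.
  under [X in (_ - X)%E]eq_integral do rewrite funeneg_comp/=.
  over.
apply: emeasurable_funB.
- exact: (measurable_fun_fubini_tonelli_F _ (measurable_funepos mf)).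
- exact: (measurable_fun_fubini_tonelli_F _ (measurable_funeneg mf)).
Qed.

Lemma emeasurable_partial_integral2 (f : T1 * T2 -> \bar R) :
  measurable_fun [set: T1 * T2] f ->
  measurable_fun [set: T2] (fun y => \int[m1]_x f (x, y))%E.
Proof.
move=> mf; under eq_fun => x.
  rewrite integralE; under eq_integral do rewrite funepos_comp/=.
  under [X in (_ - X)%E]eq_integral do rewrite funeneg_comp/=.
  over.
apply: emeasurable_funB.
- exact: (measurable_fun_fubini_tonelli_G _ (measurable_funepos mf)).
- exact: (measurable_fun_fubini_tonelli_G _ (measurable_funeneg mf)).
Qed.

Lemma measurable_partial_integral1 (f : T1 * T2 -> R) :
  measurable_fun [set: T1 * T2] f ->
  measurable_fun [set: T1] (fun x => \int[m2]_y f (x, y)).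
Proof.
move=> mf; apply: (measurableT_comp (fine_measurable measurableT)).
by apply: (@emeasurable_partial_integral1 (fun z => (f z)%:E)); exact/measurable_EFinP.
Qed.

Lemma measurable_partial_integral2 (f : T1 * T2 -> R) :
  measurable_fun [set: T1 * T2] f ->
  measurable_fun [set: T2] (fun y => \int[m1]_x f (x, y)).
Proof.
move=> mf; apply: (measurableT_comp (fine_measurable measurableT)).
by apply: (@emeasurable_partial_integral2 (fun z => (f z)%:E)); exact/measurable_EFinP.
Qed.

Lemma rintegrable_partial_integral1 (f : T1 * T2 -> R) :
  rintegrable (m1 \x m2)%E f -> rintegrable m1 (fun x => \int[m2]_y f (x, y)).
Proof.
move=> fi.
have [M1 M2] : measurable_fun [set: T1] (fun x => (\int[m2]_y f (x, y))%:E) /\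
    m1.-integrable [set: T1] (fun x => (\int[m2]_y (f (x, y))%:E)%E).
  split; last exact: (integrable_fubini_F fi).
  apply/measurable_EFinP/measurable_partial_integral1.
  exact: rintegrable_measurable fi.
apply/integrableP; split => //.
move/integrableP: (M2) => [mM]; apply: le_lt_trans.
rewrite le_eqVlt; apply/orP; left; apply/eqP/ae_eq_integral => //.
- exact: measurableT_comp.
- exact: measurableT_comp.
- apply: filterS (ae_integrable1 fi) => x /= + _ => ix.
  by rewrite -(EFin_Rintegral ix).
Qed.

Lemma rintegrable_partial_integral2 (f : T1 * T2 -> R) :
  rintegrable (m1 \x m2)%E f -> rintegrable m2 (fun y => \int[m1]_x f (x, y)).
Proof.
move=> fi; have mf := rintegrable_measurable fi.
have mef : measurable_fun [set: T1 * T2] (fun z => (f z)%:E).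
  exact/measurable_EFinP.
have mG := measurable_partial_integral2 mf.
apply/integrableP; split; first exact/measurable_EFinP.
apply: le_lt_trans ((integrable21ltyP _ _ mef).1 fi).
apply: ae_ge0_le_integral => //.
- by apply: measurableT_comp => //; exact/measurable_EFinP.
- by move=> y _; exact: integral_ge0.
- apply: (@emeasurable_partial_integral2 (fun z => `|(f z)%:E|%E)).
  exact: measurableT_comp.
- apply: filterS (ae_integrable2 fi) => y /= + _ => iy.
  rewrite -abse_EFin (EFin_Rintegral iy) le_abse_integral//.
  exact: measurable_int iy.
Qed.

Lemma Cintegral_fubini (f : T1 * T2 -> C) : Cintegrable (m1 \x m2)%E f ->
  Cintegral m1 (fun x => Cintegral m2 (fun y => f (x, y))) =
  Cintegral m2 (fun y => Cintegral m1 (fun x => f (x, y))).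
Proof.
move=> [f1 f2]; rewrite /Cintegral /=; congr (_ +i* _).
- exact: (Rintegral_fubini f1).
- exact: (Rintegral_fubini f2).
Qed.

Lemma Cintegral_prod (f : T1 * T2 -> C) : Cintegrable (m1 \x m2)%E f ->
  Cintegral (m1 \x m2)%E f = Cintegral m1 (fun x => Cintegral m2 (fun y => f (x, y))).
Proof.
move=> [f1 f2]; rewrite /Cintegral /=; congr (_ +i* _).
- exact: (Rintegral_prod f1).
- exact: (Rintegral_prod f2).
Qed.

End fubini.

(** * Real square-integrable functions *)

Section square_integrable.
Context d (T : measurableType d) {R : realType}.
Variable mu : {measure set T -> \bar R}.
Implicit Types (f g : T -> R).

Definition sqintegrable f :=
  measurable_fun [set: T] f /\ rintegrable mu (fun x => f x ^+ 2).

Definition ip f g := \int[mu]_x (f x * g x).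

Lemma rintegrableM f g : sqintegrable f -> sqintegrable g ->
  rintegrable mu (fun x => f x * g x).
Proof.
move=> [mf f2] [mg g2].
apply: (rintegrable_dominated _ (rintegrableD f2 g2)).
  exact: measurable_funM.
move=> x; rewrite normrM -(real_normK (num_real (f x))).
rewrite -(real_normK (num_real (g x))).
have := sqr_ge0 (`|f x| - `|g x|); have := mulr_ge0 (normr_ge0 (f x)) (normr_ge0 (g x)).
by nra.
Qed.

Lemma sqintegrable_ge0 f : measurable_fun [set: T] f ->
  (\int[mu]_x (f x ^+ 2)%:E < +oo)%E -> sqintegrable f.
Proof.
move=> mf foo; split=> //; apply: rintegrable_ge0 => //.
- exact: measurable_funX.
- by move=> x; exact: sqr_ge0.
Qed.

Lemma sqintegrableD f g : sqintegrable f -> sqintegrable g ->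
  sqintegrable (fun x => f x + g x).
Proof.
move=> sf sg; split; first exact: measurable_funD sf.1 sg.1.
under eq_fun do rewrite sqrrD.
apply: rintegrableD; last exact: sg.2.
apply: rintegrableD; first exact: sf.2.
under eq_fun do rewrite -mulr_natl.
by apply: rintegrableZl; exact: rintegrableM.
Qed.

Lemma sqintegrableZl (c : R) f : sqintegrable f -> sqintegrable (fun x => c * f x).
Proof.
move=> sf; split; first by apply: measurable_funM => //; exact: sf.1.
by under eq_fun do rewrite exprMn; apply: rintegrableZl; exact: sf.2.
Qed.

Lemma sqintegrableB f g : sqintegrable f -> sqintegrable g ->
  sqintegrable (fun x => f x - g x).
Proof.
move=> sf sg; have := sqintegrableD sf (sqintegrableZl (-1) sg).
by under eq_fun do rewrite mulN1r.
Qed.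

Lemma sqintegrable0 : sqintegrable (fun=> 0).
Proof.
split; first exact: measurable_cst.
by under eq_fun do rewrite expr0n; exact: integrable0.
Qed.

Lemma sqintegrable_sum I (s : seq I) (F : I -> T -> R) :
  (forall i, sqintegrable (F i)) -> sqintegrable (fun x => \sum_(i <- s) F i x).
Proof.
move=> mF; elim: s => [|i s IH].
  by under eq_fun do rewrite big_nil; exact: sqintegrable0.
by under eq_fun do rewrite big_cons; exact: sqintegrableD.
Qed.

Lemma sqintegrable_dominated f g : measurable_fun [set: T] f ->
  sqintegrable g -> (forall x, `|f x| <= `|g x|) -> sqintegrable f.
Proof.
move=> mf [mg g2] fg; split=> //.
apply: (rintegrable_dominated _ g2); first exact: measurable_funX.
by move=> x; rewrite normrX -(real_normK (num_real (g x))) lerXn2r// nnegrE.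
Qed.

Lemma ipC f g : ip f g = ip g f.
Proof. by apply: eq_Rintegral => x _; rewrite mulrC. Qed.

Lemma ipDl f g h : sqintegrable f -> sqintegrable g -> sqintegrable h ->
  ip (fun x => f x + g x) h = ip f h + ip g h.
Proof.
move=> sf sg sh; rewrite /ip; under eq_Rintegral do rewrite mulrDl.
by rewrite RintegralD//; exact: rintegrableM.
Qed.

Lemma ipZl c f h : sqintegrable f -> sqintegrable h ->
  ip (fun x => c * f x) h = c * ip f h.
Proof.
move=> sf sh; rewrite /ip; under eq_Rintegral do rewrite -mulrA.
by rewrite RintegralZl//; exact: rintegrableM.
Qed.

Lemma ipBl f g h : sqintegrable f -> sqintegrable g -> sqintegrable h ->
  ip (fun x => f x - g x) h = ip f h - ip g h.
Proof.
move=> sf sg sh; rewrite /ip; under eq_Rintegral do rewrite mulrBl.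
by rewrite RintegralB//; exact: rintegrableM.
Qed.

Lemma ip_suml I (s : seq I) (F : I -> T -> R) h :
  (forall i, sqintegrable (F i)) -> sqintegrable h ->
  ip (fun x => \sum_(i <- s) F i x) h = \sum_(i <- s) ip (F i) h.
Proof.
move=> sF sh; elim: s => [|i s IH].
  rewrite big_nil; under [LHS]eq_Rintegral do rewrite big_nil mul0r.
  by rewrite /Rintegral integral0.
rewrite big_cons -IH -ipDl//; last exact: sqintegrable_sum.
by apply: eq_Rintegral => x _; rewrite big_cons.
Qed.

Lemma ip_ge0 f : 0 <= ip f f.
Proof. by apply: Rintegral_ge0 => x _; rewrite -expr2 sqr_ge0. Qed.

Lemma ip_sqr f : ip f f = \int[mu]_x (f x ^+ 2).
Proof. by []. Qed.

Lemma ip_sqrD f g : sqintegrable f -> sqintegrable g ->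
  ip (fun x => f x + g x) (fun x => f x + g x) = ip f f + 2 * ip f g + ip g g.
Proof.
move=> sf sg; have sfg := sqintegrableD sf sg.
by rewrite ipDl// (ipC f (fun x => _)) (ipC g (fun x => _)) !ipDl// (ipC g f); ring.
Qed.

(** The quadratic polynomial [t |-> |f + t g|^2] is nonnegative; the degenerate
    case, where it is affine, is treated apart. *)
Lemma cauchy_schwarz f g : sqintegrable f -> sqintegrable g ->
  ip f g ^+ 2 <= ip f f * ip g g.
Proof.
move=> sf sg; have gg := ip_ge0 g.
have H t : 0 <= ip f f + 2 * (t * ip f g) + t ^+ 2 * ip g g.
  have stg := sqintegrableZl t sg.
  have := ip_ge0 (fun x => f x + t * g x).
  rewrite ip_sqrD// (ipC f) ipZl// ipZl// (ipC g (fun x => t * g x)) ipZl//.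
  by rewrite (ipC g f) mulrA -expr2.
move: gg; rewrite le_eqVlt => /predU1P[g0|gg].
  rewrite -g0 mulr0; have ff := ip_ge0 f.
  have [->|fg0] := eqVneq (ip f g) 0; first by rewrite expr0n.
  have := H (- (ip f f + 1) / ip f g); rewrite -g0 divfK// => {}H.
  by have := sqr_ge0 (ip f g); nra.
have := H (- (ip f g / ip g g)) => {}H.
have e : ip f g / ip g g * ip g g = ip f g by rewrite divfK// gt_eqF.
set r := ip f g / ip g g in H e.
rewrite -e; rewrite -e in H.
by have := mulr_ge0 (ltW gg) H; nra.
Qed.

Lemma cauchy_schwarz_norm f g : sqintegrable f -> sqintegrable g ->
  `|ip f g| <= Num.sqrt (ip f f) * Num.sqrt (ip g g).
Proof.
move=> sf sg; rewrite -sqrtrM ?ip_ge0// -sqrtr_sqr ler_wsqrtr//.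
exact: cauchy_schwarz.
Qed.

Lemma ip_sqrD_le f g : sqintegrable f -> sqintegrable g ->
  ip (fun x => f x + g x) (fun x => f x + g x) <= 2 * ip f f + 2 * ip g g.
Proof.
move=> sf sg; rewrite ip_sqrD//.
have := ip_ge0 (fun x => f x - g x).
have sgm := sqintegrableZl (-1) sg.
rewrite (_ : (fun x => f x - g x) = (fun x => f x + -1 * g x)); last first.
  by apply/funext => x; rewrite mulN1r.
rewrite ip_sqrD// (ipC f) !ipZl// (ipC g (fun x => -1 * g x)) !ipZl// (ipC g f).
by nra.
Qed.

Lemma ip_eq0_ae f : sqintegrable f -> ip f f = 0 ->
  {ae mu, forall x, f x = 0}.
Proof.
move=> [mf f2] f0.
have m2 : measurable_fun [set: T] (fun x => (f x ^+ 2)%:E).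
  by apply/measurable_EFinP; exact: measurable_funX.
have : (\int[mu]_x `|(f x ^+ 2)%:E| = 0)%E.
  under eq_integral do rewrite /= ger0_norm ?sqr_ge0//.
  by rewrite -EFin_Rintegral// -ip_sqr f0.
move/(ae_eq_integral_abs mu measurableT m2).1.
apply: filterS => x /(_ I)/= [] /eqP; rewrite sqrf_eq0 => /eqP //.
Qed.

Section orthonormal.
Variables (I : eqType) (e : I -> T -> R).
Hypothesis se : forall i, sqintegrable (e i).
Hypothesis oe : forall i j, ip (e i) (e j) = (i == j)%:R.

Definition orthoproj (s : seq I) f := fun x => \sum_(i <- s) ip f (e i) * e i x.

Lemma sqintegrable_orthoproj s f : sqintegrable (orthoproj s f).
Proof.
apply: (@sqintegrable_sum _ _ (fun i x => ip f (e i) * e i x)) => i.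
exact: sqintegrableZl.
Qed.

Lemma ip_orthoproj s f g : sqintegrable f -> sqintegrable g ->
  ip (orthoproj s f) g = \sum_(i <- s) ip f (e i) * ip g (e i).
Proof.
move=> sf sg; rewrite (@ip_suml _ _ (fun i x => ip f (e i) * e i x))//; last first.
  by move=> i; exact: sqintegrableZl.
by apply: eq_bigr => i _; rewrite ipZl// (ipC g).
Qed.

Lemma ip_orthoproj_basis s f i : uniq s -> sqintegrable f ->
  ip (orthoproj s f) (e i) = (i \in s)%:R * ip f (e i).
Proof.
move=> us sf; rewrite ip_orthoproj//.
under eq_bigr do rewrite oe.
case: (boolP (i \in s)) => is_ /=.
  rewrite (bigD1_seq i)//= eqxx mulr1 big1 ?addr0 ?mul1r// => j ji.
  by rewrite eq_sym (negbTE ji) mulr0.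
rewrite big_seq big1 ?mul0r// => j js; case: eqP => [ij|_]; last by rewrite mulr0.
by move: is_; rewrite ij js.
Qed.

(** Pythagoras: what is left of the energy of [f] after projecting. *)
Lemma ip_residual s f g : uniq s -> sqintegrable f -> sqintegrable g ->
  ip (fun x => f x - orthoproj s f x) (fun x => g x - orthoproj s g x) =
  ip f g - \sum_(i <- s) ip f (e i) * ip g (e i).
Proof.
move=> us sf sg.
have sPf := sqintegrable_orthoproj s f; have sPg := sqintegrable_orthoproj s g.
have srg := sqintegrableB sg sPg.
rewrite ipBl// ip_orthoproj//.
rewrite big_seq [X in _ - X]big1 => [|i is_]; last first.
  by rewrite ipBl// ip_orthoproj_basis// is_ mul1r subrr mulr0.
rewrite subr0 ipC ipBl// (ipC g) ip_orthoproj//; congr (_ - _).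
by apply: eq_bigr => i _; rewrite mulrC.
Qed.

End orthonormal.

End square_integrable.

Section dominated_convergence_real.
Context d (T : measurableType d) {R : realType}.
Variable mu : {measure set T -> \bar R}.

Lemma Rintegral_dominated_cvg (f_ : nat -> T -> R) (f g : T -> R) :
  (forall n, measurable_fun [set: T] (f_ n)) -> measurable_fun [set: T] f ->
  {ae mu, forall x, f_ ^~ x @ \oo --> f x} -> rintegrable mu g ->
  (forall n x, `|f_ n x| <= g x) ->
  rintegrable mu f /\ \int[mu]_x f_ n x @[n --> \oo] --> \int[mu]_x f x.
Proof.
move=> mf_ mf ff ig fg.
have ffE : {ae mu, forall x, [set: T] x -> (f_ n x)%:E @[n --> \oo] --> (f x)%:E}.
  by apply: filterS ff => x fx _; apply/fine_cvgP; split => //; exact: nearW.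
have [fi _ fc] := @dominated_convergence _ T R mu setT measurableT
  (fun n x => (f_ n x)%:E) (fun x => (f x)%:E) (fun x => (g x)%:E)
  (fun n => (measurable_EFinP _ _).2 (mf_ n)) ((measurable_EFinP _ _).2 mf)
  ffE ig
  (aeW _ (fun x n _ => fg n x)).
split => //; move: fc; rewrite -EFin_Rintegral// => /fine_cvg; exact.
Qed.

End dominated_convergence_real.

(** * Gaussian integrals on the line *)

Notation leb := (@lebesgue_measure _).

Section gaussian.
Context {R : realType}.
Local Notation C := R[i].
Implicit Types (k b e x : R).

Definition gauss k x : R := expR (- (k * x ^+ 2)).

Lemma gauss_ge0 k x : 0 <= gauss k x. Proof. exact: expR_ge0. Qed.

Lemma gauss_gt0 k x : 0 < gauss k x. Proof. exact: expR_gt0. Qed.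

Lemma gaussD k1 k2 x : gauss (k1 + k2) x = gauss k1 x * gauss k2 x.
Proof. by rewrite /gauss -expRD mulrDl opprD. Qed.

Lemma gauss_le1 k x : 0 <= k -> gauss k x <= 1.
Proof. by move=> k0; rewrite -expR0 ler_expR oppr_le0 mulr_ge0// sqr_ge0. Qed.

Lemma measurable_gauss k : measurable_fun [set: R] (gauss k).
Proof.
apply: measurableT_comp => //; apply: measurable_funN.
by apply: measurable_funM => //; exact: measurable_funX.
Qed.

Lemma gauss_normal k : 0 < k -> rintegrable leb (gauss k) /\
  \int[leb]_x gauss k x = Num.sqrt (pi / k).
Proof.
move=> k0; pose s := (Num.sqrt (2 * k))^-1.
have k20 : 0 < 2 * k by rewrite mulr_gt0.
have s0 : s != 0 by rewrite invr_eq0 gt_eqF// sqrtr_gt0.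
have s2 : s ^+ 2 *+ 2 = k^-1.
  by rewrite exprVn sqr_sqrtr ?ltW// -mulr_natl; field; rewrite gt_eqF.
have p0 : 0 < Num.sqrt (pi / k) by rewrite sqrtr_gt0 divr_gt0// pi_gt0.
have E : gauss k = (fun x => Num.sqrt (pi / k) * normal_pdf 0 s x).
  apply/funext => x; rewrite normal_pdfE// /normal_peak /normal_fun subr0.
  rewrite -mulrnAl s2 (mulrC _ pi) mulrA divff ?gt_eqF// mul1r.
  by rewrite invrK /gauss mulrC mulNr.
have i0 : rintegrable leb (normal_pdf 0 s) := integrable_normal_pdf 0 s.
rewrite E; split; first exact: rintegrableZl.
by rewrite RintegralZl// /Rintegral integral_normal_pdf mulr1.
Qed.

Lemma rintegrable_gauss k : 0 < k -> rintegrable leb (gauss k).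
Proof. by move=> /gauss_normal[]. Qed.

Lemma Rintegral_gauss k : 0 < k -> \int[leb]_x gauss k x = Num.sqrt (pi / k).
Proof. by move=> /gauss_normal[]. Qed.

Lemma exprn_le_expR (y : R) n : 0 <= y -> y ^+ n <= n`!%:R * expR y.
Proof.
move=> y0; case: n => [|n].
  by rewrite expr0 fact0 mul1r -expR0 ler_expR.
have := expR_ge1Dxn n y0; rewrite [X in 1 + X]mulrC.
rewrite -ler_pdivrMl ?ltr0n ?fact_gt0//.
by move: (_ * _) => t ?; lra.
Qed.

Lemma norm_exprn_le x n : `|x| ^+ n <= 1 + (x ^+ 2) ^+ n.
Proof.
rewrite -[x ^+ 2]real_normK ?num_real// -exprM mulnC exprM.
have y0 : 0 <= `|x| ^+ n by rewrite exprn_ge0.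
by nra.
Qed.

(** Half of the Gaussian decay absorbs any polynomial growth.  Keeping the other
    half gives majorants that are again Gaussian. *)
Lemma exprn_gauss_le n k : 0 < k ->
  exists M : R, 0 <= M /\ forall x, `|x| ^+ n * gauss k x <= M * gauss (k / 2) x.
Proof.
move=> k0; pose K := n`!%:R * (k / 2)^-1 ^+ n : R.
have K0 : 0 <= K by rewrite mulr_ge0// exprn_ge0// invr_ge0 divr_ge0// ltW.
exists (1 + K); split=> [|x]; first by rewrite addr_ge0.
rewrite {1}[k](_ : k = k / 2 + k / 2); last by field.
rewrite gaussD mulrA ler_wpM2r ?gauss_ge0//.
apply: le_trans (ler_wpM2r (gauss_ge0 _ _) (norm_exprn_le x n)) _.
rewrite mulrDl mul1r lerD//; first by rewrite gauss_le1// divr_ge0// ltW.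
have k20 : 0 < k / 2 by rewrite divr_gt0.
have := @exprn_le_expR (k / 2 * x ^+ 2) n.
rewrite mulr_ge0 ?sqr_ge0 ?(ltW k20)// => /(_ isT).
rewrite exprMn mulrC -ler_pdivlMr ?exprn_gt0// => H.
apply: le_trans (ler_wpM2r (gauss_ge0 _ _) H) _.
rewrite [leLHS](_ : _ = K * (expR (k / 2 * x ^+ 2) * expR (- (k / 2 * x ^+ 2)))).
  by rewrite -expRD subrr expR0 mulr1.
by rewrite /K /gauss exprVn; ring.
Qed.

Lemma horner_gauss_le (p : {poly C}) k : 0 < k ->
  exists M : R, 0 <= M /\
    forall x, normc p.[x%:C] * gauss k x <= M * gauss (k / 2) x.
Proof.
move=> k0; have /choice[M HM] := fun n => exprn_gauss_le n k0.
exists (\sum_(i < size p) normc p`_i * M i); split=> [|x].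
  by apply: sumr_ge0 => i _; rewrite mulr_ge0 ?normc_ge0// (HM i).1.
have H : normc p.[x%:C] <= \sum_(i < size p) normc p`_i * `|x| ^+ i.
  rewrite horner_coef; elim/big_rec2 : _ => [|i u v _ le_uv].
    by rewrite normc0.
  rewrite (le_trans (le_normcD _ _))// lerD// normcM -[X in normc (X ^+ _)]/(x%:C).
  by rewrite -(rmorphXn (real_complex R)) normc_realE normrX.
apply: le_trans (ler_wpM2r (gauss_ge0 _ _) H) _; rewrite !mulr_suml ler_sum// => i _.
by rewrite -!mulrA ler_wpM2l ?normc_ge0// (HM i).2.
Qed.

Lemma Rintegral_itv_derive (F f : R -> R) a b : a < b ->
  (forall x, is_derive x (1 : R) F (f x)) -> continuous f ->
  \int[leb]_x (f x * \1_(`[a, b]%classic) x) = F b - F a.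
Proof.
move=> ab dF cf.
have := @continuous_FTC2 R f F a b ab.
rewrite -EFinB => FTC; rewrite /Rintegral.
rewrite -[RHS]/(fine (F b - F a)%:E) -FTC.
- rewrite [in RHS]integral_mkcond; congr fine; apply: eq_integral => x _.
  by rewrite restrict_EFin -[RHS]/(_ %:E) patch_indic.
- exact: continuous_subspaceT.
- split => [x _||].
  + exact: ex_derive.
  + by apply: cvg_at_right_filter; apply: differentiable_continuous;
      apply/derivable1_diffP; exact: ex_derive.
  + by apply: cvg_at_left_filter; apply: differentiable_continuous;
      apply/derivable1_diffP; exact: ex_derive.
- by move=> x _; rewrite derive1E; exact: derive_val.
Qed.
(** The fundamental theorem of calculus on [-n, n] with [n] tending to infinity:
    the boundary terms vanish by Gaussian decay.  Every integration by parts
    below goes through this statement. *)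
Lemma Rintegral_derive_eq0 (F f : R -> R) k M : 0 < k ->
  (forall x, is_derive x 1 F (f x)) -> continuous f ->
  rintegrable leb f -> (forall x, `|F x| <= M * gauss k x) ->
  \int[leb]_x f x = 0.
Proof.
move=> k0 dF cf fi FM.
have FTC (n : nat) : \int[leb]_x (f x * \1_(`[- n.+1%:R, n.+1%:R]%classic) x) =
    F n.+1%:R - F (- n.+1%:R).
  apply: Rintegral_itv_derive => //.
  by have : 0 < n.+1%:R :> R by []; lra.
have mf := rintegrable_measurable fi.
have [|||||_ L1] := @Rintegral_dominated_cvg _ _ R leb
  (fun n x => f x * \1_(`[- n.+1%:R, n.+1%:R]%classic) x) f (fun x => `|f x|).
- by move=> n; apply: measurable_funM => //; exact: measurable_indic.
- exact: mf.
- apply: aeW => x; apply: cvg_near_cst; near=> n.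
  rewrite indicE mem_set ?mulr1//= in_itv/= -ler_norml.
  near: n; exists (Num.bound `|x|) => // n /= nx.
  by rewrite (le_trans (ltW (archi_boundP (normr_ge0 x))))// ler_nat ltnW.
- exact: rintegrable_norm fi.
- move=> n x; rewrite normrM ler_piMr// ger0_norm ?indicE ?ler0n//.
  by case: (_ \in _).
apply/esym/(cvg_unique _ _ L1) => //.
have M0 : 0 <= M.
  have := le_trans (normr_ge0 _) (FM 0).
  by rewrite pmulr_lge0// gauss_gt0.
have FM' x n : `|x| = n.+1%:R -> `|F x| <= M / k * harmonic n.
  move=> xn; apply: le_trans (FM x) _; rewrite -mulrA ler_wpM2l//.
  rewrite /gauss expRN /harmonic/= -invfM lef_pV2 ?posrE ?expR_gt0 ?mulr_gt0//.
  apply: le_trans (expR_ge1Dx _).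
  rewrite -[x ^+ 2]real_normK ?num_real// xn.
  have : 1 <= n.+1%:R :> R by rewrite ler1n.
  move: n.+1%:R => y y1.
  have : 0 <= k * (y * (y - 1)).
    by rewrite !mulr_ge0 ?subr_ge0 ?(ltW k0)// (le_trans ler01).
  by nra.
rewrite (_ : (fun n => _) = (fun n => F n.+1%:R - F (- n.+1%:R))); last exact/funext.
apply/norm_cvg0P/(@squeeze_cvgr _ _ _ _ (cst 0) (fun n => M / k * harmonic n * 2)).
- near=> n; rewrite normr_ge0/= (le_trans (ler_normB _ _))//.
  have := FM' n.+1%:R n (ger0_norm (ler0n _ _)).
  have := FM' (- n.+1%:R) n; rewrite normrN => /(_ (ger0_norm (ler0n _ _))).
  by move: (M / k * harmonic n) => t; lra.
- exact: (@cvg_cst _ (0 : R)).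
- have : M / k * harmonic n * 2 @[n --> \oo] --> M / k * 0 * 2.
    by apply: cvgMr_tmp; apply: cvgMl_tmp; exact: cvg_harmonic.
  by rewrite mulr0 mul0r; exact.
Unshelve. all: by end_near. Qed.

Lemma is_derive_mul (f g : R -> R) x df dg : is_derive x (1 : R) f df ->
  is_derive x (1 : R) g dg ->
  is_derive x (1 : R) (fun y => f y * g y) (df * g x + f x * dg).
Proof.
move=> Hf Hg; apply: is_derive_eq (is_deriveM Hf Hg) _.
by rewrite addrC; congr (_ + _); exact: mulrC.
Qed.

Lemma is_derive_exprn n x :
  is_derive x (1 : R) (fun y : R => y ^+ n) (n%:R * x ^+ n.-1).
Proof.
elim: n => [|n IH].
  rewrite mul0r (_ : (fun y => _) = cst 1); first exact: is_derive_cst.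
  by apply/funext => y; rewrite expr0.
rewrite (_ : (fun y => _) = (fun y => y * y ^+ n)); last first.
  by apply/funext => y; rewrite exprS.
apply: is_derive_eq (is_derive_mul (is_derive_id _ _) IH) _.
by case: n {IH} => [|n] /=; rewrite ?exprS -?(natr1 n.+1); ring.
Qed.

Lemma is_derive_gauss k x :
  is_derive x (1 : R) (gauss k) (- (2 * k * x) * gauss k x).
Proof.
apply: (@is_derive_eq _ _ _ (expR \o (fun x => - (k * x ^+ 2)))).
by rewrite /GRing.scale/= /gauss; ring.
Qed.

Definition phase b e x : R := b * x + e * x ^+ 2.

Lemma is_derive_phase b e x : is_derive x (1 : R) (phase b e) (b + 2 * e * x).
Proof.
apply: is_derive_eq; by rewrite /GRing.scale/=; ring.
Qed.

Definition gcos k b e n x := x ^+ n * (gauss k x * cos (phase b e x)).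
Definition gsin k b e n x := x ^+ n * (gauss k x * sin (phase b e x)).

Lemma is_derive_gcos k b e n x : is_derive x (1 : R) (gcos k b e n)
  (n%:R * gcos k b e n.-1 x - 2 * k * gcos k b e n.+1 x
   - b * gsin k b e n x - 2 * e * gsin k b e n.+1 x).
Proof.
have dX := is_derive_exprn n x.
have dc := @is_derive1_comp _ cos (phase b e) x _ _ (is_derive_cos _) (is_derive_phase b e x).
apply: is_derive_eq (is_derive_mul dX (is_derive_mul (is_derive_gauss k x) dc)) _.
by rewrite /gcos /gsin /GRing.scale/= !exprS; ring.
Qed.

Lemma is_derive_gsin k b e n x : is_derive x (1 : R) (gsin k b e n)
  (n%:R * gsin k b e n.-1 x - 2 * k * gsin k b e n.+1 x
   + b * gcos k b e n x + 2 * e * gcos k b e n.+1 x).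
Proof.
have dX := is_derive_exprn n x.
have dc := @is_derive1_comp _ sin (phase b e) x _ _ (is_derive_sin _) (is_derive_phase b e x).
apply: is_derive_eq (is_derive_mul dX (is_derive_mul (is_derive_gauss k x) dc)) _.
by rewrite /gcos /gsin /GRing.scale/= !exprS; ring.
Qed.

Lemma continuous_gcos k b e n : continuous (gcos k b e n).
Proof.
move=> x; apply: differentiable_continuous; apply/derivable1_diffP.
have h := is_derive_gcos k b e n x; exact: ex_derive.
Qed.

Lemma continuous_gsin k b e n : continuous (gsin k b e n).
Proof.
move=> x; apply: differentiable_continuous; apply/derivable1_diffP.
have h := is_derive_gsin k b e n x; exact: ex_derive.
Qed.

Lemma norm_cos_le1 (t : R) : `|cos t| <= 1.
Proof. by rewrite ler_norml cos_geN1 cos_le1. Qed.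

Lemma norm_sin_le1 (t : R) : `|sin t| <= 1.
Proof. by rewrite ler_norml sin_geN1 sin_le1. Qed.

Lemma gcos_le k b e n x : `|gcos k b e n x| <= `|x| ^+ n * gauss k x.
Proof.
rewrite /gcos !normrM normrX (ger0_norm (gauss_ge0 _ _)).
by rewrite ler_wpM2l// ler_piMr// ?gauss_ge0// norm_cos_le1.
Qed.

Lemma gsin_le k b e n x : `|gsin k b e n x| <= `|x| ^+ n * gauss k x.
Proof.
rewrite /gsin !normrM normrX (ger0_norm (gauss_ge0 _ _)).
by rewrite ler_wpM2l// ler_piMr// ?gauss_ge0// norm_sin_le1.
Qed.

Lemma rintegrable_exprn_gauss k n : 0 < k ->
  rintegrable leb (fun x => `|x| ^+ n * gauss k x).
Proof.
move=> k0; have [M [M0 HM]] := exprn_gauss_le n k0.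
have k20 : 0 < k / 2 by rewrite divr_gt0.
apply: (rintegrable_dominated _ (rintegrableZl M (rintegrable_gauss k20))).
- by apply: measurable_funM; [exact: measurable_funX|exact: measurable_gauss].
- move=> x; rewrite ger0_norm; first exact: HM.
  by rewrite mulr_ge0// ?exprn_ge0// gauss_ge0.
Qed.

Lemma rintegrable_gcos k b e n : 0 < k -> rintegrable leb (gcos k b e n).
Proof.
move=> k0; apply: (rintegrable_dominated _ (rintegrable_exprn_gauss n k0)).
- by apply: continuous_measurable_fun; exact: continuous_gcos.
- exact: gcos_le.
Qed.

Lemma rintegrable_gsin k b e n : 0 < k -> rintegrable leb (gsin k b e n).
Proof.
move=> k0; apply: (rintegrable_dominated _ (rintegrable_exprn_gauss n k0)).
- by apply: continuous_measurable_fun; exact: continuous_gsin.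
- exact: gsin_le.
Qed.

Lemma Rintegral_gcos k b e n : 0 < k ->
  n%:R * \int[leb]_x gcos k b e n.-1 x - 2 * k * \int[leb]_x gcos k b e n.+1 x
  - b * \int[leb]_x gsin k b e n x - 2 * e * \int[leb]_x gsin k b e n.+1 x = 0.
Proof.
move=> k0; have [M [M0 HM]] := exprn_gauss_le n k0.
have ic m := rintegrable_gcos b e m k0; have is_ m := rintegrable_gsin b e m k0.
have iZc c m := rintegrableZl c (ic m); have iZs c m := rintegrableZl c (is_ m).
have iB1 := rintegrableB (iZc n%:R n.-1) (iZc (2 * k) n.+1).
have iB2 := rintegrableB iB1 (iZs b n).
have H0 : \int[leb]_x (n%:R * gcos k b e n.-1 x - 2 * k * gcos k b e n.+1 x
    - b * gsin k b e n x - 2 * e * gsin k b e n.+1 x) = 0; last first.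
  move: H0; rewrite (rintegralB iB2 (iZs (2 * e) n.+1)).
  rewrite (rintegralB iB1 (iZs b n)) (rintegralB (iZc n%:R n.-1) (iZc (2 * k) n.+1)).
  by rewrite (rintegralZl _ (ic n.-1)) (rintegralZl _ (ic n.+1))
    (rintegralZl _ (is_ n)) (rintegralZl _ (is_ n.+1)).
apply: (@Rintegral_derive_eq0 (gcos k b e n) _ (k / 2) M).
- by rewrite divr_gt0.
- by move=> x; exact: is_derive_gcos.
- have cc m := @continuous_gcos k b e m; have cs m := @continuous_gsin k b e m.
  by move=> x; apply: cvgB; [apply: cvgB; [apply: cvgB|]|]; apply: cvgMl_tmp;
    first [exact: cc|exact: cs].
- exact: rintegrableB iB2 (iZs (2 * e) n.+1).
- by move=> x; apply: le_trans (gcos_le _ _ _ _ _) (HM x).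
Qed.

Lemma Rintegral_gsin k b e n : 0 < k ->
  n%:R * \int[leb]_x gsin k b e n.-1 x - 2 * k * \int[leb]_x gsin k b e n.+1 x
  + b * \int[leb]_x gcos k b e n x + 2 * e * \int[leb]_x gcos k b e n.+1 x = 0.
Proof.
move=> k0; have [M [M0 HM]] := exprn_gauss_le n k0.
have ic m := rintegrable_gcos b e m k0; have is_ m := rintegrable_gsin b e m k0.
have iZc c m := rintegrableZl c (ic m); have iZs c m := rintegrableZl c (is_ m).
have iB1 := rintegrableB (iZs n%:R n.-1) (iZs (2 * k) n.+1).
have iB2 := rintegrableD iB1 (iZc b n).
have H0 : \int[leb]_x (n%:R * gsin k b e n.-1 x - 2 * k * gsin k b e n.+1 x
    + b * gcos k b e n x + 2 * e * gcos k b e n.+1 x) = 0; last first.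
  move: H0; rewrite (rintegralD iB2 (iZc (2 * e) n.+1)).
  rewrite (rintegralD iB1 (iZc b n)) (rintegralB (iZs n%:R n.-1) (iZs (2 * k) n.+1)).
  by rewrite (rintegralZl _ (is_ n.-1)) (rintegralZl _ (is_ n.+1))
    (rintegralZl _ (ic n)) (rintegralZl _ (ic n.+1)).
apply: (@Rintegral_derive_eq0 (gsin k b e n) _ (k / 2) M).
- by rewrite divr_gt0.
- by move=> x; exact: is_derive_gsin.
- have cc m := @continuous_gcos k b e m; have cs m := @continuous_gsin k b e m.
  by move=> x; apply: cvgD; [apply: cvgD; [apply: cvgB|]|]; apply: cvgMl_tmp;
    first [exact: cc|exact: cs].
- exact: rintegrableD iB2 (iZc (2 * e) n.+1).
- by move=> x; apply: le_trans (gsin_le _ _ _ _ _) (HM x).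
Qed.

(** The moments against a Gaussian with a linear or quadratic phase; every
    integral of Hermite functions needed below is one of these. *)
Definition gaussian_functional k b e (p : {poly C}) : C :=
  Cintegral leb (fun x => p.[x%:C] * ((gauss k x)%:C * cis (phase b e x))).

Local Notation E := gaussian_functional.

Lemma Cmeasurable_horner (p : {poly C}) :
  Cmeasurable (fun x : R => p.[x%:C]).
Proof.
under eq_fun do rewrite horner_coef.
apply: Cmeasurable_sum => i; apply: CmeasurableM; first exact: Cmeasurable_cst.
under eq_fun do rewrite -(rmorphXn (real_complex R)).
by apply: Cmeasurable_real; exact: measurable_funX.
Qed.

Lemma Cintegrable_gaussian k b e (p : {poly C}) : 0 < k ->
  Cintegrable leb (fun x => p.[x%:C] * ((gauss k x)%:C * cis (phase b e x))).
Proof.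
move=> k0; have [M [M0 HM]] := horner_gauss_le p k0.
have k20 : 0 < k / 2 by rewrite divr_gt0.
apply: (Cintegrable_dominated _ (rintegrableZl M (rintegrable_gauss k20))).
  apply: CmeasurableM; first exact: Cmeasurable_horner.
  apply: CmeasurableM; first exact: (Cmeasurable_real (measurable_gauss k)).
  apply: Cmeasurable_cis; apply: measurable_funD; apply: measurable_funM => //.

by move=> x; rewrite !normcM normc_cis mulr1 normc_realE ger0_norm ?gauss_ge0.
Qed.

Lemma gaussian_functionalD k b e p q : 0 < k ->
  E k b e (p + q) = E k b e p + E k b e q.
Proof.
move=> k0; rewrite -CintegralD; [|exact: Cintegrable_gaussian..].
by apply: eq_Cintegral => x; rewrite hornerD mulrDl.
Qed.

Lemma gaussian_functionalZ k b e c p : 0 < k ->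
  E k b e (c *: p) = c * E k b e p.
Proof.
move=> k0; rewrite -CintegralZl; last exact: Cintegrable_gaussian.
by apply: eq_Cintegral => x; rewrite hornerZ -mulrA.
Qed.

Lemma gaussian_functional_Xn k b e n :
  E k b e 'X^n = (\int[leb]_x gcos k b e n x) +i* (\int[leb]_x gsin k b e n x).
Proof.
rewrite /gaussian_functional /Cintegral; congr (_ +i* _).
- apply: eq_Rintegral => x _; rewrite hornerXn -(rmorphXn (real_complex R)).
  by rewrite /gcos !ReCM !ImCM /=; ring.
- apply: eq_Rintegral => x _; rewrite hornerXn -(rmorphXn (real_complex R)).
  by rewrite /gsin !ImCM !ReCM /=; ring.
Qed.

(** The fundamental relation: a Gaussian with phase has logarithmic derivative
    [- 2 (k - i e) x + i b]. *)
Lemma gaussian_functional_deriv k b e p : 0 < k ->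
  E k b e p^`() = E k b e (((2 * (k -i* e))%:P * 'X - (0 +i* b)%:P) * p).
Proof.
move=> k0; pose D q := E k b e (q^`() - (((2 * (k -i* e))%:P * 'X - (0 +i* b)%:P) * q)).
suff D0 : D p = 0.
  move: D0; rewrite /D gaussian_functionalD// -scaleN1r gaussian_functionalZ// mulN1r.
  by move/eqP; rewrite subr_eq0 => /eqP.
have DD q r : D (q + r) = D q + D r.
  by rewrite /D -gaussian_functionalD// derivD; congr gaussian_functional; ring.
have DZ c q : D (c *: q) = c * D q.
  by rewrite /D -gaussian_functionalZ// derivZ scalerBr scalerAr.
have DX (n : nat) : D 'X^n = 0.
  rewrite /D derivXn.
  rewrite (_ : _ - _ = n%:R *: 'X^(n.-1) + (- (2 * (k -i* e)) *: 'X^(n.+1) +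
      (0 +i* b) *: 'X^n)); last first.
    by rewrite scaler_nat exprS -!mul_polyC polyCN; ring.
  rewrite !gaussian_functionalD// !gaussian_functionalZ// !gaussian_functional_Xn.
  have := Rintegral_gcos b e n k0; have := Rintegral_gsin b e n k0.
  move: (\int[leb]_x gcos k b e n.-1 x) (\int[leb]_x gcos k b e n.+1 x)
    (\int[leb]_x gsin k b e n.-1 x) (\int[leb]_x gsin k b e n.+1 x)
    (\int[leb]_x gcos k b e n x) (\int[leb]_x gsin k b e n x) => c1 c2 s1 s2 c0 s0.
  rewrite -!(rmorph_nat (real_complex R)) => H1 H2; apply: complex_ext.
  - rewrite -[RHS]H2 /=; ring.
  - rewrite -[RHS]H1 /=; ring.
rewrite -[p]coefK poly_def.
elim: (size p) => [|n IH]; first by rewrite big_ord0 -(scale0r 1) DZ mul0r.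
by rewrite big_ord_recr DD IH /= DZ DX mulr0 addr0.
Qed.

(** ** Dependence of the Gaussian functional on its phase *)

(** Differentiation under the integral sign; [u] is a cosine or a sine, and the
    phase moves along [phi], which is the identity or the square below. *)
Lemma is_derive_gauss_param (u du phi : R -> R) k (s : R) : 0 < k ->
  (forall t, is_derive t (1 : R) u (du t)) -> measurable_fun [set: R] u ->
  (forall t, `|u t| <= 1) -> (forall t, `|du t| <= 1) ->
  measurable_fun [set: R] phi ->
  rintegrable leb (fun x => `|phi x| * gauss k x) ->
  is_derive s (1 : R) (fun t => \int[leb]_x (gauss k x * u (t * phi x)))
    (\int[leb]_x (phi x * (gauss k x * du (s * phi x)))).
Proof.
move=> k0 dU mu u1 du1 mphi iphi.
have ig := rintegrable_gauss k0; have mg := measurable_gauss k.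
have ic t : rintegrable leb (fun x => gauss k x * u (t * phi x)).
  apply: (rintegrable_dominated _ ig) => [|x].
    by apply: measurable_funM => //; apply: (measurableT_comp mu); exact: measurable_funM.
  by rewrite normrM (ger0_norm (gauss_ge0 _ _)) ler_piMr ?gauss_ge0.
have d1 x t : is_derive t (1 : R) (fun v => gauss k x * u (v * phi x))
    (phi x * (gauss k x * du (t * phi x))).
  have dl : is_derive t (1 : R) (fun v => v * phi x) (phi x).
    apply: is_derive_eq (is_derive_mul (is_derive_id _ _) (is_derive_cst _ _ _)) _.
    by rewrite mul1r mulr0 addr0.
  have dc := @is_derive1_comp _ u (fun v => v * phi x) t _ _ (dU _) dl.
  apply: is_derive_eq (is_derive_mul (is_derive_cst (gauss k x) t 1) dc) _.
  by rewrite /GRing.scale/=; ring.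
have e t x : partial1of2 (fun v x => gauss k x * u (v * phi x)) t x =
    phi x * (gauss k x * du (t * phi x)).
  by rewrite partial1of2E; have h := d1 x t; exact: derive_val.
have st : (`]s - 1, s + 1[%classic : set R) s.
  by rewrite /= in_itv/=; apply/andP; split; lra.
have GP : forall (x y : R), `]s - 1, s + 1[%classic x -> [set: R] y ->
    `|partial1of2 (fun v x => gauss k x * u (v * phi x)) x y| <= `|phi y| * gauss k y.
  move=> t x _ _; rewrite e !normrM (ger0_norm (gauss_ge0 _ _)) ler_wpM2l//.
  by rewrite ler_piMr ?gauss_ge0.
have g0 x : 0 <= `|phi x| * gauss k x by rewrite mulr_ge0 ?gauss_ge0.
apply: DeriveDef.
  exact: (@derivable_under_integral R _ _ leb (fun v x => gauss k x * u (v * phi x))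
    setT measurableT s (s - 1) (s + 1) st (fun t _ => ic t)
    (fun t x _ _ => @ex_derive _ _ _ _ _ _ _ (d1 x t)) _ g0 iphi GP).
rewrite -derive1E (@differentiation_under_integral R _ _ leb
  (fun v x => gauss k x * u (v * phi x)) setT measurableT s (s - 1) (s + 1) st
  (fun t _ => ic t)
    (fun t x _ _ => @ex_derive _ _ _ _ _ _ _ (d1 x t)) _ g0 iphi GP).
by under eq_Rintegral do rewrite e.
Qed.

Let mcos : measurable_fun [set: R] (@cos R).
Proof. exact: (continuous_measurable_fun (@continuous_cos R)). Qed.

Let msin : measurable_fun [set: R] (@sin R).
Proof. exact: (continuous_measurable_fun (@continuous_sin R)). Qed.

Let nsin1 (t : R) : `|- sin t| <= 1.
Proof. by rewrite normrN norm_sin_le1. Qed.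

(** With [A] and [B] the real and imaginary parts as functions of [b], the
    fundamental relation gives [A' = - b A / (2 k)] and [B' = - b B / (2 k)], so
    that their products with [e^{b^2 / (4 k)}] are constant. *)
Lemma gaussian_fourier k b : 0 < k ->
  E k b 0 1 = (Num.sqrt (pi / k) * gauss (4 * k)^-1 b)%:C.
Proof.
move=> k0; pose A n t := \int[leb]_x gcos k t 0 n x; pose B n t := \int[leb]_x gsin k t 0 n x.
have phE t x : phase t 0 x = t * x by rewrite /phase mul0r addr0.
have i1 : rintegrable leb (fun x => `|x| * gauss k x).
  by have := rintegrable_exprn_gauss 1 k0; under eq_fun do rewrite expr1.
have dA t : is_derive t (1 : R) (A 0%N) (- B 1%N t).
  rewrite (_ : A 0%N = fun t => \int[leb]_x (gauss k x * cos (t * x))); last first.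
    apply/funext => u; apply: eq_Rintegral => x _.
    by rewrite /gcos expr0 mul1r phE.
  apply: is_derive_eq (@is_derive_gauss_param cos (fun v => - sin v) id k t k0
    (@is_derive_cos R) mcos norm_cos_le1 nsin1 (@measurable_id _ _ _) i1) _.
  rewrite -mulN1r -(rintegralZl _ (rintegrable_gsin t 0 1 k0)).
  by apply: eq_Rintegral => x _; rewrite /gsin expr1 phE; ring.
have dB t : is_derive t (1 : R) (B 0%N) (A 1%N t).
  rewrite (_ : B 0%N = fun t => \int[leb]_x (gauss k x * sin (t * x))); last first.
    apply/funext => u; apply: eq_Rintegral => x _.
    by rewrite /gsin expr0 mul1r phE.
  apply: is_derive_eq (@is_derive_gauss_param sin cos id k t k0
    (@is_derive_sin R) msin norm_sin_le1 norm_cos_le1 (@measurable_id _ _ _) i1) _.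
  by apply: eq_Rintegral => x _; rewrite /gcos expr1 phE.
have A1 t : 2 * k * A 1%N t = - (t * B 0%N t).
  by have := Rintegral_gcos t 0 0 k0; rewrite /A /B /=; lra.
have B1 t : 2 * k * B 1%N t = t * A 0%N t.
  by have := Rintegral_gsin t 0 0 k0; rewrite /A /B /=; lra.
pose c := (4 * k)^-1.
have kc : 4 * (c * k) = 1 by rewrite /c; field; rewrite gt_eqF.
have k2 : k != 0 by rewrite gt_eqF.
have cstA t : A 0%N t * gauss (- c) t = A 0%N 0 * gauss (- c) 0.
  apply: (@is_derive_0_is_cst _ (fun t => A 0%N t * gauss (- c) t) t 0) => u.
  apply: is_derive_eq (is_derive_mul (dA u) (is_derive_gauss (- c) u)) _.
  have -> : B 1%N u = u * A 0%N u / (2 * k) by rewrite -B1; field.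
  by rewrite /c; field.
have cstB t : B 0%N t * gauss (- c) t = B 0%N 0 * gauss (- c) 0.
  apply: (@is_derive_0_is_cst _ (fun t => B 0%N t * gauss (- c) t) t 0) => u.
  apply: is_derive_eq (is_derive_mul (dB u) (is_derive_gauss (- c) u)) _.
  have -> : A 1%N u = - (u * B 0%N u) / (2 * k) by rewrite -A1; field.
  by rewrite /c; field.
have g0 : gauss (- c) 0 = 1 by rewrite /gauss expr0n mulr0 oppr0 expR0.
have gK t : gauss (- c) t * gauss c t = 1.
  by rewrite -gaussD addNr /gauss mul0r oppr0 expR0.
have A00 : A 0%N 0 = Num.sqrt (pi / k).
  rewrite -Rintegral_gauss//; apply: eq_Rintegral => x _.
  by rewrite /gcos expr0 mul1r phE mul0r cos0 mulr1.
have B00 : B 0%N 0 = 0.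
  rewrite /B (_ : (fun x => _) = cst 0); last first.
    by apply/funext => x; rewrite /gsin phE mul0r sin0 !mulr0.
  by rewrite /Rintegral integral0.
rewrite -(expr0 'X) gaussian_functional_Xn -/(A 0%N b) -/(B 0%N b); apply: complex_ext => /=.
- transitivity (A 0%N b * (gauss (- c) b * gauss c b)); first by rewrite gK mulr1.
  by rewrite mulrA cstA g0 mulr1 A00.
- transitivity (B 0%N b * (gauss (- c) b * gauss c b)); first by rewrite gK mulr1.
  by rewrite mulrA cstB B00 !mul0r.
Qed.

(** The Gaussian integral with complex coefficient [k - i e], squared in order to
    avoid choosing a branch of the square root; the square is all that a
    two-dimensional integral needs.  As a function of [e], the product of
    [k - i e] with the square has derivative 0. *)
Lemma gaussian_chirp k e : 0 < k -> E k 0 e 1 ^+ 2 = pi%:C / (k -i* e).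
Proof.
move=> k0; pose A n t := \int[leb]_x gcos k 0 t n x; pose B n t := \int[leb]_x gsin k 0 t n x.
have phE t x : phase 0 t x = t * x ^+ 2 by rewrite /phase mul0r add0r.
have i2 : rintegrable leb (fun x => `|x ^+ 2| * gauss k x).
  by have := rintegrable_exprn_gauss 2 k0; under eq_fun do rewrite -normrX.
have m2 : measurable_fun [set: R] (fun x : R => x ^+ 2) by exact: exprn_measurable.
have dA t : is_derive t (1 : R) (A 0%N) (- B 2%N t).
  rewrite (_ : A 0%N = fun t => \int[leb]_x (gauss k x * cos (t * x ^+ 2))); last first.
    apply/funext => u; apply: eq_Rintegral => x _.
    by rewrite /gcos expr0 mul1r phE.
  apply: is_derive_eq (@is_derive_gauss_param cos (fun v => - sin v) _ k t k0
    (@is_derive_cos R) mcos norm_cos_le1 nsin1 m2 i2) _.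
  rewrite -mulN1r -(rintegralZl _ (rintegrable_gsin 0 t 2 k0)).
  by apply: eq_Rintegral => x _; rewrite /gsin phE; ring.
have dB t : is_derive t (1 : R) (B 0%N) (A 2%N t).
  rewrite (_ : B 0%N = fun t => \int[leb]_x (gauss k x * sin (t * x ^+ 2))); last first.
    apply/funext => u; apply: eq_Rintegral => x _.
    by rewrite /gsin expr0 mul1r phE.
  apply: is_derive_eq (@is_derive_gauss_param sin cos _ k t k0
    (@is_derive_sin R) msin norm_sin_le1 norm_cos_le1 m2 i2) _.
  by apply: eq_Rintegral => x _; rewrite /gcos phE.
have A0 t : A 0%N t = 2 * (k * A 2%N t + t * B 2%N t).
  by have := Rintegral_gcos 0 t 1 k0; rewrite /A /B /=; lra.
have B0 t : B 0%N t = 2 * (k * B 2%N t - t * A 2%N t).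
  by have := Rintegral_gsin 0 t 1 k0; rewrite /A /B /=; lra.
(* [G1] and [G2] are the real and imaginary parts of [(k - i t) (A + i B)^2]. *)
pose G1 t := k * (A 0%N t * A 0%N t - B 0%N t * B 0%N t) + t * (2 * (A 0%N t * B 0%N t)).
pose G2 t := k * (2 * (A 0%N t * B 0%N t)) - t * (A 0%N t * A 0%N t - B 0%N t * B 0%N t).
have dAA t := is_derive_mul (dA t) (dA t).
have dBB t := is_derive_mul (dB t) (dB t).
have dAB t := is_derive_mul (dA t) (dB t).
have dP t := is_deriveB (dAA t) (dBB t).
have dS t := is_derive_mul (is_derive_cst (2 : R) t (1 : R)) (dAB t).
have cst1 t : G1 t = G1 0.
  apply: (@is_derive_0_is_cst _ G1 t 0) => u.
  apply: is_derive_eq (is_deriveD (is_derive_mul (is_derive_cst k u (1 : R)) (dP u))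
    (is_derive_mul (is_derive_id _ _) (dS u))) _.
  by rewrite !fctE /= A0 B0; ring.
have cst2 t : G2 t = G2 0.
  apply: (@is_derive_0_is_cst _ G2 t 0) => u.
  apply: is_derive_eq (is_deriveB (is_derive_mul (is_derive_cst k u (1 : R)) (dS u))
    (is_derive_mul (is_derive_id _ _) (dP u))) _.
  by rewrite !fctE /= A0 B0; ring.
have A00 : A 0%N 0 = Num.sqrt (pi / k).
  rewrite -Rintegral_gauss//; apply: eq_Rintegral => x _.
  by rewrite /gcos expr0 mul1r phE mul0r cos0 mulr1.
have B00 : B 0%N 0 = 0.
  rewrite /B (_ : (fun x => _) = cst 0); last first.
    by apply/funext => x; rewrite /gsin phE mul0r sin0 !mulr0.
  by rewrite /Rintegral integral0.
have s2 : Num.sqrt (pi / k) * Num.sqrt (pi / k) = pi / k.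
  by rewrite -expr2 sqr_sqrtr// divr_ge0 ?pi_ge0// ltW.
have c0 : (k -i* e) != 0 :> C.
  by rewrite eq_complex /= negb_and gt_eqF.
suff H : (k -i* e) * E k 0 e 1 ^+ 2 = pi%:C by rewrite -H [RHS]mulrC mulKf.
rewrite -(expr0 'X) gaussian_functional_Xn -/(A 0%N e) -/(B 0%N e); apply: complex_ext => /=.
- transitivity (G1 e); first by rewrite /G1 /=; ring.
  have kk : k * (pi / k) = pi by rewrite mulrC divfK// gt_eqF.
  by rewrite cst1 /G1 A00 B00 s2 -[RHS]kk; ring.
- transitivity (G2 e); first by rewrite /G2 /=; ring.
  by rewrite cst2 /G2 A00 B00 !mul0r !mulr0 subr0.
Qed.

End gaussian.

(** ** Affine changes of variable *)

(** Uniqueness of Lebesgue measure: the pushforward by an affine map, suitably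
    scaled, has the right value on half-open intervals. *)
Lemma ge0_integral_affine {R : realType} (c r : R) (f : R -> \bar R) : r != 0 ->
  measurable_fun [set: R] f -> (forall x, 0 <= f x)%E ->
  (\int[leb]_x f (c + r * x)%R = `|r|^-1%:E * \int[leb]_x f x)%E.
Proof.
move=> r0 mf f0.
pose phi : R -> measurableTypeR R := fun x => c + r * x.
have mphi : measurable_fun [set: R] phi.
  by apply: measurable_funD => //; exact: measurable_funM.
have nr0 : 0 < `|r|^-1 by rewrite invr_gt0 normr_gt0.
pose nr : {nonneg R} := NngNum (normr_ge0 r).
have U A : measurable A -> leb A = mscale nr (pushforward leb phi) A.
  apply: lebesgue_measure_unique => X [[a b]] _ <-.
  change (leb `]a, b]%classic = `|r|%:E * leb (phi @^-1` `]a, b]%classic))%E.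
  have [r_gt0|r_le0] := ltP 0 r.
    rewrite (_ : phi @^-1` _ = `](a - c) / r, (b - c) / r]%classic); last first.
      apply/seteqP; split => x /=; rewrite !in_itv/= /phi.
        by move=> /andP[h1 h2]; rewrite ltr_pdivrMr// ler_pdivlMr//; apply/andP; split; lra.
      by rewrite ltr_pdivrMr// ler_pdivlMr// => /andP[h1 h2]; apply/andP; split; lra.
    rewrite !lebesgue_measure_itv /= !lte_fin ltr_pM2r ?invr_gt0// ltrD2r.
    case: ifP => _; last by rewrite mule0.
    by rewrite -!EFinB -EFinM (gtr0_norm r_gt0); congr EFin; field.
  have r_lt0 : r < 0 by rewrite lt_neqAle r0.
  rewrite (_ : phi @^-1` _ = `[(b - c) / r, (a - c) / r[%classic); last first.
    apply/seteqP; split => x /=; rewrite !in_itv/= /phi.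
      by move=> /andP[h1 h2]; rewrite ler_ndivrMr// ltr_ndivlMr//; apply/andP; split; lra.
    by rewrite ler_ndivrMr// ltr_ndivlMr// => /andP[h1 h2]; apply/andP; split; lra.
  rewrite !lebesgue_measure_itv /= !lte_fin ltr_nM2r ?invr_lt0// ltrD2r.
  case: ifP => _; last by rewrite mule0.
  by rewrite -!EFinB -EFinM (ltr0_norm r_lt0); congr EFin; field.
have -> : (\int[leb]_x f x = `|r|%:E * \int[leb]_x f (c + r * x)%R)%E.
  have := @ge0_integral_pushforward _ _ (measurableTypeR R) (measurableTypeR R) R
    phi mphi leb setT f measurableT mf (fun x _ => f0 x).
  rewrite preimage_setT => /= <-.
  rewrite (@eq_measure_integral _ _ R setT (mscale nr (pushforward leb phi)) leb f).
    by rewrite ge0_integral_mscale.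
  by move=> A mA _; exact: U.
by rewrite muleA -EFinM mulVf ?normr_eq0// mul1e.
Qed.

(** * Lebesgue measure on row vectors *)

(** ** Transport of integrals along a measurable map *)

Section transport.
Context d1 d2 (T1 : measurableType d1) (T2 : measurableType d2) {R : realType}.
Variables (mu : {measure set T1 -> \bar R}) (nu : {measure set T2 -> \bar R}).
Variable phi : T1 -> T2.
Hypothesis mphi : measurable_fun [set: T1] phi.
Hypothesis nuE : forall A, measurable A -> nu A = mu (phi @^-1` A).

Lemma ge0_integral_transport (f : T2 -> \bar R) :
  measurable_fun [set: T2] f -> (forall x, 0 <= f x)%E ->
  (\int[nu]_x f x = \int[mu]_x f (phi x))%E.
Proof.
move=> mf f0.
have := @ge0_integral_pushforward _ _ T1 T2 R phi mphi mu setT f measurableT mf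
  (fun x _ => f0 x).
rewrite preimage_setT => /= <-.
by apply: eq_measure_integral => A mA _; rewrite nuE.
Qed.

Lemma integral_transport (f : T2 -> \bar R) : measurable_fun [set: T2] f ->
  (\int[nu]_x f x = \int[mu]_x f (phi x))%E.
Proof.
move=> mf; rewrite [LHS]integralE [RHS]integralE.
rewrite (ge0_integral_transport (measurable_funepos mf))//.
rewrite (ge0_integral_transport (measurable_funeneg mf))//.
by rewrite (funepos_comp f phi) (funeneg_comp f phi).
Qed.

Lemma Rintegral_transport (f : T2 -> R) : measurable_fun [set: T2] f ->
  \int[nu]_x f x = \int[mu]_x f (phi x).
Proof.
move=> mf; rewrite /Rintegral (@integral_transport (fun x => (f x)%:E))//.
exact/measurable_EFinP.
Qed.

Lemma rintegrable_transport (f : T2 -> R) : measurable_fun [set: T2] f ->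
  rintegrable mu (fun x => f (phi x)) <-> rintegrable nu f.
Proof.
move=> mf; have mfp : measurable_fun [set: T1] (fun x => f (phi x)).
  exact: measurableT_comp mf mphi.
have E : (\int[nu]_x `|(f x)%:E| = \int[mu]_x `|(f (phi x))%:E|)%E.
  rewrite (@ge0_integral_transport (fun x => `|(f x)%:E|%E))//.
  by apply: measurableT_comp => //; exact/measurable_EFinP.
split=> /integrableP[_ foo]; apply/integrableP; split.
- exact/measurable_EFinP.
- by rewrite E.
- exact/measurable_EFinP.
- by rewrite -E.
Qed.

Lemma Cintegral_transport (f : T2 -> R[i]) : Cmeasurable f ->
  Cintegral nu f = Cintegral mu (fun x => f (phi x)).
Proof.
move=> [f1 f2]; rewrite /Cintegral /=.
by rewrite (Rintegral_transport f1) (Rintegral_transport f2).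
Qed.

Lemma Cintegrable_transport (f : T2 -> R[i]) : Cmeasurable f ->
  Cintegrable mu (fun x => f (phi x)) <-> Cintegrable nu f.
Proof.
move=> [f1 f2]; split => -[g1 g2]; split.
- exact/(rintegrable_transport f1).
- exact/(rintegrable_transport f2).
- exact/(rintegrable_transport f1).
- exact/(rintegrable_transport f2).
Qed.

End transport.

Section row_measure.
Context {R : realType}.
Local Notation C := R[i].
Local Notation lam n := (@lebesgue_row R n).

(** ** Peeling off a coordinate *)

Lemma consr0 n (t : R) (v : 'rV[R]_n) : consr (t, v) ord0 ord0 = t.
Proof.
by rewrite consrE; case: splitP => // j /= j0.
Qed.

Lemma consrS n (t : R) (v : 'rV[R]_n) (j : 'I_n) :
  consr (t, v) ord0 (lift ord0 j) = v ord0 j.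
Proof.
rewrite consrE; case: splitP => k /=; rewrite /bump leq0n add1n.
  by move=> jk; have := ltn_ord k; rewrite -jk.
by rewrite add1n => -[jk]; congr (v _ _); apply/val_inj.
Qed.

Definition tailr n (c : 'rV[R]_n.+1) : 'rV[R]_n := \row_j c ord0 (lift ord0 j).

Lemma measurable_coord n (i : 'I_n) :
  measurable_fun [set: 'rV[R]_n] (fun x : 'rV[R]_n => x ord0 i).
Proof. exact: (@measurable_row_coord _ (measurableTypeR R)). Qed.

Lemma lebesgue_rowSE n (A : set 'rV[R]_n.+1) : measurable A ->
  lam n.+1 A = (lebesgue_measure \x lam n)%E (@consr R n @^-1` A).
Proof. by []. Qed.

Lemma ge0_integral_rowS n (f : 'rV[R]_n.+1 -> \bar R) :
  measurable_fun [set: 'rV[R]_n.+1] f -> (forall x, 0 <= f x)%E ->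
  (\int[lam n.+1]_x f x = \int[lebesgue_measure]_t \int[lam n]_v f (consr (t, v)))%E.
Proof.
move=> mf f0.
rewrite (ge0_integral_transport (@measurable_consr R n) (@lebesgue_rowSE n) mf f0).
rewrite (fubini_tonelli1 (fun z => f (consr z)))//.
exact: measurableT_comp mf (@measurable_consr R n).
Qed.

Lemma lebesgue_row0T : lam 0%N [set: 'rV[R]_0] = 1%E.
Proof. by rewrite /= diracT. Qed.

Lemma Rintegral_row0 (f : 'rV[R]_0 -> R) : \int[lam 0]_x f x = f 0.
Proof.
have -> : f = cst (f 0) by apply/funext => x; rewrite (thinmx0 x).
by rewrite /Rintegral /= integral_cst// -[X in (_ * X)%E]/(lam 0%N setT) lebesgue_row0T mule1.
Qed.

Lemma rintegrable_row0 (f : 'rV[R]_0 -> R) : rintegrable (lam 0) f.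
Proof.
have -> : f = cst (f 0) by apply/funext => x; rewrite (thinmx0 x).
apply/integrableP; split; first exact/measurable_EFinP.
by rewrite /= integral_cst// -[X in (_ * X)%E]/(lam 0%N setT) lebesgue_row0T mule1 ltry.
Qed.

(** ** Functions that are products of functions of one coordinate *)

Lemma Cintegral_row_prod n (f : 'I_n -> R -> C) :
  (forall j, Cintegrable leb (f j)) ->
  Cintegrable (lam n) (fun x => \prod_j f j (x ord0 j)) /\
  Cintegral (lam n) (fun x => \prod_j f j (x ord0 j)) =
    \prod_j Cintegral leb (f j).
Proof.
elim: n f => [|n IH] f If.
  split; first by split; exact: rintegrable_row0.
  under eq_Cintegral do rewrite big_ord0.
  by rewrite big_ord0 Cintegral_real Rintegral_row0.
have mf : Cmeasurable (fun x : 'rV[R]_n.+1 => \prod_j f j (x ord0 j)).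
  apply: Cmeasurable_prod => j; apply: Cmeasurable_comp (measurable_coord j) _.
  exact: Cintegrable_measurable (If j).
have [I1 I2] := IH (fun j => f (lift ord0 j)) (fun j => If _).
have E z : \prod_j f j (consr z ord0 j) =
    f ord0 z.1 * \prod_(j < n) f (lift ord0 j) (z.2 ord0 j).
  case: z => t v; rewrite big_ord_recl consr0; congr (_ * _).
  by apply: eq_bigr => j _; rewrite consrS.
have P : Cintegrable (lebesgue_measure \x lam n)%E
    (fun z => \prod_j f j (consr z ord0 j)).
  under eq_fun do rewrite E.
  apply: (Cintegrable_dominated _ (rintegrable_prod
    (Cintegrable_normc (If ord0)) (Cintegrable_normc I1))); last first.
    by move=> z; rewrite normcM.
  apply: CmeasurableM.
  - exact: (Cmeasurable_comp measurable_fst (Cintegrable_measurable (If ord0))).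
  - exact: (Cmeasurable_comp measurable_snd (Cintegrable_measurable I1)).
split; first exact: (Cintegrable_transport (@measurable_consr R n) (@lebesgue_rowSE n) mf).1.
rewrite (Cintegral_transport (@measurable_consr R n) (@lebesgue_rowSE n) mf).
rewrite Cintegral_prod// big_ord_recl -I2 mulrC -CintegralZl//.
apply: eq_Cintegral => t; rewrite mulrC -CintegralZl//.
by apply: eq_Cintegral => v; rewrite E.
Qed.

Lemma Rintegral_row_prod n (f : 'I_n -> R -> R) :
  (forall j, rintegrable leb (f j)) ->
  rintegrable (lam n) (fun x => \prod_j f j (x ord0 j)) /\
  \int[lam n]_x \prod_j f j (x ord0 j) = \prod_j \int[leb]_t f j t.
Proof.
move=> If.
have [[I1 _] I2] := @Cintegral_row_prod n (fun j t => (f j t)%:C)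
  (fun j => Cintegrable_real (If j)).
have E (x : 'rV[R]_n) : \prod_j (f j (x ord0 j))%:C = (\prod_j f j (x ord0 j))%:C.
  by rewrite rmorph_prod.
split.
  by move: I1; under eq_fun do rewrite E.
move: I2; under eq_Cintegral do rewrite E.
by under eq_bigr do rewrite Cintegral_real; rewrite Cintegral_real -rmorph_prod => -[].
Qed.

(** ** Splitting a row vector *)

Definition row_pair n m (z : 'rV[R]_n * 'rV[R]_m) : 'rV[R]_(n + m) :=
  row_mx z.1 z.2.

Lemma measurable_row_pair n m : measurable_fun [set: _] (@row_pair n m).
Proof.
apply: measurable_fun_row => i.
rewrite /row_pair; under eq_fun do rewrite mxE.
case: (fintype.split i) => j.
- exact: (measurableT_comp (measurable_coord j) measurable_fst).
- exact: (measurableT_comp (measurable_coord j) measurable_snd).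
Qed.

(** Concatenation commutes with adding a first coordinate, so that measures of
    concatenations can be computed by induction. *)
Lemma row_pair_consr n m (t : R) (x : 'rV[R]_n) (y : 'rV[R]_m) :
  row_pair (consr (t, x) : 'rV[R]_n.+1, y) = consr (t, row_pair (x, y)).
Proof.
apply/rowP => i; rewrite [LHS]mxE consrE.
case: splitP => j ij; case: splitP => k ik.
- rewrite [j](_ : _ = ord0) ?consr0//; apply/val_inj => /=.
  by rewrite -ij ik; case: k {ik} => -[].
- have jn : (k < n)%N by have := ltn_ord j; rewrite -ij ik.
  have [l0 l0k] : exists l : 'I_n, nat_of_ord l = k by exists (Ordinal jn).
  rewrite [j](_ : _ = lift ord0 l0); last first.
    by apply/val_inj; rewrite /= /bump /= -ij ik l0k.
  rewrite consrS /= /row_pair [RHS]mxE /=.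
  case: splitP => l /= kl; first by congr (x _ _); apply/val_inj; rewrite /= l0k.
  by move: jn; rewrite kl ltnNge leq_addr.
- by have := ltn_ord k; rewrite -ik ij.
- have kE : k = n + j :> nat by apply/eqP; rewrite -(eqn_add2l 1) -ik ij.
  rewrite /row_pair [RHS]mxE /=.
  case: splitP => l /= kl; first by have := ltn_ord l; rewrite -kl kE ltnNge leq_addr.
  by congr (y _ _); apply/val_inj/eqP; rewrite -(eqn_add2l n) -kl kE.
Qed.

Lemma ge0_integral_row_pair n m (f : 'rV[R]_(n + m) -> \bar R) :
  measurable_fun [set: 'rV[R]_(n + m)] f -> (forall x, 0 <= f x)%E ->
  (\int[lam (n + m)]_x f x = \int[lam n]_x \int[lam m]_y f (row_pair (x, y)))%E.
Proof.
elim: n f => [|n IH] f mf f0.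
  rewrite [RHS](_ : _ = \int[lam 0]_x (cst (\int[lam m]_y f (row_pair (0%R : 'rV[R]_0, y))) x))%E; last first.
    by apply: eq_integral => x _; rewrite (thinmx0 x).
  rewrite integral_cst// -[X in (_ * X)%E]/(lam 0%N setT) lebesgue_row0T mule1; apply: eq_integral => y _; congr f.
  apply/rowP => i; rewrite mxE; case: splitP => j ij; first by case: j {ij}.
  by apply: (congr1 (y ord0)); apply/val_inj.
have mfc : measurable_fun [set: _] (fun z => f (@consr R (n + m) z)).
  exact: measurableT_comp mf (@measurable_consr R (n + m)).
rewrite (@ge0_integral_rowS (n + m))//.
have mF : measurable_fun [set: 'rV[R]_n.+1]
    (fun x => \int[lam m]_y f (@row_pair n.+1 m (x, y)))%E.
  apply: (@emeasurable_partial_integral1 _ _ _ _ _ (lam m)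
    (fun z : 'rV[R]_n.+1 * 'rV[R]_m => f (row_pair z))).
  exact: measurableT_comp mf (@measurable_row_pair n.+1 m).
rewrite [RHS](ge0_integral_rowS mF); last by move=> x; exact: integral_ge0.
apply: eq_integral => t _.
rewrite (IH (fun v => f (consr (t, v))))//; last first.
  exact: measurableT_comp mfc (@measurable_pair1 _ _ _ _ t).
apply: eq_integral => x _; apply: eq_integral => y _.
by rewrite -row_pair_consr.
Qed.

Lemma lebesgue_row_pairE n m (A : set 'rV[R]_(n + m)) : measurable A ->
  lam (n + m) A = (lam n \x lam m)%E (@row_pair n m @^-1` A).
Proof.
move=> mA; have mp := @measurable_row_pair n m.
have mP : measurable (@row_pair n m @^-1` A).
  by rewrite -[X in measurable X]setTI; exact: mp.
have I d (T : measurableType d) (mu : {measure set T -> \bar R}) B :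
    measurable B -> (mu B = \int[mu]_x (\1_B x)%:E)%E.
  by move=> mB; rewrite integral_indic// setIT.
rewrite (I _ _ (lam (n + m)) _ mA) (I _ _ (lam n \x lam m)%E _ mP).
transitivity (\int[lam n]_x \int[lam m]_y (\1_A (row_pair (x, y)))%:E)%E.
  apply: (@ge0_integral_row_pair n m (fun x => (\1_A x)%:E)) => //.
  by apply/measurable_EFinP; exact: measurable_indic.
rewrite (fubini_tonelli1 (fun z => (\1_(@row_pair n m @^-1` A) z)%:E))//.
by apply/measurable_EFinP; exact: measurable_indic.
Qed.

(** ** Affine changes of variable *)

Lemma ge0_integral_row_affine n (c : 'rV[R]_n) (r : R) (f : 'rV[R]_n -> \bar R) :
  r != 0 -> measurable_fun [set: 'rV[R]_n] f -> (forall x, 0 <= f x)%E ->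
  (\int[lam n]_x f x = (`|r| ^+ n)%:E * \int[lam n]_x f (c + r *: x)%R)%E.
Proof.
move=> r0; elim: n c f => [|n IH] c f mf f0.
  rewrite expr0 mul1e; apply: eq_integral => x _.
  by congr f; rewrite [LHS]thinmx0 [RHS]thinmx0.
have mA : measurable_fun [set: 'rV[R]_n.+1] (fun x => f (c + r *: x)).
  apply: (measurableT_comp mf); apply: measurable_fun_row => i.
  under eq_fun do rewrite !mxE.
  apply: measurable_funD => //; apply: measurable_funM => //.
  exact: measurable_coord.
rewrite ge0_integral_rowS// [in RHS]ge0_integral_rowS//.
have E t v : c + r *: consr (t, v) =
    consr (c ord0 ord0 + r * t, tailr c + r *: v) :> 'rV[R]_n.+1.
  apply/rowP => i; case: (unliftP ord0 i) => [j|] ->.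
  - by rewrite mxE mxE !consrS !mxE.
  - by rewrite mxE mxE !consr0.
have mfc : measurable_fun [set: _] (fun z => f (@consr R n z)).
  exact: measurableT_comp mf (@measurable_consr R n).
pose G t := (\int[lam n]_v f (consr (t, v)))%E.
have mG : measurable_fun [set: R] G.
  exact: (@emeasurable_partial_integral1 _ _ _ _ _ (lam n) (fun z => f (consr z))).
have G0 t : (0 <= G t)%E by exact: integral_ge0.
have -> : (\int[lebesgue_measure]_t \int[lam n]_v f (c + r *: consr (t, v))%R =
    (`|r| ^- n)%:E * \int[lebesgue_measure]_t G (c ord0 ord0 + r * t)%R)%E.
  rewrite -ge0_integralZl//; last first.
    have mh : measurable_fun [set: R] (fun t : R => c ord0 ord0 + r * t).
      by apply: measurable_funD => //; exact: measurable_funM.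
    exact: measurableT_comp mG mh.
  apply: eq_integral => t _; under eq_integral do rewrite E.
  rewrite /G (IH (tailr c) (fun v => f (consr (c ord0 ord0 + r * t, v))))//; last first.
    exact: measurableT_comp mfc (@measurable_pair1 _ _ _ _ _).
  by rewrite muleA -EFinM mulVf ?mul1e// expf_neq0// normr_eq0.
rewrite ge0_integral_affine// !muleA -!EFinM -/G.
rewrite (_ : `|r| ^+ n.+1 * _ * _ = 1) ?mul1e//.
have rn0 : `|r| != 0 by rewrite normr_eq0.
by rewrite exprS; field; rewrite ?rn0 ?expf_neq0.
Qed.

Lemma fine_muleB (k : R) (x y : \bar R) : 0 < k -> (0 <= x)%E -> (0 <= y)%E ->
  fine (k%:E * x - k%:E * y) = k * fine (x - y).
Proof.
move=> k0; case: x => [x||]// _; case: y => [y||]// _.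
- by rewrite -!EFinM -!EFinB /= mulrBr.
- by rewrite gt0_muley ?lte_fin//= mulr0.
- by rewrite gt0_muley ?lte_fin//= mulr0.
- by rewrite gt0_muley ?lte_fin//= mulr0.
Qed.

Lemma Rintegral_row_affine n (c : 'rV[R]_n) (r : R) (f : 'rV[R]_n -> R) :
  r != 0 -> measurable_fun [set: 'rV[R]_n] f ->
  \int[lam n]_x f x = `|r| ^+ n * \int[lam n]_x f (c + r *: x).
Proof.
move=> r0 mf; have mef : measurable_fun [set: 'rV[R]_n] (fun x => (f x)%:E).
  exact/measurable_EFinP.
rewrite /Rintegral [in LHS]integralE [in RHS]integralE.
rewrite (ge0_integral_row_affine c r0 (measurable_funepos mef))//.
rewrite (ge0_integral_row_affine c r0 (measurable_funeneg mef))//.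
rewrite fine_muleB ?exprn_gt0 ?normr_gt0//; [|exact: integral_ge0..].
by rewrite (funepos_comp (fun x => (f x)%:E) (fun x => c + r *: x)) (funeneg_comp (fun x => (f x)%:E) (fun x => c + r *: x)).
Qed.

Lemma Cintegral_row_affine n (c : 'rV[R]_n) (r : R) (f : 'rV[R]_n -> C) :
  r != 0 -> Cmeasurable f ->
  Cintegral (lam n) f = (`|r| ^+ n)%:C * Cintegral (lam n) (fun x => f (c + r *: x)).
Proof.
move=> r0 [f1 f2]; rewrite /Cintegral (Rintegral_row_affine c r0 f1).
by rewrite (Rintegral_row_affine c r0 f2); apply: complex_ext => /=; ring.
Qed.

(** ** Measurability of continuous functions *)

Lemma measurable_row_ball n (q : 'rV[R]_n) (e : R) :
  measurable [set x : 'rV[R]_n | forall i, `|x ord0 i - q ord0 i| < e].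
Proof.
rewrite (_ : mkset _ = \bigcap_(i in [set: 'I_n])
    ((fun x : 'rV[R]_n => x ord0 i) @^-1` ball (q ord0 i) e)).
  apply: fin_bigcap_measurable => // i _.
  rewrite -[X in measurable X]setTI; apply: measurable_coord => //.
  exact: measurable_ball.
by apply/seteqP; split => x /= h i; [move=> _|]; rewrite /ball/= distrC; exact: h.
Qed.

(** The sigma-algebra on row vectors is generated by the coordinates; an open
    set is a countable union of rational cubes. *)
Lemma open_row_measurable n (U : set 'rV[R]_n) : open U -> measurable U.
Proof.
move=> oU.
pose B (z : 'rV[rat]_n * nat) := [set x : 'rV[R]_n | forall i,
   `|x ord0 i - ratr (z.1 ord0 i)| < z.2.+1%:R^-1].
pose F z := if `[< B z `<=` U >] then B z else set0.
have -> : U = \bigcup_z F z.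
  apply/seteqP; split => [x Ux|x [z _]]; last first.
    by rewrite /F; case: asboolP => // BU; exact: BU.
  have /nbhs_ballP[e /= e0 eU] : nbhs x U by exact: open_nbhs_nbhs.
  have [k ke] : exists k : nat, k.+1%:R^-1 < e / 2.
    exists (Num.bound (e / 2)^-1).
    rewrite invf_plt ?posrE ?divr_gt0// (lt_le_trans (archi_boundP _))//.
      by rewrite invr_ge0 divr_ge0// ltW.
    by rewrite ler_nat.
  have /choice[q Hq] (i : 'I_n) : exists r : rat, `|x ord0 i - ratr r| < k.+1%:R^-1.
    have [|r] := @rat_in_itvoo R (x ord0 i - k.+1%:R^-1) (x ord0 i + k.+1%:R^-1).
      by rewrite ltrBlDr -addrA ltrDl addr_gt0// invr_gt0.
    rewrite in_itv/= => /andP[r1 r2]; exists r; move: (k.+1%:R^-1) r1 r2 => dl r1 r2.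
    by rewrite ltr_norml; apply/andP; split; lra.
  exists (\row_i q i, k) => //; rewrite /F.
  have Bx : B (\row_i q i, k) x by move=> i; rewrite mxE; exact: Hq.
  case: asboolP => // -[] y By; apply: eU => /=.
  split=> // i j; rewrite (ord1 i) /ball /=.
  have := Bx j; have := By j; rewrite /= distrC => h1 h2.
  rewrite -(subrK (ratr ((\row_i q i) ord0 j)) (x ord0 j)) -addrA.
  rewrite (le_lt_trans (ler_normD _ _))//.
  by move: (k.+1%:R^-1) ke h1 h2 => dl; lra.
apply: countable_bigcupT_measurable; first exact: countableP.
move=> z; rewrite /F; case: asboolP => // _.
rewrite (_ : B z = [set x | forall i, `|x ord0 i - (map_mx ratr z.1) ord0 i| < z.2.+1%:R^-1]).
  exact: measurable_row_ball.
by apply/seteqP; split => x h i; have := h i; rewrite mxE.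
Qed.

Lemma continuous_row_measurable n (f : 'rV[R]_n -> R) :
  continuous f -> measurable_fun [set: 'rV[R]_n] f.
Proof.
move=> /continuousP cf; apply: (measurability _ (RGenOpens.measurableE R)).
move=> _ [_ [a [b ->] <-]]; rewrite setTI; apply: open_row_measurable.
exact/cf/interval_open.
Qed.

(** ** Spheres are negligible *)

Lemma measurable_sqnorm n :
  measurable_fun [set: 'rV[R]_n] (fun x => \sum_j x ord0 j ^+ 2).
Proof.
apply: (@measurable_sum _ _ _ _ _ _ (fun j (x : 'rV[R]_n) => x ord0 j ^+ 2)) => j.
by apply: measurable_funX; exact: measurable_coord.
Qed.

(** Freezing all coordinates but the first leaves at most two points. *)
Lemma lebesgue_row_sphere n (s : R) :
  lam n.+1 [set x | \sum_j x ord0 j ^+ 2 = s] = 0.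
Proof.
have mS : measurable [set x : 'rV[R]_n.+1 | \sum_j x ord0 j ^+ 2 = s].
  rewrite -[X in measurable X]setTI.
  exact: (@measurable_sqnorm n.+1 measurableT _ (measurable_set1 s)).
have mP : measurable (@consr R n @^-1` [set x | \sum_j x ord0 j ^+ 2 = s]).
  by rewrite -[X in measurable X]setTI; exact: measurable_consr.
rewrite lebesgue_rowSE// -[LHS](_ : \int[(lebesgue_measure \x lam n)%E]_z
    (\1_(@consr R n @^-1` [set x | \sum_j x ord0 j ^+ 2 = s]) z)%:E = _)%E; last first.
  by rewrite integral_indic// setIT.
rewrite fubini_tonelli2//=; last by apply/measurable_EFinP; exact: measurable_indic.
rewrite /fubini_G integral0_eq// => v _.
pose r := Num.sqrt (s - \sum_j v ord0 j ^+ 2).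
transitivity (\int[leb]_t (\1_([set t | t ^+ 2 + \sum_j v ord0 j ^+ 2 = s]) t)%:E)%E.
  apply: eq_integral => t _; congr (_%:E); rewrite !indicE; congr (_%:R).
  have E : \sum_j consr (t, v) ord0 j ^+ 2 = t ^+ 2 + \sum_j v ord0 j ^+ 2.
    rewrite big_ord_recl consr0; congr (_ + _).
    by apply: eq_bigr => j _; rewrite consrS.
  by congr nat_of_bool; apply/idP/idP; rewrite !inE/= E.
have sub : [set t : R | t ^+ 2 + \sum_j v ord0 j ^+ 2 = s] `<=` [set r; - r].
  move=> t /= ts; have : t ^+ 2 = r ^+ 2.
    by rewrite /r -ts addrK sqr_sqrtr// sqr_ge0.
  by move/eqP; rewrite eqf_sqr => /orP[] /eqP ->; [left|right].
have m2 : measurable [set t : R | t ^+ 2 + \sum_j v ord0 j ^+ 2 = s].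
  rewrite -[X in measurable X]setTI.
  have mf : measurable_fun [set: R] (fun t : R => t ^+ 2 + \sum_j v ord0 j ^+ 2).
    by apply: measurable_funD => //; exact: exprn_measurable.
  exact: (mf measurableT _ (measurable_set1 s)).
rewrite integral_indic// setIT; apply: countable_lebesgue_measure0.
apply: sub_countable (subset_card_le sub) _.
exact/finite_set_countable/finite_set2.
Qed.

Lemma lebesgue_row_ball_lty n (s : R) :
  (lam n [set x | (\sum_j x ord0 j ^+ 2 <= s)%R] < +oo)%E.
Proof.
have [_ _ _ /(_ (Num.bound (1 + `|s|)))] := @lebesgue_row_measure R n.
apply: le_lt_trans; apply: le_measure; rewrite ?inE.
- rewrite -[X in measurable X]setTI.
  have := @measurable_sqnorm n measurableT _ (measurable_itv `]-oo, s]).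
  by congr (measurable _); apply/seteqP; split => x /= [] _ h; split => //; move: h; rewrite /= in_itv/=.
- exact: measurable_box.
move=> x /= xs i; rewrite /= in_itv/= -ler_norml.
apply: le_trans (ltW (archi_boundP _)); last by rewrite addr_ge0.
have : x ord0 i ^+ 2 <= `|s|.
  apply: le_trans (le_trans xs (ler_norm _)).
  by rewrite (bigD1 i)//= lerDl sumr_ge0// => j _; rewrite sqr_ge0.
rewrite -[x ord0 i ^+ 2]real_normK ?num_real//.
by have := normr_ge0 (x ord0 i); have := normr_ge0 s; nra.
Qed.

End row_measure.

(** * Hermite polynomials *)

Section hermite_algebra.
Variables (F : numFieldType) (w : F).
Hypothesis w0 : w != 0.

(** [hermite_poly k * e^{- pi x^2}] is a multiple of the [k]-th Hermite
    function when [w = pi]; the recurrence is the action of the raising operator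
    [x - (2 pi)^-1 d/dx] on polynomials times the Gaussian. *)
Fixpoint hermite_poly k : {poly F} :=
  if k is k'.+1 then
    2%:P * 'X * hermite_poly k' - ((2 * w)^-1)%:P * (hermite_poly k')^`()
  else 1.

Local Notation h := hermite_poly.

Lemma hermite_polyS k : h k.+1 = 2%:P * 'X * h k - ((2 * w)^-1)%:P * (h k)^`().
Proof. by []. Qed.

(** The lowering operator acts on polynomials as the derivative. *)
Lemma deriv_hermite_poly k : (h k)^`() = (2 * k%:R)%:P * h k.-1.
Proof.
elim: k => [|k IH]; first by rewrite derivC mulr0 mul0r.
rewrite hermite_polyS derivB !derivM !derivC derivX IH derivM derivC !mul0r !add0r.
case: k IH => [|k] IH; first by rewrite /= derivC mulr0 !mul0r; ring.
change (k.+2.-1) with k.+1; change (k.+1.-1) with k.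
by rewrite -(natr1 k.+1) (hermite_polyS k) !polyCM polyCD; ring.
Qed.

Section functional.
Variable E : {poly F} -> F.
Hypothesis ED : forall p q, E (p + q) = E p + E q.
Hypothesis EZ : forall c p, E (c%:P * p) = c * E p.

Lemma functional0 : E 0 = 0.
Proof. by rewrite -(mul0r 0) -(polyC0) EZ mul0r. Qed.

Lemma functionalN p : E (- p) = - E p.
Proof. by rewrite -mulN1r -polyCN EZ mulN1r. Qed.

Lemma functionalB p q : E (p - q) = E p - E q.
Proof. by rewrite ED functionalN. Qed.

Let half : (2%:P : {poly F}) = ((2 * w)^-1)%:P * (4 * w)%:P.
Proof. by rewrite -polyCM; congr (_%:P); field; exact: w0. Qed.

(** The derivative in the raising operator is integrated by parts onto the
    Gaussian, whose phase contributes a factor [b / (2 w)]. *)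
Lemma hermite_functional_phase b :
  (forall p, E p^`() = E (((4 * w)%:P * 'X - b%:P) * p)) ->
  forall k, E (h k) = (b / (2 * w)) ^+ k * E 1.
Proof.
move=> EE; elim=> [|k IH]; first by rewrite mul1r.
rewrite exprS -mulrA -IH hermite_polyS functionalB EZ EE.
rewrite (_ : 2%:P * 'X * h k = ((2 * w)^-1)%:P * (((4 * w)%:P * 'X - b%:P) * h k) +
  (b / (2 * w))%:P * h k); last by rewrite half polyCM; ring.
by rewrite ED !EZ; ring.
Qed.

(** The lowering operator is adjoint to the raising one: moving the derivative
    onto [p] lowers the index. *)
Lemma hermite_functional_raise : (forall p, E p^`() = E ((4 * w)%:P * 'X * p)) ->
  forall k p, E (h k.+1 * p) = (2 * w)^-1 * E (h k * p^`()).
Proof.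
move=> EE k p; rewrite hermite_polyS.
rewrite (_ : _ * p = ((2 * w)^-1)%:P * ((4 * w)%:P * 'X * (h k * p)) -
  ((2 * w)^-1)%:P * ((h k)^`() * p)); last by rewrite half; ring.
by rewrite functionalB !EZ -EE derivM ED; ring.
Qed.

(** Raising indices on one side lowers them on the other until one of them is 0. *)
Lemma hermite_orthogonal : (forall p, E p^`() = E ((4 * w)%:P * 'X * p)) ->
  forall j k, E (h j * h k) = (j == k)%:R * (k`!%:R / w ^+ k * E 1).
Proof.
move=> EE; have step j k : E (h j.+1 * h k.+1) = k.+1%:R / w * E (h j * h k).
  rewrite hermite_functional_raise// deriv_hermite_poly mulrCA EZ [k.+1.-1]/=.
  by field; exact: w0.
elim=> [|j IH] [|k].
- by rewrite mul1r fact0 expr0 divr1 !mul1r.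
- by rewrite mulrC hermite_functional_raise// derivC mulr0 functional0 mulr0 mul0r.
- by rewrite hermite_functional_raise// derivC mulr0 functional0 mulr0 mul0r.
- by rewrite step IH eqSS factS natrM exprS; field; rewrite expf_neq0 ?w0.
Qed.

(** ** The Wigner transform of two Hermite functions *)

(** Here [E] stands for the integral in [z] against
    [e^{- pi z^2 / 2 - 2 i pi z xi}], [y] for [i xi], and the lemmas give the
    effect of the raising operators in terms of [x - y] and [x + y]. *)
Section wigner_recurrence.
Variables (x y : F) .
Hypothesis EE : forall p, E p^`() = E ((w%:P * 'X + (2 * w * y)%:P) * p).

Definition fwd (p : {poly F}) := p \Po (x%:P + (2^-1)%:P * 'X).
Definition bwd (p : {poly F}) := p \Po (x%:P - (2^-1)%:P * 'X).

Let fwdS k : fwd (h k.+1) = 2%:P * (x%:P + (2^-1)%:P * 'X) * fwd (h k) -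
  ((2 * w)^-1)%:P * fwd (h k)^`().
Proof. by rewrite /fwd hermite_polyS comp_polyB !comp_polyM !comp_polyC comp_polyX. Qed.

Let bwdS k : bwd (h k.+1) = 2%:P * (x%:P - (2^-1)%:P * 'X) * bwd (h k) -
  ((2 * w)^-1)%:P * bwd (h k)^`().
Proof. by rewrite /bwd hermite_polyS comp_polyB !comp_polyM !comp_polyC comp_polyX. Qed.

Let d_fwd p : (fwd p)^`() = (2^-1)%:P * fwd p^`().
Proof.
rewrite /fwd deriv_comp derivD derivM !derivC derivX mul0r mulr1 !add0r.
by rewrite mulrC.
Qed.

Let d_bwd p : (bwd p)^`() = - ((2^-1)%:P * bwd p^`()).
Proof.
rewrite /bwd deriv_comp derivB derivM !derivC derivX mul0r mulr1 !add0r.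
by rewrite mulrN mulrC.
Qed.

Let bwdZ c p : bwd (c%:P * p) = c%:P * bwd p.
Proof. by rewrite /bwd comp_polyM comp_polyC. Qed.

Let two_half : (2%:P : {poly F}) * (2^-1)%:P = 1.
Proof. by rewrite -polyCM divff. Qed.

Let wV : (w%:P : {poly F}) * (w^-1)%:P = 1.
Proof. by rewrite -polyCM divff. Qed.

(** Integration by parts trades a multiplication by [z] for a derivative. *)
Let EX p : E ('X * p) = w^-1 * E p^`() - 2 * y * E p.
Proof.
rewrite EE -!EZ -functionalB; congr E.
transitivity ((w^-1 * w)%:P * 'X * p); first by rewrite mulVf// mul1r.
rewrite [in RHS](_ : (2 * w * y)%:P = w%:P * (2 * y)%:P); last first.
  by rewrite -polyCM; congr (_%:P); ring.
rewrite !polyCM; have := wV; move: (w%:P) (w^-1)%:P => u v uv.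
transitivity (v * u * 'X * p + (v * u - 1) * (2%:P * y%:P) * p); last by ring.
by rewrite mulrC in uv; rewrite uv; ring.
Qed.

(** The raising operator at [x + z / 2] combines a multiplication and a
    derivative in [z]; integrating by parts leaves the multiplication by
    [2 (x - y)] and a derivative falling on the other factor. *)
Lemma wigner_raise_left j k :
  E (fwd (h j.+1) * bwd (h k)) = 2 * (x - y) * E (fwd (h j) * bwd (h k)) -
    k%:R / w * E (fwd (h j) * bwd (h k.-1)).
Proof.
rewrite fwdS (_ : _ * bwd (h k) = (2 * x)%:P * (fwd (h j) * bwd (h k)) +
   'X * (fwd (h j) * bwd (h k)) - ((2 * w)^-1)%:P * (fwd (h j)^`() * bwd (h k)));
  last first.
  transitivity (2%:P * x%:P * (fwd (h j) * bwd (h k)) + (2%:P * (2^-1)%:P) *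
     ('X * (fwd (h j) * bwd (h k))) - ((2 * w)^-1)%:P * (fwd (h j)^`() * bwd (h k))).
    by ring.
  by rewrite two_half mul1r -polyCM.
have dE : E (fwd (h j) * bwd (h k))^`() = 2^-1 * E (fwd (h j)^`() * bwd (h k)) -
    2^-1 * E (fwd (h j) * bwd (h k)^`()).
  rewrite derivM d_fwd d_bwd mulrN ED functionalN -EZ -EZ.
  by congr (E _ - E _); ring.
have kE : E (fwd (h j) * bwd (h k)^`()) = 2 * k%:R * E (fwd (h j) * bwd (h k.-1)).
  by rewrite deriv_hermite_poly bwdZ mulrCA EZ.
by rewrite functionalB ED !EZ EX dE kE; field; exact: w0.
Qed.

(** The case where the other factor is constant, so that no derivative is left. *)
Lemma wigner_raise_right k :
  E (bwd (h k.+1)) = 2 * (x + y) * E (bwd (h k)).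
Proof.
rewrite bwdS (_ : _ * bwd (h k) = (2 * x)%:P * bwd (h k) - 'X * bwd (h k)); last first.
  transitivity (2%:P * x%:P * bwd (h k) - (2%:P * (2^-1)%:P) * ('X * bwd (h k))).
    by ring.
  by rewrite two_half mul1r -polyCM.
rewrite !functionalB !EZ EX d_bwd functionalN EZ.
by field; exact: w0.
Qed.

End wigner_recurrence.

(** ** Integration over phase space *)

(** Polynomials in two variables: the outer one is [x], the inner one [xi]. *)
Section phase_space.
Variables (I : F) (lam : F).
Hypothesis II : I ^+ 2 = - 1.
Hypothesis lam0 : lam != 0.
Hypothesis EE : forall p, E p^`() = E (lam%:P * 'X * p).

Definition functional2 (P : {poly {poly F}}) : F := E (map_poly E P).
Local Notation E2 := functional2.

Let cE P i : (map_poly E P)`_i = E P`_i.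
Proof. by rewrite coef_map_id0// functional0. Qed.

Lemma functional2D P Q : E2 (P + Q) = E2 P + E2 Q.
Proof.
rewrite /functional2 -ED; congr E.
by apply/polyP => i; rewrite coefD !cE coefD ED.
Qed.

Lemma functional2Z c P : E2 (c%:P%:P * P) = c * E2 P.
Proof.
rewrite /functional2 -EZ; congr E.
by apply/polyP => i; rewrite coefCM !cE coefCM EZ.
Qed.

Lemma functional2B P Q : E2 (P - Q) = E2 P - E2 Q.
Proof.
by rewrite functional2D -mulN1r -!polyCN functional2Z mulN1r.
Qed.

Let E2x P : E2 P^`() = lam * E2 ('X * P).
Proof.
rewrite /functional2; transitivity (E (map_poly E P)^`()).
  congr E; apply/polyP => i; rewrite cE !coef_deriv cE.
  by rewrite -mulr_natl -[RHS]mulr_natl -EZ polyC_natr.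
rewrite EE -mulrA EZ; congr (_ * E _); apply/polyP => i.
by rewrite cE !coefXM; case: eqP => _; rewrite ?functional0 ?cE.
Qed.

Let E2y P : E2 (map_poly (@deriv F) P) = lam * E2 ('X%:P * P).
Proof.
rewrite /functional2 -EZ; congr E; apply/polyP => i.
by rewrite coefCM !cE coefCM coef_map_id0 ?deriv0// EE -mulrA EZ.
Qed.

Let zz : {poly {poly F}} := 'X + I%:P%:P * 'X%:P.
Let zb : {poly {poly F}} := 'X - I%:P%:P * 'X%:P.

(** The Wigner distribution of two Hermite functions is a Gaussian times this
    polynomial, which is a power of [zz] or [zb] times a Laguerre polynomial in
    [zz * zb]; the recurrence is that of [wigner_raise_left]. *)
Fixpoint wigner_poly j k : {poly {poly F}} :=
  if j is j'.+1 then
    2%:P%:P * zb * wigner_poly j' k - (k%:R / w)%:P%:P * wigner_poly j' k.-1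
  else (2%:P%:P * zz) ^+ k.

Let D P := P^`() - I%:P%:P * map_poly (@deriv F) P.
Let Db P := P^`() + I%:P%:P * map_poly (@deriv F) P.

Let dyM (P Q : {poly {poly F}}) : map_poly (@deriv F) (P * Q) =
  map_poly (@deriv F) P * Q + P * map_poly (@deriv F) Q.
Proof.
apply/polyP => i; rewrite coefD !coef_map_id0 ?deriv0// !coefM.
rewrite raddf_sum -big_split /=; apply: eq_bigr => l _.
by rewrite !coef_map_id0 ?deriv0// derivM.
Qed.

Let dyD (P Q : {poly {poly F}}) : map_poly (@deriv F) (P + Q) =
  map_poly (@deriv F) P + map_poly (@deriv F) Q.
Proof.
by apply/polyP => i; rewrite coefD !coef_map_id0 ?deriv0// coefD derivD.
Qed.

Let dyC (p : {poly F}) : map_poly (@deriv F) p%:P = (p^`())%:P.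
Proof.
apply/polyP => i; rewrite !coef_map_id0 ?deriv0// !coefC.
by case: ifP => // _; rewrite deriv0.
Qed.

Let dyX : map_poly (@deriv F) 'X = 0.
Proof.
apply/polyP => i; rewrite coef_map_id0 ?deriv0// coefX coef0.
by case: (i == _); rewrite ?derivC// deriv0.
Qed.

Let DM P Q : D (P * Q) = D P * Q + P * D Q.
Proof. by rewrite /D derivM dyM; ring. Qed.

Let DbM P Q : Db (P * Q) = Db P * Q + P * Db Q.
Proof. by rewrite /Db derivM dyM; ring. Qed.

Let DC c : D c%:P%:P = 0.
Proof. by rewrite /D derivC dyC derivC; ring. Qed.

Let DB P Q : D (P - Q) = D P - D Q.
Proof.
have dyN : map_poly (@deriv F) (- Q) = - map_poly (@deriv F) Q.
  by apply/polyP => i; rewrite coefN !coef_map_id0 ?deriv0// coefN derivN.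
by rewrite /D derivB dyD dyN; ring.
Qed.

Let I2 : (I%:P%:P : {poly {poly F}}) * I%:P%:P = - 1.
Proof. by rewrite -!polyCM -expr2 II !polyCN. Qed.

Let Dzz : D zz = 2%:P%:P.
Proof.
rewrite /D /zz dyD dyM !dyC dyX derivD derivX derivM !derivC derivX.
transitivity (1 - I%:P%:P * I%:P%:P : {poly {poly F}}); first by ring.
by rewrite I2 !polyCMn; ring.
Qed.

Let Dzb : D zb = 0.
Proof.
have -> : zb = 'X + (- I)%:P%:P * 'X%:P by rewrite /zb !polyCN; ring.
rewrite /D dyD dyM !dyC dyX derivD derivX derivM !derivC derivX !polyCN.
transitivity (1 + I%:P%:P * I%:P%:P : {poly {poly F}}); first by ring.
by rewrite I2; ring.
Qed.

Let Dbzz : Db zz = 0.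
Proof.
rewrite /Db /zz dyD dyM !dyC dyX derivD derivX derivM !derivC derivX.
transitivity (1 + I%:P%:P * I%:P%:P : {poly {poly F}}); first by ring.
by rewrite I2; ring.
Qed.

Let DbC c : Db c%:P%:P = 0.
Proof. by rewrite /Db derivC dyC derivC; ring. Qed.

(** [D] is twice the Wirtinger derivative in [zz], for which [zb] is a constant. *)
Let D_wigner j k : D (wigner_poly j k) = (4 * k%:R)%:P%:P * wigner_poly j k.-1.
Proof.
elim: j k => [|j IH] k.
  elim: k => [|k IHk]; first by rewrite /= expr0 mulr0 mul0r -(DC 1).
  rewrite /= in IHk *; rewrite exprS DM IHk DM DC Dzz.
  case: k IHk => [|k] _ /=; first by rewrite expr0 !polyCM !polyCMn; ring.
  by rewrite exprS -(natr1 k.+1) !polyCM !polyCD !polyCMn; ring.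
rewrite /= DB !DM !DC Dzb !IH.
case: k => [|k] /=; first by rewrite !mulr0 !mul0r; ring.
by rewrite -(natr1 k) !mulrDl !polyCM !polyCD !polyCM; ring.
Qed.

Let E2_zb P : lam * E2 (zb * P) = E2 (D P).
Proof.
rewrite /D functional2B functional2Z E2x E2y /zb mulrBl functional2B.
by rewrite -mulrA functional2Z; ring.
Qed.

Let E2_zz P : lam * E2 (zz * P) = E2 (Db P).
Proof.
rewrite /Db functional2D functional2Z E2x E2y /zz mulrDl functional2D.
by rewrite -mulrA functional2Z; ring.
Qed.

(** The functional [E2] is the integral against a rotation-invariant Gaussian,
    so that multiplication by [zb] integrates by parts to the derivative in
    [zz] ([E2_zb]), which lowers the second index while the recurrence lowers
    the first. *)
Lemma wigner_functional j k : E2 (wigner_poly j k) =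
  (j == k)%:R * (k`!%:R * (8 / lam - w^-1) ^+ k * E 1 ^+ 2).
Proof.
have step l m : E2 (wigner_poly l.+1 m.+1) =
    m.+1%:R * (8 / lam - w^-1) * E2 (wigner_poly l m).
  rewrite /= functional2B -mulrA !functional2Z.
  have := E2_zb (wigner_poly l m.+1); rewrite D_wigner functional2Z /=.
  by move/(congr1 (fun t => lam^-1 * t)); rewrite mulKf// => ->; field; rewrite lam0 w0.
have left0 l : E2 (wigner_poly l.+1 0) = 0.
  rewrite /= functional2B -mulrA !functional2Z.
  have := E2_zb (wigner_poly l 0); rewrite D_wigner functional2Z /= mulr0 mul0r.
  by move/eqP; rewrite mulf_eq0 (negbTE lam0) /= => /eqP ->; rewrite mul0r !mulr0 mul0r subr0.
have right0 m : E2 (wigner_poly 0 m.+1) = 0.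
  rewrite /= exprS -mulrA functional2Z.
  have := E2_zz ((2%:P%:P * zz) ^+ m).
  have -> : Db ((2%:P%:P * zz) ^+ m) = 0.
    elim: m => [|m IHm]; first by rewrite expr0 -(DbC 1).
    by rewrite exprS !DbM IHm Dbzz DbC; ring.
  rewrite -(mul0r (1 : {poly {poly F}})) -!polyC0 functional2Z mul0r.
  by move/eqP; rewrite mulf_eq0 (negbTE lam0) /= => /eqP ->; rewrite mulr0.
elim: j k => [|j IH] [|k].
- rewrite /= expr0 /functional2 fact0 expr0 !mul1r expr2.
  rewrite (_ : map_poly E 1 = (E 1)%:P * 1); first by rewrite EZ.
  apply/polyP => i; rewrite mulr1 cE !coefC.
  by case: i => [|i] /=; rewrite ?functional0.
- by rewrite right0 mul0r.
- by rewrite left0 mul0r.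
- by rewrite step IH eqSS factS natrM (exprS _ k); ring.
Qed.

(** Applying [E] to the inner variable first is what makes [functional2] an
    iterated integral. *)
Lemma functional_horner (P : {poly {poly F}}) c : E P.[c%:P] = (map_poly E P).[c].
Proof.
elim/poly_ind: P => [|P p IH].
  rewrite horner0 functional0 (_ : map_poly E 0 = 0) ?horner0//.
  by apply/polyP => i; rewrite cE !coef0 functional0.
rewrite hornerMXaddC (_ : map_poly E _ = map_poly E P * 'X + (E p)%:P); last first.
  apply/polyP => i; rewrite cE !coefD !coefMX !coefC cE.
  by case: i => [|i] /=; rewrite ED ?functional0 ?addr0 ?add0r.
by rewrite hornerMXaddC ED mulrC EZ IH mulrC.
Qed.

End phase_space.

End functional.
End hermite_algebra.

(** * Hermite functions on the line *)

Section hermite_functions.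
Context {R : realType}.
Local Notation C := R[i].
Local Notation E := gaussian_functional.
Local Notation hp := (hermite_poly (pi : R)).
Local Notation hpC := (hermite_poly (pi%:C : C)).

Let pi_neq0 : (pi : R) != 0. Proof. by rewrite gt_eqF// pi_gt0. Qed.

Let piC_neq0 : (pi%:C : C) != 0. Proof. by rewrite eq_complex /= negb_and pi_neq0. Qed.

Lemma map_hermite_poly k : map_poly (real_complex R) (hp k) = hpC k.
Proof.
elim: k => [|k IH]; first by rewrite rmorph1.
rewrite !hermite_polyS -IH rmorphB !rmorphM /= !map_polyC map_polyX /= deriv_map.
by rewrite fmorphV rmorphM /= !rmorph_nat.
Qed.

Lemma horner_hermite_poly k (x : R) : (hpC k).[x%:C] = ((hp k).[x])%:C.
Proof. by rewrite -map_hermite_poly horner_map. Qed.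

Lemma is_derive_horner (p : {poly R}) (x : R) : is_derive x (1 : R) (horner p) p^`().[x].
Proof.
apply: DeriveDef; first exact: derivable_horner.
by rewrite -derive1E derivE.
Qed.

(** Differentiating a polynomial times [e^{- 2 pi x^2}] is the recurrence of
    [hermite_poly], up to the factor [- 2 pi]. *)
Lemma derive1n_gauss k : derive1n k (fun y : R => expR (- (2 * pi * y ^+ 2))) =
  fun y => (- (2 * pi)) ^+ k * ((hp k).[y] * gauss (2 * pi) y).
Proof.
elim: k => [|k IH].
  by rewrite derive1n0; apply/funext => y; rewrite expr0 hornerC !mul1r.
rewrite derive1nS IH; apply/funext => y; rewrite derive1E.
have D := is_derive_mul (is_derive_cst ((- (2 * pi)) ^+ k : R) y 1)
  (is_derive_mul (is_derive_horner (hp k) y) (is_derive_gauss (2 * pi) y)).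
rewrite (@derive_val _ _ _ _ _ _ _ D) hermite_polyS exprS !hornerE /=.
rewrite /cst; move: (hp k)^`().[y] (hp k).[y] (gauss (2 * pi) y) => a b g.
by move: (pi : R) pi_neq0 => v v0; field.
Qed.

Definition hermite_norm k : R := 2 `^ 4^-1 * Num.sqrt pi ^+ k / Num.sqrt k`!%:R.

Lemma hermiteE k (x : R) :
  hermite k x = hermite_norm k * ((hp k).[x] * gauss pi x).
Proof.
rewrite /hermite derive1n_gauss /hermite_norm.
have sp : Num.sqrt pi != 0 :> R by rewrite gt_eqF// sqrtr_gt0 pi_gt0.
have sp2 : Num.sqrt pi ^+ 2 = pi :> R by rewrite sqr_sqrtr// pi_ge0.
have -> : gauss (2 * pi) x = gauss pi x * gauss pi x.
  by rewrite mulr_natl mulr2n gaussD.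
have eg : expR (pi * x ^+ 2) * gauss pi x = 1.
  by rewrite /gauss -expRD subrr expR0.
have -> : (- (2 * pi)) ^+ k = (-1) ^+ k * 2 ^+ k * Num.sqrt pi ^+ k * Num.sqrt pi ^+ k :> R.
  by rewrite -!exprMn; congr (_ ^+ _); rewrite -{1}sp2; move: (Num.sqrt pi : R) => v; ring.
have s1 : (-1) ^+ k * (-1) ^+ k = 1 :> R by rewrite -exprMn mulrNN mulr1 expr1n.
have sf : Num.sqrt k`!%:R != 0 :> R by rewrite gt_eqF// sqrtr_gt0 ltr0n fact_gt0.
have spk : Num.sqrt pi ^+ k != 0 :> R by rewrite expf_neq0.
have tk : 2 ^+ k != 0 :> R by rewrite expf_neq0.
rewrite exprVn.
transitivity (((-1) ^+ k * (-1) ^+ k) * (expR (pi * x ^+ 2) * gauss pi x) *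
  (2 `^ 4^-1 * Num.sqrt pi ^+ k / Num.sqrt k`!%:R * ((hp k).[x] * gauss pi x))).
  move: (Num.sqrt pi ^+ k) spk (Num.sqrt k`!%:R) sf ((2 : R) ^+ k) tk ((-1) ^+ k : R)
    (expR _) (gauss pi x) (hp k).[x] (2 `^ 4^-1) => u u0 v v0 t t0 *.
  by field; rewrite v0 u0 t0.
by rewrite s1 eg !mul1r.
Qed.

Lemma hermite_norm2 k : hermite_norm k ^+ 2 = Num.sqrt 2 * (pi ^+ k / k`!%:R).
Proof.
have p4 : (2 `^ 4^-1) ^+ 2 = Num.sqrt 2 :> R.
  rewrite -powR_mulrn ?powR_ge0// -powRrM (_ : 4^-1 * 2%:R = 2^-1); last by field.
  by rewrite powR12_sqrt.
have sk : (Num.sqrt pi ^+ k) ^+ 2 = pi ^+ k :> R.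
  by rewrite -exprM mulnC exprM sqr_sqrtr ?pi_ge0.
by rewrite /hermite_norm expr_div_n exprMn p4 sk sqr_sqrtr// mulrA.
Qed.

Lemma hermite_norm_gt0 k : 0 < hermite_norm k.
Proof.
by rewrite /hermite_norm !mulr_gt0// ?powR_gt0// ?exprn_gt0 ?invr_gt0 ?sqrtr_gt0 ?pi_gt0 ?ltr0n ?fact_gt0.
Qed.

Lemma hermite_le k : exists M : R, 0 <= M /\
  forall x, `|hermite k x| <= M * gauss (pi / 2) x.
Proof.
have [M [M0 HM]] := horner_gauss_le (hpC k) (@pi_gt0 R).
exists (hermite_norm k * M); split=> [|x]; first by rewrite mulr_ge0// ltW// hermite_norm_gt0.
rewrite hermiteE normrM (gtr0_norm (hermite_norm_gt0 k)) -mulrA.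
rewrite ler_wpM2l ?(ltW (hermite_norm_gt0 k))//.
have := HM x; rewrite horner_hermite_poly normc_realE.
by rewrite normrM (ger0_norm (gauss_ge0 _ _)).
Qed.

Lemma measurable_horner (p : {poly R}) : measurable_fun [set: R] (horner p).
Proof. by apply: continuous_measurable_fun; exact: continuous_horner. Qed.

Lemma measurable_hermite k : measurable_fun [set: R] (@hermite R k).
Proof.
have -> : @hermite R k = fun x => hermite_norm k * ((hp k).[x] * gauss pi x).
  by apply/funext => x; exact: hermiteE.
apply: measurable_funM => //; apply: measurable_funM; first exact: measurable_horner.
exact: measurable_gauss.
Qed.

Lemma gauss_sqr (k x : R) : gauss k x ^+ 2 = gauss (2 * k) x.
Proof. by rewrite mulr_natl mulr2n gaussD. Qed.

Lemma sqintegrable_gauss (k : R) : 0 < k -> sqintegrable leb (gauss k).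
Proof.
move=> k0; split; first exact: measurable_gauss.
by under eq_fun do rewrite gauss_sqr; apply: rintegrable_gauss; rewrite mulr_gt0.
Qed.

Lemma sqintegrable_hermite k : sqintegrable leb (@hermite R k).
Proof.
have [M [M0 HM]] := hermite_le k.
have p2 : 0 < pi / 2 :> R by rewrite divr_gt0// pi_gt0.
apply: (sqintegrable_dominated _ (sqintegrableZl M (sqintegrable_gauss p2))).
  exact: measurable_hermite.
by move=> x; rewrite (le_trans (HM x))// ler_norm.
Qed.

Let phase00 (x : R) : phase 0 0 x = 0. Proof. by rewrite /phase !mul0r addr0. Qed.

(** The product of two Hermite functions is a polynomial times [e^{- 2 pi x^2}]. *)
Lemma hermite_orthonormal j k :
  ip leb (@hermite R j) (@hermite R k) = (j == k)%:R.
Proof.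
have p2 : 0 < 2 * pi :> R by rewrite mulr_gt0// pi_gt0.
apply: complexI; rewrite /ip -Cintegral_real.
transitivity ((hermite_norm j * hermite_norm k)%:C * E (2 * pi) 0 0 (hpC j * hpC k)).
  rewrite /gaussian_functional -CintegralZl; last exact: Cintegrable_gaussian.
  apply: eq_Cintegral => x; rewrite hornerM !horner_hermite_poly phase00 cis0 mulr1.
  rewrite -!rmorphM; congr (_%:C); rewrite !hermiteE.
  by rewrite [gauss (2 * pi) x](_ : _ = gauss pi x * gauss pi x) -?gauss_sqr//; ring.
rewrite (hermite_orthogonal piC_neq0 (fun p q => gaussian_functionalD _ _ p q p2)); last 2 first.
- by move=> c p; rewrite mul_polyC gaussian_functionalZ.
- move=> p; rewrite gaussian_functional_deriv//; congr E.
  rewrite -[RHS]addr0 mulrDl; congr (_ * _ * _ + _).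
    congr (_%:P); apply: complex_ext => /=; ring.
  by rewrite (_ : (0 +i* 0)%:P = 0 :> {poly C}) ?oppr0 ?mul0r//; exact: polyC0.
have [->|] := eqVneq j k; last by rewrite !mul0r mulr0.
rewrite gaussian_fourier// /gauss expr0n mulr0 oppr0 expR0 mulr1 mul1r -expr2.
rewrite hermite_norm2 -(rmorph_nat (real_complex R)) -!rmorphXn -!(fmorph_div (real_complex R)).
rewrite -!rmorphM; congr (_%:C).
have kf : k`!%:R != 0 :> R by rewrite pnatr_eq0 -lt0n fact_gt0.
have pk : pi ^+ k != 0 :> R by rewrite expf_neq0.
rewrite (_ : pi / (2 * pi) = 2^-1 :> R); last by rewrite invfM mulrCA divff ?mulr1.
transitivity (Num.sqrt 2 * Num.sqrt 2^-1 : R).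
  by move: (pi ^+ k : R) pk (k`!%:R : R) kf => u u0 v v0; field; rewrite v0 u0.
by rewrite -sqrtrM// divff// sqrtr1.
Qed.

End hermite_functions.

(** * Wigner distributions of Hermite functions in one dimension *)

Section wigner_hermite.
Context {R : realType}.
Local Notation C := R[i].
Local Notation E := gaussian_functional.
Local Notation hp := (hermite_poly (pi : R)).
Local Notation hpC := (hermite_poly (pi%:C : C)).

Let pi_neq0 : (pi : R) != 0. Proof. by rewrite gt_eqF// pi_gt0. Qed.

Let piC_neq0 : (pi%:C : C) != 0. Proof. by rewrite eq_complex /= negb_and pi_neq0. Qed.

Definition wigner1 j k (x y : R) : C := Cintegral leb (fun z =>
  cis (- (2 * pi * (z * y))) * (hermite j (x + 2^-1 * z))%:C * (hermite k (x - 2^-1 * z))%:C).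

Let horner_fwd k (x z : R) :
  (fwd x%:C (hpC k)).[z%:C] = ((hp k).[x + 2^-1 * z])%:C.
Proof.
rewrite /fwd horner_comp -horner_hermite_poly; congr horner.
by rewrite !hornerE rmorphD rmorphM fmorphV rmorph_nat.
Qed.

Let horner_bwd k (x z : R) :
  (bwd x%:C (hpC k)).[z%:C] = ((hp k).[x - 2^-1 * z])%:C.
Proof.
rewrite /bwd horner_comp -horner_hermite_poly; congr horner.
by rewrite !hornerE rmorphB rmorphM fmorphV rmorph_nat.
Qed.

(** Completing the square separates the Gaussian in [x] from the one in [z], and
    the recurrences in both indices start from [gaussian_fourier]. *)
Lemma wigner1E j k (x y : R) : wigner1 j k x y =
  (hermite_norm j * hermite_norm k * Num.sqrt 2)%:C *
  ((wigner_poly (pi%:C : C) 'i j k).[(x%:C)%:P].[y%:C] *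
   (gauss (2 * pi) x * gauss (2 * pi) y)%:C).
Proof.
have p2 : 0 < pi / 2 :> R by rewrite divr_gt0// pi_gt0.
pose L := E (pi / 2) (- (2 * pi * y)) 0.
have LD p q : L (p + q) = L p + L q by exact: gaussian_functionalD.
have LZ c p : L (c%:P * p) = c * L p by rewrite mul_polyC; exact: gaussian_functionalZ.
have LE p : L p^`() = L ((pi%:C%:P * 'X + (2 * pi%:C * ('i * y%:C))%:P) * p).
  rewrite /L gaussian_functional_deriv//; congr E; congr (_ * _).
  rewrite -polyCN; move: (pi : R) => v; congr (_%:P * _ + _%:P).
    by apply: complex_ext => /=; field.
  by apply: complex_ext => /=; ring.
have key l m : L (fwd x%:C (hpC l) * bwd x%:C (hpC m)) =
    (wigner_poly (pi%:C : C) 'i l m).[(x%:C)%:P].[y%:C] * L 1.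
  elim: l m => [|l IH] m.
    rewrite /fwd comp_polyC mul1r /=.
    elim: m => [|m IHm]; first by rewrite /bwd comp_polyC !expr0 !hornerE.
    rewrite (wigner_raise_right piC_neq0 LD LZ _ LE) IHm exprS !hornerM.
    by rewrite mulrA; congr (_ * _ * _); rewrite !hornerE.
  rewrite (wigner_raise_left piC_neq0 LD LZ _ LE) !IH /= !hornerE.
  by rewrite mulrBl.
transitivity ((hermite_norm j * hermite_norm k * gauss (2 * pi) x)%:C *
    L (fwd x%:C (hpC j) * bwd x%:C (hpC k))).
  rewrite /L /gaussian_functional -CintegralZl; last exact: Cintegrable_gaussian.
  apply: eq_Cintegral => z; rewrite hornerM horner_fwd horner_bwd !hermiteE.
  have -> : phase (- (2 * pi * y)) 0 z = - (2 * pi * (z * y)).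
    by rewrite /phase; move: (pi : R) => v; ring.
  have eg : gauss pi (x + 2^-1 * z) * gauss pi (x - 2^-1 * z) =
      gauss (2 * pi) x * gauss (pi / 2) z.
    by rewrite /gauss -!expRD; congr expR; move: (pi : R) => v; field.
  transitivity ((hermite_norm j * hermite_norm k * gauss (2 * pi) x *
    ((hp j).[x + 2^-1 * z] * (hp k).[x - 2^-1 * z] * gauss (pi / 2) z))%:C *
    cis (- (2 * pi * (z * y)))).
    rewrite -mulrA -rmorphM [LHS]mulrC; congr (_%:C * _).
    transitivity (hermite_norm j * hermite_norm k *
      ((hp j).[x + 2^-1 * z] * (hp k).[x - 2^-1 * z]) *
      (gauss pi (x + 2^-1 * z) * gauss pi (x - 2^-1 * z))).
      move: (hp j).[_] (hp k).[_] (gauss _ (x + _)) (gauss _ (x - _))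
        (hermite_norm j) (hermite_norm k) => *; ring.
    rewrite eg; move: (hp j).[_] (hp k).[_] (gauss _ x) (gauss _ z)
      (hermite_norm j) (hermite_norm k) => *; ring.
  move: (cis _) (hp j).[_] (hp k).[_] (gauss _ x) (gauss _ z)
    (hermite_norm j) (hermite_norm k) => *; rewrite !real_complexM; ring.
rewrite key /L gaussian_fourier// (_ : pi / (pi / 2) = 2 :> R); last first.
  by rewrite invfM invrK mulrA divff ?mul1r.
rewrite (_ : gauss (4 * (pi / 2))^-1 (- (2 * pi * y)) = gauss (2 * pi) y); last first.
  by congr expR; move: (pi : R) pi_neq0 => v v0; field.
set A := (wigner_poly _ _ _ _).[_].[_]; move: A (gauss _ x) (gauss _ y)
  (hermite_norm j) (hermite_norm k) (Num.sqrt 2) => *; rewrite !real_complexM; ring.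
Qed.

Lemma horner2_gauss_le (P : {poly {poly C}}) : exists M : R, 0 <= M /\
  forall x y, normc P.[(x%:C)%:P].[y%:C] * (gauss (2 * pi) x * gauss (2 * pi) y) <=
    M * (gauss pi x * gauss pi y).
Proof.
have p2 : 0 < 2 * pi :> R by rewrite mulr_gt0// pi_gt0.
have pp : 2 * pi / 2 = pi :> R by rewrite mulrAC divff ?mul1r.
elim/poly_ind: P => [|P p _].
  by exists 0; split=> // x y; rewrite !horner0 normc0 !mul0r.
have /choice[M HM] i : exists M, 0 <= M /\ forall x : R,
    normc ((P * 'X + p%:P)`_i).[x%:C] * gauss (2 * pi) x <= M * gauss pi x.
  by have := horner_gauss_le (P * 'X + p%:P)`_i p2; rewrite pp.
have /choice[N HN] i : exists M, 0 <= M /\ forall x : R,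
    `|x| ^+ i * gauss (2 * pi) x <= M * gauss pi x.
  by have := exprn_gauss_le i p2; rewrite pp.
set Q := P * 'X + p%:P in M HM *.
exists (\sum_(i < size Q) M i * N i); split=> [|x y].
  by apply: sumr_ge0 => i _; rewrite mulr_ge0 ?(HM i).1 ?(HN i).1.
have H : normc Q.[(x%:C)%:P].[y%:C] <=
    \sum_(i < size Q) normc (Q`_i * (x%:C)%:P ^+ i).[y%:C].
  rewrite (horner_coef Q) horner_sum.
  elim/big_rec2 : _ => [|i u v _ le_uv]; first by rewrite normc0.
  by rewrite (le_trans (le_normcD _ _))// lerD.
apply: le_trans (ler_wpM2r (mulr_ge0 (gauss_ge0 _ _) (gauss_ge0 _ _)) H) _.
rewrite !mulr_suml ler_sum// => i _.
rewrite hornerM -polyC_exp hornerC normcM -(rmorphXn (real_complex R)) normc_realE normrX.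
rewrite [leLHS](_ : _ = (normc (Q`_i).[y%:C] * gauss (2 * pi) y) *
    (`|x| ^+ i * gauss (2 * pi) x)); last first.
  move: (normc _) (gauss _ x) (gauss _ y) (`|x| ^+ i) => *; ring.
rewrite [leRHS](_ : _ = (M i * gauss pi y) * (N i * gauss pi x)); last first.
  move: (gauss _ x) (gauss _ y) => *; ring.
apply: ler_pM; [| |exact: (HM i).2|exact: (HN i).2].
- by rewrite mulr_ge0 ?normc_ge0 ?gauss_ge0.
- by rewrite mulr_ge0 ?exprn_ge0 ?gauss_ge0.
Qed.

Lemma wigner1_le j k : exists M : R, 0 <= M /\
  forall x y, normc (wigner1 j k x y) <= M * (gauss pi x * gauss pi y).
Proof.
have [M [M0 HM]] := horner2_gauss_le (wigner_poly (pi%:C : C) 'i j k).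
have c0 : 0 <= hermite_norm j * hermite_norm k * Num.sqrt 2 :> R.
  by rewrite mulr_ge0 ?sqrtr_ge0// mulr_ge0// ltW// hermite_norm_gt0.
exists (hermite_norm j * hermite_norm k * Num.sqrt 2 * M); split=> [|x y].
  by rewrite mulr_ge0.
rewrite wigner1E !normcM !normc_realE (ger0_norm c0) -[leRHS]mulrA.
apply: ler_wpM2l => //.
by rewrite ger0_norm ?mulr_ge0 ?gauss_ge0.
Qed.

Lemma Cmeasurable_horner2 (P : {poly {poly C}}) :
  Cmeasurable (fun z : R * R => P.[(z.1%:C)%:P].[z.2%:C]).
Proof.
under eq_fun do rewrite (horner_coef P) horner_sum.
apply: Cmeasurable_sum => i.
under eq_fun do rewrite hornerM -polyC_exp hornerC.
apply: CmeasurableM.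
  exact: (Cmeasurable_comp measurable_snd (Cmeasurable_horner P`_i)).
apply: (Cmeasurable_comp measurable_fst (f := fun x : R => x%:C ^+ i)).
by under eq_fun do rewrite -hornerXn; exact: Cmeasurable_horner.
Qed.

Lemma Cmeasurable_wigner1 j k : Cmeasurable (fun z : R * R => wigner1 j k z.1 z.2).
Proof.
under eq_fun do rewrite wigner1E.
apply: CmeasurableM; first exact: Cmeasurable_cst.
apply: CmeasurableM; first exact: Cmeasurable_horner2.
apply: Cmeasurable_real; apply: measurable_funM.
- exact: (measurableT_comp (measurable_gauss _) measurable_fst).
- exact: (measurableT_comp (measurable_gauss _) measurable_snd).
Qed.

(** The chirp [e^{i tau q}] merges with the Gaussian factor of the Wigner
    distribution into a rotation-invariant Gaussian with complex coefficient
    [2 pi (1 - i tau)], to which [wigner_functional] and [gaussian_chirp]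
    apply. *)
Lemma wigner1_chirp j k (tau : R) :
  Cintegral leb (fun x => Cintegral leb (fun y =>
    wigner1 j k x y * cis (tau * (2 * pi * (x ^+ 2 + y ^+ 2))))) =
  (j == k)%:R * ((1 +i* tau) ^+ k / (1 -i* tau) ^+ k.+1).
Proof.
have p2 : 0 < 2 * pi :> R by rewrite mulr_gt0// pi_gt0.
pose L := E (2 * pi) 0 (tau * (2 * pi)).
have LD p q : L (p + q) = L p + L q by exact: gaussian_functionalD.
have LZ c p : L (c%:P * p) = c * L p by rewrite mul_polyC; exact: gaussian_functionalZ.
pose c : C := 1 -i* tau.
have c0 : c != 0 by rewrite eq_complex /= negb_and oner_eq0.
pose lam : C := 4 * pi%:C * c.
have lam0 : lam != 0 by rewrite !mulf_neq0// pnatr_eq0.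
have LE p : L p^`() = L (lam%:P * 'X * p).
  rewrite /L gaussian_functional_deriv//; congr E; congr (_ * _).
  rewrite (_ : (0 +i* 0)%:P = 0 :> {poly C}) ?subr0; last exact: polyC0.
  congr (_%:P * _); rewrite /lam /c; move: (pi : R) => v.
  by apply: complex_ext => /=; ring.
have i2 : ('i : C) ^+ 2 = - 1 by rewrite sqr_i.
have WF := wigner_functional piC_neq0 LD LZ i2 lam0 LE j k.
transitivity ((hermite_norm j * hermite_norm k * Num.sqrt 2)%:C *
  functional2 L (wigner_poly (pi%:C : C) 'i j k)).
  rewrite /functional2 /L /gaussian_functional -CintegralZl; last exact: Cintegrable_gaussian.
  apply: eq_Cintegral => x.
  rewrite -(functional_horner LD LZ).
  transitivity ((hermite_norm j * hermite_norm k * Num.sqrt 2)%:C *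
      ((gauss (2 * pi) x)%:C * cis (phase 0 (tau * (2 * pi)) x)) *
      L (wigner_poly (pi%:C : C) 'i j k).[(x%:C)%:P]); last first.
    by move: (L _) (_%:C) (_ * cis _) => *; ring.
  rewrite /L /gaussian_functional -CintegralZl; last exact: Cintegrable_gaussian.
  apply: eq_Cintegral => y; rewrite wigner1E.
  rewrite (_ : tau * _ = phase 0 (tau * (2 * pi)) x + phase 0 (tau * (2 * pi)) y); last first.
    by rewrite /phase; move: (pi : R) => v; ring.
  rewrite (cisD (phase 0 (tau * (2 * pi)) x)) (real_complexM (gauss _ x)).
  set A := (wigner_poly _ _ _ _).[_].[_].
  move: (cis (phase _ _ x)) (cis (phase _ _ y)) A
    ((gauss _ x)%:C) ((gauss _ y)%:C) (_%:C) => *; ring.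
rewrite WF; have [->|] := eqVneq j k; last by rewrite !mul0r mulr0.
rewrite !mul1r gaussian_chirp// (_ : 2 * pi -i* _ = 2 * pi%:C * c); last first.
  by rewrite /c; move: (pi : R) => v; apply: complex_ext => /=; ring.
rewrite -expr2 hermite_norm2.
have s2 : Num.sqrt 2 * Num.sqrt 2 = 2 :> R by rewrite -expr2 sqr_sqrtr.
have f0 : (k`!%:R : R) != 0 by rewrite pnatr_eq0 -lt0n fact_gt0.
have fC0 : (k`!%:R : C) != 0 by rewrite pnatr_eq0 -lt0n fact_gt0.
have -> : (8 / lam - pi%:C^-1 : C) = pi%:C^-1 * ((1 +i* tau) / c).
  rewrite /lam; move: (pi%:C : C) piC_neq0 => v v0.
  have -> : 1 +i* tau = 2 - c by rewrite /c; apply: complex_ext => /=; ring.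
  by move: c c0 {lam lam0 L LD LZ LE WF} => c c0; field; rewrite v0 c0.
have -> : Num.sqrt 2 * (pi ^+ k / k`!%:R) * Num.sqrt 2 = 2 * (pi ^+ k / k`!%:R) :> R.
  by rewrite mulrAC s2.
rewrite !real_complexM rmorphXn fmorphV !rmorph_nat /=.
rewrite !exprMn exprVn exprS -/c.
have : (pi%:C : C) ^+ k != 0 by rewrite expf_neq0.
have : c ^+ k != 0 by rewrite expf_neq0.
rewrite exprVn.
clear lam lam0 L LD LZ LE WF; clearbody c.
move: (c ^+ k) ((1 +i* tau) ^+ k) ((pi%:C : C) ^+ k) (pi%:C : C) piC_neq0 (k`!%:R : C) fC0.
move=> ck tk pk p p0 f f00 ck0 pk0; field.
by rewrite ?f00 ?c0 ?p0 ?pk0 ?ck0.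
Qed.

End wigner_hermite.

(** * Orthonormal expansions *)

(** The finite index sets [s N] exhaust the index type; they are left arbitrary
    because in several variables the multi-indices are summed by increasing
    order. *)
Section expansion.
Import HBSimple HBNNSimple.
Context d (T : measurableType d) {R : realType}.
Variable mu : {measure set T -> \bar R}.
Variables (K : eqType) (e : K -> T -> R) (s : nat -> seq K).
Hypothesis se : forall i, sqintegrable mu (e i).
Hypothesis oe : forall i j, ip mu (e i) (e j) = (i == j)%:R.
Hypothesis us : forall N, uniq (s N).
Implicit Types f g w : T -> R.

Definition residual N f := fun x => f x - orthoproj mu e (s N) f x.

Definition energy f := ip mu f f.

Definition expands f :=
  sqintegrable mu f /\ energy (residual N f) @[N --> \oo] --> 0.

Lemma sqintegrable_residual N f : sqintegrable mu f -> sqintegrable mu (residual N f).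
Proof. by move=> sf; apply: sqintegrableB => //; exact: sqintegrable_orthoproj. Qed.

Lemma energy_residual N f : sqintegrable mu f ->
  energy (residual N f) = energy f - \sum_(i <- s N) ip mu f (e i) ^+ 2.
Proof. by move=> sf; rewrite /energy ip_residual. Qed.

Lemma energy_residual_le N f : sqintegrable mu f ->
  energy (residual N f) <= energy f.
Proof.
move=> sf; rewrite energy_residual// gerBl.
by apply: sumr_ge0 => i _; exact: sqr_ge0.
Qed.

Lemma residualD N f g : sqintegrable mu f -> sqintegrable mu g ->
  residual N (fun x => f x + g x) = fun x => residual N f x + residual N g x.
Proof.
move=> sf sg; apply/funext => x; rewrite /residual /orthoproj.
rewrite addrACA -opprD -big_split/=; congr (_ - _).
by apply: eq_bigr => i _; rewrite ipDl// mulrDl.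
Qed.

Lemma residualZ N c f : sqintegrable mu f ->
  residual N (fun x => c * f x) = fun x => c * residual N f x.
Proof.
move=> sf; apply/funext => x; rewrite /residual /orthoproj mulrBr mulr_sumr.
by congr (_ - _); apply: eq_bigr => i _; rewrite ipZl// mulrA.
Qed.

(** The residual is orthogonal to the projections. *)
Lemma ip_residual_swap N f g : sqintegrable mu f -> sqintegrable mu g ->
  ip mu (residual N f) g = ip mu (residual N f) (residual N g).
Proof.
move=> sf sg; rewrite ip_residual// /residual ipBl//; last exact: sqintegrable_orthoproj.
by rewrite ip_orthoproj.
Qed.

Lemma energyZ c f : sqintegrable mu f -> energy (fun x => c * f x) = c ^+ 2 * energy f.
Proof.
move=> sf; have sc := sqintegrableZl c sf.
by rewrite /energy ipZl// ipC ipZl// mulrA.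
Qed.

Lemma expands0 : expands (fun=> 0).
Proof.
have s0 := @sqintegrable0 _ T R mu; split => //.
apply: (@squeeze_cvgr _ _ _ _ (fun=> 0) (fun=> 0)); [|exact: cvg_cst..].
apply: nearW => N; rewrite ip_ge0/= (le_trans (energy_residual_le _ s0))//.
by rewrite /energy ip_sqr; under eq_Rintegral do rewrite expr0n; rewrite /Rintegral integral0.
Qed.

Lemma expandsD f g : expands f -> expands g -> expands (fun x => f x + g x).
Proof.
move=> [sf cf] [sg cg]; split; first exact: sqintegrableD.
apply: (@squeeze_cvgr _ _ _ _ (fun=> 0)
  (fun N => 2 * energy (residual N f) + 2 * energy (residual N g))).
- apply: nearW => N; rewrite ip_ge0/= residualD//.
  by apply: ip_sqrD_le; exact: sqintegrable_residual.
- exact: cvg_cst.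
- rewrite -[X in _ --> X](_ : 2 * 0 + 2 * 0 = 0 :> R); last by rewrite mulr0 addr0.
  by apply: cvgD; [exact: (cvgMl_tmp cf)|exact: (cvgMl_tmp cg)].
Qed.

Lemma expandsZ c f : expands f -> expands (fun x => c * f x).
Proof.
move=> [sf cf]; split; first exact: sqintegrableZl.
have H N : energy (residual N (fun x => c * f x)) = c ^+ 2 * energy (residual N f).
  by rewrite residualZ// energyZ//; exact: sqintegrable_residual.
by under eq_fun do rewrite H; rewrite -(mulr0 (c ^+ 2)); exact: (cvgMl_tmp cf).
Qed.

Lemma expandsB f g : expands f -> expands g -> expands (fun x => f x - g x).
Proof.
move=> ef eg; have := expandsD ef (expandsZ (-1) eg).
by under eq_fun do rewrite mulN1r.
Qed.

Lemma expands_sum J (r : seq J) (F : J -> T -> R) :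
  (forall j, expands (F j)) -> expands (fun x => \sum_(j <- r) F j x).
Proof.
move=> eF; elim: r => [|j r IH].
  by under eq_fun do rewrite big_nil; exact: expands0.
by under eq_fun do rewrite big_cons; exact: (expandsD (eF j) IH).
Qed.

(** The set of functions that are limits of their expansions is closed, because
    taking residuals does not increase the energy. *)
Lemma expands_approx f : sqintegrable mu f ->
  (forall eps, 0 < eps -> exists2 g, expands g & energy (fun x => f x - g x) <= eps) ->
  expands f.
Proof.
move=> sf H; split => //; apply/cvgr0Pnorm_le => eps e0.
(* The energy of a sum is at most twice the sum of the energies, and there are
   two terms. *)
have [g [sg cg] fg] := H (eps / 4) ltac:(by rewrite divr_gt0).
have e4 : 0 < eps / 4 by rewrite divr_gt0.
move/cvgr0Pnorm_le : (cg) => /(_ _ e4) cg'.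
near=> N; rewrite ger0_norm ?ip_ge0//.
have sfg := sqintegrableB sf sg.
have -> : f = (fun x => (f x - g x) + g x) by apply/funext => x; rewrite subrK.
rewrite residualD//.
have := ip_sqrD_le (sqintegrable_residual N sfg) (sqintegrable_residual N sg).
have A := le_trans (energy_residual_le N sfg) fg.
have B : energy (residual N g) <= eps / 4.
  by near: N; apply: filterS cg' => N; rewrite ger0_norm ?ip_ge0.
rewrite /energy in A B *; move: A B; set P := ip mu _ _; set Q := ip mu _ _.
by move=> A B /le_trans; apply; lra.
Unshelve. all: by end_near. Qed.

(** Dominated convergence, with the majorant [(2 g)^2] for the squared distances. *)
Lemma expands_dominated (f_ : nat -> T -> R) f g :
  (forall n, expands (f_ n)) -> measurable_fun [set: T] f ->
  {ae mu, forall x, f_ ^~ x @ \oo --> f x} -> sqintegrable mu g ->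
  (forall n x, `|f_ n x| <= g x) -> (forall x, `|f x| <= g x) -> expands f.
Proof.
move=> ef_ mf cf sg fg_ fg.
have sf : sqintegrable mu f.
  by apply: (sqintegrable_dominated mf sg) => x; rewrite (le_trans (fg x))// ler_norm.
have mf_ n : measurable_fun [set: T] (f_ n) by have [[]] := ef_ n.
have [|||||_ C] := @Rintegral_dominated_cvg _ T R mu (fun n x => (f x - f_ n x) ^+ 2)
  (fun=> 0) (fun x => 4 * g x ^+ 2).
- by move=> n; apply: measurable_funX; exact: measurable_funB.
- exact: measurable_cst.
- apply: filterS cf => x cx.
  rewrite -[X in _ --> X](_ : (f x - f x) * (f x - f x) = 0 :> R); last by rewrite subrr mulr0.
  under eq_fun do rewrite expr2.
  by apply: cvgM; (apply: cvgB; [exact: (cvg_cst (f x))|exact: cx]).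
- by apply: rintegrableZl; exact: sg.2.
- move=> n x; rewrite ger0_norm ?sqr_ge0//.
  rewrite (_ : 4 * g x ^+ 2 = (2 * g x) ^+ 2); last by ring.
  have g0 : 0 <= g x by exact: le_trans (normr_ge0 _) (fg x).
  rewrite -(real_normK (num_real (f x - f_ n x))) lerXn2r ?nnegrE ?mulr_ge0//.
  rewrite (le_trans (ler_normB _ _))//.
  by have := fg_ n x; have := fg x; lra.
rewrite [X in _ --> X]/Rintegral integral0 in C.
apply: expands_approx => // eps e0.
move/cvgr0Pnorm_le : C => /(_ _ e0) [N _ HN].
exists (f_ N) => //; have := HN N (leqnn _).
by rewrite /= ger0_norm ?Rintegral_ge0 ?/energy ?ip_sqr// => *; exact: sqr_ge0.
Qed.

Let indic_sum (F : (set T)^nat) x : trivIset [set: nat] F ->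
  (forall n, \sum_(k < n) (\1_(F k) x : R) <= 1) /\
  \sum_(k < n) (\1_(F k) x : R) @[n --> \oo] --> (\1_(\bigcup_k F k) x : R).
Proof.
move=> tF; have [[k0 _ Fx]|nFx] := pselect ((\bigcup_k F k) x); last first.
  have H n : \sum_(k < n) (\1_(F k) x : R) = 0.
    by apply: big1 => k _; rewrite indicE memNset// => Fk; apply: nFx; exists k.
  split=> [n|]; first by rewrite H.
  by under eq_fun do rewrite H; rewrite indicE memNset//; exact: cvg_cst.
have H n : \sum_(k < n) (\1_(F k) x : R) = (k0 < n)%N%:R.
  have E k : \1_(F k) x = (k == k0)%:R :> R.
    rewrite indicE; congr (_%:R); case: eqP => [->|kk0]; first by rewrite mem_set.
    rewrite memNset// => Fk; apply: kk0.
    by apply: (tF k k0 I I); exists x.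
  under eq_bigr do rewrite E.
  case: ltnP => [kn|nk].
    rewrite (bigD1 (Ordinal kn))//= eqxx big1 ?addr0// => i.
    by rewrite -val_eqE/= => /negbTE ->.
  by rewrite big1// => i _; rewrite ltn_eqF// (leq_trans (ltn_ord i)).
split=> [n|]; first by rewrite H; case: (_ < _)%N.
rewrite indicE mem_set; last by exists k0.
under eq_fun do rewrite H.
apply: cvg_near_cst; exists k0.+1 => // n /= kn.
by rewrite kn.
Qed.

(** The sets whose weighted indicator is the limit of its expansion form a
    Dynkin class; simple functions for the quotient [f / w] then approximate a
    nonnegative [f] monotonically.  The weight [w] makes the indicators of sets
    of infinite measure square-integrable. *)
Lemma expands_all w (G : set (set T)) :
  sqintegrable mu w -> (forall x, 0 < w x) ->
  measurable_fun [set: T] (fun x => (w x)^-1) ->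
  @measurable _ T = <<s G >> -> setI_closed G -> expands w ->
  (forall A, G A -> expands (fun x => w x * \1_A x)) ->
  forall f, sqintegrable mu f -> expands f.
Proof.
move=> sw w0 mwV GE GI ew eG.
have eA A : measurable A -> expands (fun x => w x * \1_A x).
  rewrite GE; move: A.
  apply: (@dynkin_induction _ _ G (fun A => expands (fun x => w x * \1_A x)) GE GI).
  - by under eq_fun do rewrite indicT mulr1.
  - exact: eG.
  - move=> S mS eS.
    rewrite (_ : (fun x => _) = fun x => w x - w x * \1_S x); first exact: (expandsB ew eS).
    apply/funext => x; rewrite !indicE in_setC.
    by case: (x \in S); rewrite ?mulr1 ?mulr0 ?subrr ?subr0.
  - move=> F mF tF eF.
    apply: (@expands_dominated (fun n x => \sum_(k < n) (w x * \1_(F k) x)) _ w).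
    + move=> n.
      exact: (@expands_sum _ (index_enum 'I_n) (fun k x => w x * \1_(F k) x) (fun k => eF k)).
    + apply: measurable_funM; first exact: sw.1.
      by apply: measurable_indic; exact: bigcup_measurable.
    + apply: aeW => x; under eq_fun do rewrite -mulr_sumr.
      by apply: cvgMl_tmp; exact: (indic_sum x tF).2.
    + exact: sw.
    + move=> n x; rewrite -mulr_sumr normrM ger0_norm ?(ltW (w0 x))//.
      rewrite ger0_norm; last by apply: sumr_ge0 => k _.
      by rewrite ler_piMr ?(indic_sum x tF).1// ltW.
    + move=> x; rewrite normrM !ger0_norm ?(ltW (w0 x))//.
      by rewrite ler_piMr ?indic_le1// ltW.
have eN f : sqintegrable mu f -> (forall x, 0 <= f x) -> expands f.
  move=> sf f0.
  have mg : measurable_fun [set: T] (fun x => (f x / w x)%:E).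
    apply/measurable_EFinP; apply: measurable_funM; first exact: sf.1.
    exact: mwV.
  have g0 x : [set: T] x -> (0 <= (f x / w x)%:E)%E.
    by move=> _; rewrite lee_fin divr_ge0// ltW.
  pose h := nnsfun_approx measurableT mg.
  apply: (@expands_dominated (fun n x => w x * h n x) f f).
  - move=> n; under eq_fun do rewrite fimfunE fsbig_finite// mulr_sumr.
    apply: expands_sum => y.
    under eq_fun do rewrite mulrCA.
    apply: expandsZ; apply: eA; exact: measurable_sfunP.
  - exact: sf.1.
  - apply: aeW => x; rewrite -[X in _ --> X](mulVKf (lt0r_neq0 (w0 x)) (f x)).
    apply: cvgMl_tmp; rewrite mulrC.
    have /fine_cvg C := cvg_nnsfun_approx measurableT mg g0 (I : [set: T] x).
    exact: C.
  - exact: sf.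
  - move=> n x; rewrite ger0_norm ?mulr_ge0 ?(ltW (w0 x))//.
    rewrite mulrC -ler_pdivlMr//.
    have C : (fun m => h m x) @ \oo --> f x / w x.
      exact: (fine_cvg (cvg_nnsfun_approx measurableT mg g0 (I : [set: T] x))).
    have nd : {homo (fun m => h m x) : m k / (m <= k)%N >-> m <= k}.
      by move=> m k mk; apply/lefP/nd_nnsfun_approx.
    have := nondecreasing_cvgn_le nd (cvgP _ C) n.
    by rewrite (cvg_lim _ C).
  - by move=> x; rewrite ger0_norm.
move=> f sf; have mf := sf.1.
have sp : sqintegrable mu (fun x => Num.max (f x) 0).
  apply: (sqintegrable_dominated _ sf); first exact: measurable_maxr.
  by move=> x; rewrite /Num.max; case: ifP => // _; rewrite normr0.
have sn : sqintegrable mu (fun x => Num.max (- f x) 0).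
  apply: (sqintegrable_dominated _ sf).
    by apply: measurable_maxr => //; exact: measurableT_comp.
  by move=> x; rewrite /Num.max; case: ifP => // _; rewrite ?normrN ?normr0.
rewrite (_ : f = fun x => Num.max (f x) 0 - Num.max (- f x) 0); last first.
  apply/funext => x; rewrite /Num.max oppr_lt0.
  by case: ltgtP => [||->]; rewrite ?subr0 ?sub0r ?opprK ?oppr0 ?subrr.
by apply: expandsB; [apply: (eN _ sp)|apply: (eN _ sn)] => x; rewrite le_max lexx orbT.
Qed.

End expansion.

(** * The Dirichlet kernel *)

Section dirichlet.
Context {R : realType}.
Local Notation C := R[i].
Implicit Types (a t tau : R) (n : nat).

Let pi_neq0 : (pi : R) != 0. Proof. by rewrite gt_eqF// pi_gt0. Qed.

Lemma ge0_Rintegral_affine (c r : R) (f : R -> R) : r != 0 ->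
  measurable_fun [set: R] f -> (forall x, 0 <= f x) ->
  \int[leb]_x f x = `|r| * \int[leb]_x f (c + r * x).
Proof.
move=> r0 mf f0; rewrite /Rintegral.
rewrite (ge0_integral_affine c r0 (f := fun x => (f x)%:E)); last first.
- by move=> x; rewrite lee_fin.
- exact/measurable_EFinP.
have k0 : 0 < `|r| by rewrite normr_gt0.
have : (0 <= \int[leb]_x (f x)%:E)%E by apply: integral_ge0 => x _; rewrite lee_fin.
case: (\int[leb]_x _)%E => [x| |]//= x0; first by rewrite mulrA divff ?mul1r// gt_eqF.
by rewrite gt0_muley ?lte_fin ?invr_gt0//= mulr0.
Qed.

Definition window a : R -> R := \1_(`[- a, a]%classic).

Lemma window_ge0 a t : 0 <= window a t.
Proof. by rewrite /window indicE. Qed.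

Lemma window_le1 a t : window a t <= 1.
Proof. by rewrite /window indicE; case: (_ \in _). Qed.

Lemma windowE a t : window a t = (`|t| <= a)%R%:R.
Proof. by rewrite /window indicE mem_setE/= in_itv/= -ler_norml. Qed.

Lemma measurable_window a : measurable_fun [set: R] (window a).
Proof. exact: measurable_indic. Qed.

Lemma rintegrable_window a : rintegrable leb (window a).
Proof.
apply: rintegrable_ge0; [exact: measurable_window|exact: window_ge0|].
rewrite integral_indic// setIT [X in (X < _)%E]lebesgue_measure_itv/=.
by case: ifP => // _; rewrite -EFinB ltry.
Qed.

(** The Fourier transform of this function is the indicator of [-a, a], as an
    improper integral; the division by 0 at [tau = 0] gives the value 0. *)
Definition dirichlet a tau := sin (a * tau) / (pi * tau).

Lemma window_fourier a tau t : 0 < a -> tau != 0 ->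
  Cintegral leb (fun s => cis (tau * (t - s)) * (window a s)%:C) =
  (2 * pi * dirichlet a tau)%:C * cis (tau * t).
Proof.
move=> a0 t0; have aa : - a < a by lra.
have dl s : is_derive s (1 : R) (fun s => tau * (t - s)) (- tau).
  have : is_derive s (1 : R) (fun s => tau * (t - s)) (0 * (t - s) + tau * (0 - 1)).
    exact: is_derive_mul.
  by rewrite mul0r add0r sub0r mulrN1.
have ds s : is_derive s (1 : R) (fun s => - tau^-1 * sin (tau * (t - s)))
    (cos (tau * (t - s))).
  apply: is_derive_eq (is_derive_mul (is_derive_cst _ _ _)
    (is_derive1_comp (is_derive_sin _) (dl s))) _.
  by rewrite /GRing.scale/= mul0r add0r -[X in X * _ = _]/(- tau^-1); move: (cos _) => c; field.
have dc s : is_derive s (1 : R) (fun s => tau^-1 * cos (tau * (t - s)))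
    (sin (tau * (t - s))).
  apply: is_derive_eq (is_derive_mul (is_derive_cst _ _ _)
    (is_derive1_comp (is_derive_cos _) (dl s))) _.
  by rewrite /GRing.scale/= mul0r add0r -[X in X * _ = _]/(tau^-1); move: (sin _) => c; field.
have cc : continuous (fun s => cos (tau * (t - s))).
  move=> s; apply: differentiable_continuous; apply/derivable1_diffP.
  by have [D _] := is_derive1_comp (is_derive_cos _) (dl s).
have cs : continuous (fun s => sin (tau * (t - s))).
  move=> s; apply: differentiable_continuous; apply/derivable1_diffP.
  by have [D _] := is_derive1_comp (is_derive_sin _) (dl s).
have two : 2 * pi * dirichlet a tau = 2 * (sin (a * tau) / tau).
  by rewrite /dirichlet; move: (pi : R) pi_neq0 (sin _) => v v0 s; field; rewrite ?v0 ?t0.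
rewrite two; apply: complex_ext; rewrite ?ReCM ?ImCM /Cintegral /=.
- under eq_Rintegral do rewrite mulr0 subr0.
  rewrite (Rintegral_itv_derive aa ds cc).
  rewrite !mulrBr !mulrN !opprK !sinB !sinD !(mulrC tau a).
  by move: (sin (tau * t)) (cos (tau * t)) (sin (a * tau)) (cos (a * tau)) => *; field.
- under eq_Rintegral do rewrite mulr0 add0r.
  rewrite (Rintegral_itv_derive aa dc cs).
  rewrite !mulrBr !mulrN !opprK !cosB !cosD !(mulrC tau a).
  by move: (sin (tau * t)) (cos (tau * t)) (sin (a * tau)) (cos (a * tau)) => *; field.
Qed.

(** The continuous functions [x / (x^2 + 1 / (n + 1))] converge to the inverse
    at every point, including 0 where its value is 0. *)
Lemma measurable_inv : measurable_fun [set: R] (fun x : R => x^-1).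
Proof.
apply: (@measurable_fun_cvg _ _ _ _ (fun n (x : R) => x / (x ^+ 2 + n.+1%:R^-1))).
  move=> n; apply: continuous_measurable_fun => x.
  apply: cvgM; first exact: cvg_id.
  apply: cvgV; first by rewrite gt_eqF// ltr_wpDl// sqr_ge0.
  apply: cvgD; last exact: cvg_cst.
  exact: exprn_continuous.
move=> x _; have [->|x0] := eqVneq x 0.
  by under eq_fun do rewrite mul0r; rewrite invr0; exact: cvg_cst.
rewrite -[X in _ --> X](_ : x / (x ^+ 2 + 0) = x^-1); last by rewrite addr0; field.
apply: cvgMl_tmp; apply: cvgV; first by rewrite addr0 expf_neq0.
by apply: cvgD; [exact: cvg_cst|exact: cvg_harmonic].
Qed.

Lemma measurable_dirichlet a : measurable_fun [set: R] (dirichlet a).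
Proof.
apply: measurable_funM.
  apply: measurableT_comp; last exact: measurable_funM.
  exact: (continuous_measurable_fun (@continuous_sin R)).
by apply: (measurableT_comp measurable_inv); exact: measurable_funM.
Qed.

Lemma norm_sin_le t : `|sin t| <= `|t|.
Proof.
wlog t0 : t / 0 < t => [H|].
  have [/H //|t0|<-] := ltgtP 0 t; last by rewrite sin0.
  by rewrite -normrN -sinN -(normrN t) H// oppr_gt0.
have [c _ E] := @MVT R sin cos 0 t t0 (fun x _ => is_derive_sin x)
  (continuous_subspaceT (@continuous_sin R)).
rewrite sin0 !subr0 in E.
by rewrite E normrM ler_piMl// norm_cos_le1.
Qed.

Lemma dirichlet_le a tau : 0 <= a -> `|dirichlet a tau| <= a.
Proof.
move=> a0; have [->|t0] := eqVneq tau 0.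
  by rewrite /dirichlet mulr0 sin0 mul0r normr0.
rewrite /dirichlet normrM normfV ler_pdivrMr ?normr_gt0 ?mulf_neq0//.
apply: le_trans (norm_sin_le _) _; rewrite normrM (ger0_norm a0) ler_wpM2l//.
rewrite normrM ler_peMl// ger0_norm ?pi_ge0//.
by apply: le_trans (pi_ge2 R); rewrite ler1n.
Qed.

Lemma dirichlet_decay a tau : `|dirichlet a tau| <= `|tau|^-1.
Proof.
rewrite /dirichlet normrM normfV normrM invfM mulrA ler_piMl ?invr_ge0//.
rewrite (ger0_norm (pi_ge0 R)) ler_pdivrMr ?pi_gt0// mul1r.
apply: le_trans (norm_sin_le1 _) _.
by apply: le_trans (pi_ge2 R); rewrite ler1n.
Qed.

(** The square makes the Fourier transform of the damping Gaussian a [heat]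
    kernel at scale [1 / (n + 1)]. *)
Definition damping n : R := n.+1%:R ^- 2.

Lemma damping_gt0 n : 0 < damping n.
Proof. by rewrite /damping invr_gt0 exprn_gt0. Qed.

Definition damped n a tau := dirichlet a tau * gauss (damping n) tau.

(** The Fourier transform of [e^{- tau^2}], scaled to have integral 1. *)
Definition heat t : R := (2 * Num.sqrt pi)^-1 * gauss (4^-1) t.

Lemma heat_ge0 t : 0 <= heat t.
Proof. by rewrite mulr_ge0 ?gauss_ge0// invr_ge0 mulr_ge0// sqrtr_ge0. Qed.

Lemma measurable_heat : measurable_fun [set: R] heat.
Proof. by apply: measurable_funM => //; exact: measurable_gauss. Qed.

Lemma rintegrable_heat : rintegrable leb heat.
Proof. by apply: rintegrableZl; apply: rintegrable_gauss. Qed.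

Lemma Rintegral_heat : \int[leb]_t heat t = 1.
Proof.
rewrite rintegralZl ?Rintegral_gauss//; last exact: rintegrable_gauss.
rewrite invrK mulrC sqrtrM ?pi_ge0// (_ : 4 = 2 ^+ 2 :> R); last by ring.
rewrite sqrtr_sqr ger0_norm//.
have : Num.sqrt pi != 0 :> R by rewrite gt_eqF// sqrtr_gt0 pi_gt0.
by move: (Num.sqrt _) => w w0; field.
Qed.

Let window_heat_ge0 a t s : 0 <= window a t * heat s.
Proof. by apply: mulr_ge0; [exact: window_ge0|exact: heat_ge0]. Qed.

Let window_heat_le a t s : window a t * heat s <= heat s.
Proof. by rewrite ler_piMl ?window_le1 ?heat_ge0. Qed.

Definition mollified n a t := \int[leb]_s (window a (t - s / n.+1%:R) * heat s).

Lemma rintegrable_mollified n a t :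
  rintegrable leb (fun s => window a (t - s / n.+1%:R) * heat s).
Proof.
apply: (rintegrable_dominated _ rintegrable_heat).
  apply: measurable_funM; last exact: measurable_heat.
  apply: measurableT_comp; first exact: measurable_window.
  by apply: measurable_funB => //; exact: measurable_funM.
move=> s; rewrite ger0_norm ?window_heat_ge0//; exact: window_heat_le.
Qed.

Lemma mollified_ge0 n a t : 0 <= mollified n a t.
Proof. by apply: Rintegral_ge0 => s _; exact: window_heat_ge0. Qed.

Lemma mollified_le1 n a t : mollified n a t <= 1.
Proof.
rewrite -Rintegral_heat; apply: le_Rintegral => //.
- exact: rintegrable_mollified.
- exact: rintegrable_heat.
Qed.

(** Off the boundary of the window, the integrand at any given [s] is eventually
    equal to its limit. *)
Lemma mollified_cvg a t : `|t| != a ->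
  mollified n a t @[n --> \oo] --> window a t.
Proof.
move=> ta.
have [|||||_ H] := @Rintegral_dominated_cvg _ _ R leb
  (fun n s => window a (t - s / n.+1%:R) * heat s) (fun s => window a t * heat s) heat.
- by move=> n; exact: rintegrable_measurable (rintegrable_mollified n a t).
- by apply: measurable_funM => //; exact: measurable_heat.
- apply: aeW => s; apply: cvgMr_tmp; apply: cvg_near_cst.
  have e0 : 0 < `| `|t| - a | by rewrite normr_gt0 subr_eq0.
  have : s / n.+1%:R @[n --> \oo] --> s * 0 by apply: cvgMl_tmp; exact: cvg_harmonic.
  rewrite mulr0 => /cvgr0Pnorm_lt/(_ _ e0) [N _ HN].
  exists N => // n /HN/= h; rewrite !windowE; congr (_%:R).
  have := lerB_normD t (- (s / n.+1%:R)); rewrite normrN.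
  have := ler_normD t (- (s / n.+1%:R)); rewrite normrN.
  have := lerB_normD (t - s / n.+1%:R) (s / n.+1%:R).
  have := ler_normD (t - s / n.+1%:R) (s / n.+1%:R).
  move: h; move: (s / _) => r; rewrite subrK.
  move: (`|t|) (`|r|) (`|t - r|) ta {e0} => T r1 T2 ta.
  case: (lerP T a) => Ta.
    move=> h1 h2 h3 h4 h5; have h : T2 <= a by lra.
    by rewrite h.
  move=> h1 h2 h3 h4 h5; have h : a < T2 by lra.
  by rewrite leNgt h.
- exact: rintegrable_heat.
- move=> n s; rewrite ger0_norm ?window_heat_ge0//; exact: window_heat_le.
move: H; rewrite rintegralZl; last exact: rintegrable_heat.
by rewrite Rintegral_heat mulr1.
Qed.

Lemma measurable_damped n a : measurable_fun [set: R] (damped n a).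
Proof.
by apply: measurable_funM; [exact: measurable_dirichlet|exact: measurable_gauss].
Qed.

Lemma damped_le n a tau : 0 <= a -> `|damped n a tau| <= a * gauss (damping n) tau.
Proof.
move=> a0; rewrite normrM (ger0_norm (gauss_ge0 _ _)).
by rewrite ler_wpM2r ?gauss_ge0 ?dirichlet_le.
Qed.

Lemma damped_integrable n a t : 0 <= a ->
  Cintegrable leb (fun tau => (damped n a tau)%:C * cis (tau * t)).
Proof.
move=> a0; apply: (Cintegrable_dominated _ (rintegrableZl a (rintegrable_gauss (damping_gt0 n)))).
- apply: CmeasurableM; first by apply: Cmeasurable_real; exact: measurable_damped.
  by apply: Cmeasurable_cis; exact: measurable_funM.
- by move=> tau; rewrite normcM normc_cis mulr1 normc_realE damped_le.
Qed.

Let phase_integrand n a t (z : R * R) : C :=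
  (gauss (damping n) z.1)%:C * (cis (z.1 * (t - z.2)) * (window a z.2)%:C).

Let phase_integrandP n a t :
  Cintegrable (leb \x leb)%E (phase_integrand n a t).
Proof.
apply: (Cintegrable_dominated _
  (rintegrable_prod (rintegrable_gauss (damping_gt0 n)) (rintegrable_window a))).
- apply: CmeasurableM.
    by apply: Cmeasurable_real; exact: (measurableT_comp (measurable_gauss _) measurable_fst).
  apply: CmeasurableM; last first.
    by apply: Cmeasurable_real; exact: (measurableT_comp (measurable_window _) measurable_snd).
  apply: Cmeasurable_cis; apply: measurable_funM; first exact: measurable_fst.
  by apply: measurable_funB => //; exact: measurable_snd.
- move=> z; rewrite !normcM normc_cis mul1r !normc_realE.
  by rewrite !ger0_norm ?gauss_ge0 ?window_ge0.
Qed.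

(** Writing the kernel as an integral over the window ([window_fourier]) and
    exchanging, the Fourier transform becomes the convolution of the window
    with the Fourier transform of the damping factor.  The Gaussian makes the
    double integral absolutely convergent. *)
Lemma damped_fourier n a t : 0 < a ->
  Cintegral leb (fun tau => (damped n a tau)%:C * cis (tau * t)) =
  (mollified n a t)%:C.
Proof.
move=> a0; have d0 := damping_gt0 n.
have two_pi : (2 * pi)%:C != 0 :> C.
  by rewrite eq_complex/= negb_and mulf_neq0.
apply: (mulfI two_pi); rewrite -CintegralZl; last by apply: damped_integrable; exact: ltW.
have [f1 f2] := phase_integrandP n a t.
transitivity (Cintegral leb (fun tau => Cintegral leb (fun s => phase_integrand n a t (tau, s)))).
  apply: ae_eq_Cintegral.
  - by apply: CmeasurableM; [exact: Cmeasurable_cst|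
      exact: Cintegrable_measurable (damped_integrable _ _ (ltW a0))].
  - split; [exact: measurable_partial_integral1 (rintegrable_measurable f1)|
            exact: measurable_partial_integral1 (rintegrable_measurable f2)].
  (* [window_fourier] divides by [tau]. *)
  - exists [set 0]; split=> //; first exact: lebesgue_measure_set1.
    move=> tau /= h; apply: contrapT => /eqP t0; apply: h.
    rewrite /phase_integrand/= (CintegralZl (gauss (damping n) tau)%:C) ?window_fourier//.
      rewrite /damped; move: (dirichlet _ _) (gauss _ _) (cis _) => x y z.
      by rewrite !real_complexM; ring.
    apply: (Cintegrable_dominated _ (rintegrable_window a)); last first.
    + by move=> s; rewrite normcM normc_cis mul1r normc_realE ger0_norm ?window_ge0.
    + apply: CmeasurableM; last by apply: Cmeasurable_real; exact: measurable_window.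
      by apply: Cmeasurable_cis; apply: measurable_funM => //; exact: measurable_funB.
rewrite (Cintegral_fubini (phase_integrandP n a t)).
transitivity (Cintegral leb (fun s =>
    (window a s * (Num.sqrt (pi / damping n) * gauss (4 * damping n)^-1 (t - s)))%:C)).
  apply: eq_Cintegral => s; rewrite /phase_integrand/=.
  rewrite real_complexM -(gaussian_fourier (t - s) d0) /gaussian_functional.
  rewrite -CintegralZl; last exact: Cintegrable_gaussian.
  apply: eq_Cintegral => tau; rewrite hornerC /phase mul0r addr0 (mulrC tau).
  by move: (cis _) ((gauss _ _)%:C) ((window _ _)%:C) => *; ring.
rewrite Cintegral_real -real_complexM; congr (_%:C).
have n0 : n.+1%:R != 0 :> R by rewrite pnatr_eq0.
have N0 : (- n.+1%:R^-1 : R) != 0 by rewrite oppr_eq0 invr_eq0.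
pose f s := window a s * (Num.sqrt (pi / damping n) * gauss (4 * damping n)^-1 (t - s)).
have mf : measurable_fun [set: R] f.
  apply: measurable_funM; first exact: measurable_window.
  apply: measurable_funM => //; apply: (measurableT_comp (measurable_gauss _)).
  exact: measurable_funB.
have f0 s : 0 <= f s by rewrite !mulr_ge0 ?window_ge0 ?sqrtr_ge0 ?gauss_ge0.
rewrite -[LHS]/(\int[leb]_x f x) (ge0_Rintegral_affine t N0 mf f0).
have E s : f (t + - n.+1%:R^-1 * s) =
    (2 * pi * n.+1%:R) * (window a (t - s / n.+1%:R) * heat s).
  rewrite /f mulNr (mulrC _^-1) opprB addrCA subrr addr0 [RHS]mulrCA; congr (_ * _).
  rewrite /heat (_ : gauss _ _ = gauss 4^-1 s); last first.
    by congr expR; rewrite /damping; move: (n.+1%:R : R) n0 => N nN; field.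
  rewrite (_ : Num.sqrt (pi / damping n) = Num.sqrt pi * n.+1%:R); last first.
    by rewrite sqrtrM ?pi_ge0// /damping invrK sqrtr_sqr ger0_norm.
  have s0' : Num.sqrt pi != 0 :> R by rewrite gt_eqF// sqrtr_gt0 pi_gt0.
  have : (pi : R) = Num.sqrt pi ^+ 2 by rewrite sqr_sqrtr ?pi_ge0.
  move: (Num.sqrt pi) s0' (gauss _ _) => w w0 g ->.
  by move: (n.+1%:R : R) => N; field.
under eq_Rintegral do rewrite E.
rewrite (rintegralZl _ (rintegrable_mollified n a t)) /mollified.
rewrite normrN ger0_norm ?invr_ge0//; move: (Rintegral _ _ _) (pi : R) => I v.
by move: (n.+1%:R : R) n0 => N nN; field.
Qed.

End dirichlet.

(** * Completeness of the Hermite functions on the line *)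

Section hermite_parseval.
Context {R : realType}.
Local Notation C := R[i].
Local Notation E := gaussian_functional.
Local Notation hpC := (hermite_poly (pi%:C : C)).
Local Notation expandsH := (expands leb (@hermite R) (iota 0)).
Local Notation residualH := (residual leb (@hermite R) (iota 0)).
Local Notation energyH := (energy leb).

Let pi_neq0 : (pi : R) != 0. Proof. by rewrite gt_eqF// pi_gt0. Qed.

Let piC_neq0 : (pi%:C : C) != 0. Proof. by rewrite eq_complex /= negb_and pi_neq0. Qed.

Let se := @sqintegrable_hermite R.
Let oe := @hermite_orthonormal R.
Let us N : uniq (iota 0 N) := iota_uniq 0 N.

Definition wavec b x : R := gauss pi x * cos (b * x).
Definition waves b x : R := gauss pi x * sin (b * x).

Lemma measurable_wave (b m : R) :
  measurable_fun [set: R] (fun x => gauss pi x * cos (b * (x - m))) /\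
  measurable_fun [set: R] (fun x => gauss pi x * sin (b * (x - m))).
Proof.
have mb : measurable_fun [set: R] (fun x => b * (x - m)).
  by apply: measurable_funM => //; exact: measurable_funB.
split; apply: measurable_funM; try exact: measurable_gauss.
- exact: (measurableT_comp (continuous_measurable_fun (@continuous_cos R)) mb).
- exact: (measurableT_comp (continuous_measurable_fun (@continuous_sin R)) mb).
Qed.

Let gauss_pi : sqintegrable leb (gauss (pi : R)).
Proof. by apply: sqintegrable_gauss; exact: pi_gt0. Qed.

Lemma sqintegrable_wave (b m : R) :
  sqintegrable leb (fun x => gauss pi x * cos (b * (x - m))) /\
  sqintegrable leb (fun x => gauss pi x * sin (b * (x - m))).
Proof.
have [mc ms] := measurable_wave b m.
split.
- apply: (@sqintegrable_dominated _ _ R leb _ (gauss pi) mc gauss_pi) => x.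
  by rewrite normrM ler_piMr// norm_cos_le1.
- apply: (@sqintegrable_dominated _ _ R leb _ (gauss pi) ms gauss_pi) => x.
  by rewrite normrM ler_piMr// norm_sin_le1.
Qed.

Lemma sqintegrable_wavec b : sqintegrable leb (wavec b).
Proof. by have := (sqintegrable_wave b 0).1; under eq_fun do rewrite subr0. Qed.

Lemma sqintegrable_waves b : sqintegrable leb (waves b).
Proof. by have := (sqintegrable_wave b 0).2; under eq_fun do rewrite subr0. Qed.

Lemma coef_wave b k :
  ip leb (wavec b) (@hermite R k) +i* ip leb (waves b) (@hermite R k) =
  (hermite_norm k)%:C * E (2 * pi) b 0 (hpC k).
Proof.
have p2 : 0 < 2 * pi :> R by rewrite mulr_gt0// pi_gt0.
rewrite /gaussian_functional -CintegralZl; last exact: Cintegrable_gaussian.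
have H x : (hermite_norm k)%:C * ((hpC k).[x%:C] * ((gauss (2 * pi) x)%:C * cis (phase b 0 x))) =
    (wavec b x * hermite k x) +i* (waves b x * hermite k x).
  rewrite horner_hermite_poly hermiteE /wavec /waves -gauss_sqr /phase mul0r addr0.
  move: (gauss _ _) (hermite_norm _) (_.[x]) => g h p.
  by apply: complex_ext => /=; ring.
by under eq_Cintegral do rewrite H.
Qed.

(** By [hermite_functional_phase] the [k]-th coefficient is a multiple of
    [(i b)^k]; the normalisation provides the factorial. *)
Lemma coef_wave_sqr b k :
  ip leb (wavec b) (@hermite R k) ^+ 2 + ip leb (waves b) (@hermite R k) ^+ 2 =
  Num.sqrt 2^-1 * gauss (4 * pi)^-1 b * exp_coeff (b ^+ 2 / (4 * pi)) k.
Proof.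
have p2 : 0 < 2 * pi :> R by rewrite mulr_gt0// pi_gt0.
have LD p q : E (2 * pi) b 0 (p + q) = E (2 * pi) b 0 p + E (2 * pi) b 0 q.
  exact: gaussian_functionalD.
have LZ c p : E (2 * pi) b 0 (c%:P * p) = c * E (2 * pi) b 0 p.
  by rewrite mul_polyC; exact: gaussian_functionalZ.
have LE p : E (2 * pi) b 0 p^`() =
    E (2 * pi) b 0 (((4 * pi%:C)%:P * 'X - (0 +i* b)%:P) * p).
  rewrite (gaussian_functional_deriv _ _ _ p2).
  have -> : 2 * (2 * pi -i* 0) = 4 * pi%:C :> C; last by [].
  by move: (pi : R) => v; apply: complex_ext => /=; ring.
transitivity (normc ((hermite_norm k)%:C * E (2 * pi) b 0 (hpC k)) ^+ 2).
  by rewrite -(coef_wave b k) /= sqr_sqrtr ?addr_ge0 ?sqr_ge0.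
rewrite (hermite_functional_phase piC_neq0 LD LZ LE) (gaussian_fourier b p2).
have -> : ((0 +i* b) / (2 * pi%:C) : C) = 0 +i* (b / (2 * pi)).
  apply: (canLR (mulfK _)); first by rewrite mulf_neq0 ?pnatr_eq0.
  by move: (pi : R) pi_neq0 => v v0; apply: complex_ext => /=; field.
have normci (t : R) l : normc ((0 +i* t) ^+ l) = `|t| ^+ l.
  elim: l => [|l IH]; first by rewrite !expr0 normc1.
  by rewrite !exprS normcM IH /= expr0n add0r sqrtr_sqr.
rewrite !normcM !normc_realE normci !exprMn !real_normK ?num_real//.
rewrite hermite_norm2 exprMn gauss_sqr.
rewrite (_ : 2 * (4 * (2 * pi))^-1 = (4 * pi)^-1); last first.
  by move: (pi : R) pi_neq0 => v v0; field.
rewrite (_ : pi / (2 * pi) = 2^-1); last by move: (pi : R) pi_neq0 => v v0; field.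
rewrite /exp_coeff /= -!exprM (mulnC k 2) !exprM real_normK ?num_real//.
rewrite (_ : b ^+ 2 / (4 * pi) = pi * (b / (2 * pi)) ^+ 2); last first.
  by move: (pi : R) pi_neq0 => v v0; field.
rewrite (sqr_sqrtr (_ : 0 <= 2^-1)) ?invr_ge0//.
rewrite (_ : Num.sqrt 2^-1 = Num.sqrt 2 * 2^-1); last first.
  have w2 : Num.sqrt 2 ^+ 2 = 2 :> R by rewrite sqr_sqrtr.
  have w0 : Num.sqrt 2 != 0 :> R by rewrite gt_eqF// sqrtr_gt0.
  by rewrite sqrtrV//; move: (Num.sqrt 2) w2 w0 => w <- w0; field.
rewrite [(pi * _) ^+ k]exprMn.
move: (gauss _ _) (((b / _) ^+ 2) ^+ k) ((pi : R) ^+ k) (k`!%:R^-1) (Num.sqrt 2) => *; ring.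
Qed.

(** The sum of the exponential series makes Parseval's identity hold for the
    cosine and the sine together.  Both residual energies are nonnegative, so
    each of them tends to 0. *)
Lemma expands_wavec b : expandsH (wavec b) /\ expandsH (waves b).
Proof.
have sc := sqintegrable_wavec b; have ss := sqintegrable_waves b.
pose r N := energyH (residualH N (wavec b)) + energyH (residualH N (waves b)).
have rE N : r N = Num.sqrt 2^-1 - Num.sqrt 2^-1 * gauss (4 * pi)^-1 b *
    series (exp_coeff (b ^+ 2 / (4 * pi))) N.
  rewrite /r !energy_residual// addrACA -opprD -big_split/=; congr (_ - _).
    rewrite /energy /ip -rintegralD; [|exact: sc.2|exact: ss.2].
    have H x : wavec b x * wavec b x + waves b x * waves b x = gauss (2 * pi) x.
      rewrite -gauss_sqr /wavec /waves -[RHS]mulr1 -(cos2Dsin2 (b * x)).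
      by move: (gauss _ _) (cos _) (sin _) => g c s; ring.
    under eq_Rintegral do rewrite H.
    rewrite Rintegral_gauss ?mulr_gt0 ?pi_gt0//; congr Num.sqrt.
    by move: (pi : R) pi_neq0 => v v0; field.
  rewrite /series /= mulr_sumr /index_iota subn0.
  by apply: eq_bigr => k _; rewrite coef_wave_sqr.
have r0 : r N @[N --> \oo] --> 0.
  under eq_fun do rewrite rE.
  have : Num.sqrt 2^-1 - Num.sqrt 2^-1 * gauss (4 * pi)^-1 b *
      series (exp_coeff (b ^+ 2 / (4 * pi))) N @[N --> \oo] -->
    Num.sqrt 2^-1 - Num.sqrt 2^-1 * gauss (4 * pi)^-1 b * expR (b ^+ 2 / (4 * pi)).
    apply: cvgB; first exact: cvg_cst.
    by apply: cvgMl_tmp; exact: is_cvg_series_exp_coeff.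
  rewrite -mulrA /gauss -expRD (mulrC _^-1) addNr expR0 mulr1 subrr.
  exact.
split; [split; first exact: sc|split; first exact: ss].
- apply: (@squeeze_cvgr _ _ _ _ (fun=> 0) r); [|exact: cvg_cst|exact: r0].
  by apply: nearW => N; rewrite ip_ge0/= /r lerDl; exact: ip_ge0.
- apply: (@squeeze_cvgr _ _ _ _ (fun=> 0) r); [|exact: cvg_cst|exact: r0].
  by apply: nearW => N; rewrite ip_ge0/= /r lerDr; exact: ip_ge0.
Qed.

Lemma expands_wave b m : expandsH (fun x => gauss pi x * cos (b * (x - m))).
Proof.
have [ec es] := expands_wavec b.
have := expandsD se (expandsZ se (cos (b * m)) ec) (expandsZ se (sin (b * m)) es).
congr expandsH; apply/funext => x; rewrite /wavec /waves mulrBr cosB.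
move: (gauss _ _) (cos (b * x)) (cos _) (sin (b * x)) (sin _) => *; ring.
Qed.

Lemma measurable_mollified n a m :
  measurable_fun [set: R] (fun x : R => mollified n a (x - m)).
Proof.
apply: (measurable_partial_integral1 leb (f := fun z : R * R =>
  window a (z.1 - m - z.2 / n.+1%:R) * heat z.2)).
apply: measurable_funM; last exact: (measurableT_comp measurable_heat measurable_snd).
apply: (measurableT_comp (measurable_window _)).
apply: measurable_funB; first by apply: measurable_funB => //; exact: measurable_fst.
by apply: measurable_funM => //; exact: measurable_snd.
Qed.

Let gauss_mollified_le n a m (x : R) :
  `|gauss pi x * mollified n a (x - m)| <= gauss pi x.
Proof.
rewrite normrM !ger0_norm ?gauss_ge0 ?mollified_ge0//.
by rewrite ler_piMr ?gauss_ge0 ?mollified_le1.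
Qed.

Lemma sqintegrable_mollified n a m :
  sqintegrable leb (fun x : R => gauss pi x * mollified n a (x - m)).
Proof.
apply: (@sqintegrable_dominated _ _ R leb _ (gauss pi) _ gauss_pi).
  by apply: measurable_funM; [exact: measurable_gauss|exact: measurable_mollified].
by move=> x; apply: le_trans (gauss_mollified_le _ _ _ _) (ler_norm _).
Qed.

(** The mollified window is a superposition of cosines with an integrable weight.
    The energy of its residual, which is the pairing of the residual with the
    function, becomes an integral over the frequency of pairings with waves;
    these tend to 0 by [expands_wavec] and Cauchy-Schwarz, and the residual
    energies are uniformly bounded. *)
Lemma expands_mollified n (a m : R) : 0 < a ->
  expandsH (fun x => gauss pi x * mollified n a (x - m)).
Proof.
move=> a0; set h := fun x => _; have sh : sqintegrable leb h by exact: sqintegrable_mollified.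
split; first exact: sh.
pose g N := residualH N h; have sg N : sqintegrable leb (g N) by exact: sqintegrable_residual.
pose c tau x := gauss pi x * cos (tau * (x - m)).
have sc tau : sqintegrable leb (c tau) := (sqintegrable_wave tau m).1.
have mw : measurable_fun [set: R * R] (fun z : R * R => cos (z.2 * (z.1 - m))).
  apply: (measurableT_comp (continuous_measurable_fun (@continuous_cos R))).
  apply: measurable_funM; first exact: measurable_snd.
  by apply: measurable_funB => //; exact: measurable_fst.
pose f N (z : R * R) := (gauss pi z.1 * g N z.1) * (damped n a z.2 * cos (z.2 * (z.1 - m))).
have idmp : rintegrable leb (fun tau => a * gauss (damping n) tau).
  by apply: rintegrableZl; apply: rintegrable_gauss; exact: damping_gt0.
have igg N : rintegrable leb (fun x => gauss pi x * g N x) by exact: rintegrableM.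
have fi N : rintegrable (leb \x leb)%E (f N).
  apply: (rintegrable_dominated _ (rintegrable_prod (rintegrable_norm (igg N)) idmp)).
    apply: measurable_funM.
      exact: (measurableT_comp (rintegrable_measurable (igg N)) measurable_fst).
    apply: measurable_funM; last exact: mw.
    exact: (measurableT_comp (measurable_damped n a) measurable_snd).
  move=> z; rewrite /f normrM ler_wpM2l// normrM.
  rewrite -[leRHS]mulr1 ler_pM// ?norm_cos_le1//.
  by apply: damped_le; exact: ltW.
have moE t : mollified n a t = \int[leb]_tau (damped n a tau * cos (tau * t)).
  have := congr1 (@complex.Re R) (damped_fourier n t a0); rewrite /Cintegral/= => <-.
  by apply: eq_Rintegral => tau _; rewrite mul0r subr0.
have ic t : rintegrable leb (fun tau => damped n a tau * cos (tau * t)).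
  have [+ _] := damped_integrable n t (ltW a0).
  by under eq_fun do rewrite ReCM /= mul0r subr0.
have IE N tau : damped n a tau * ip leb (c tau) (g N) = \int[leb]_x f N (x, tau).
  rewrite -rintegralZl; last exact: rintegrableM.
  apply: eq_Rintegral => x _; rewrite /f /c/=.
  by move: (gauss _ _) (g N x) (damped _ _ _) (cos _) => *; ring.
have EN N : energyH (g N) = \int[leb]_tau (damped n a tau * ip leb (c tau) (g N)).
  under eq_Rintegral do rewrite IE.
  rewrite -(Rintegral_fubini (fi N)).
  rewrite /energy -(ip_residual_swap se oe us)// ipC.
  apply: eq_Rintegral => x _; rewrite /h moE /f/= rintegralZl; last exact: ic.
  by rewrite -/(g N) mulrAC.
have cE tau : energyH (c tau) <= energyH (gauss pi).
  apply: le_Rintegral; [exact: measurableT|exact: (sc tau).2|exact: gauss_pi.2|].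
  move=> x _; rewrite /c -!expr2 exprMn ler_piMr ?sqr_ge0//.
have ipE N tau : `|ip leb (c tau) (g N)| <= Num.sqrt (energyH (residualH N (c tau))) * Num.sqrt (energyH h).
  rewrite ipC (ip_residual_swap se oe us)// ipC.
  have sr : sqintegrable leb (residualH N (c tau)) by exact: sqintegrable_residual.
  have CS := cauchy_schwarz_norm sr (sg N).
  rewrite -/(g N); apply: (le_trans CS).
  by rewrite ler_wpM2l ?sqrtr_ge0// ler_wsqrtr// (energy_residual_le se oe us).
have [|||||_ H] := @Rintegral_dominated_cvg _ _ R leb
   (fun N tau => damped n a tau * ip leb (c tau) (g N)) (fun=> 0)
   (fun tau => (Num.sqrt (energyH (gauss pi)) * Num.sqrt (energyH h)) *
      (a * gauss (damping n) tau)).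
- move=> N; under eq_fun do rewrite IE.
  exact: measurable_partial_integral2 (rintegrable_measurable (fi N)).
- exact: measurable_cst.
- apply: aeW => tau; rewrite -(mulr0 (damped n a tau)); apply: cvgMl_tmp.
  apply/norm_cvg0P.
  apply: (@squeeze_cvgr _ _ _ _ (fun=> 0)
    (fun N => Num.sqrt (energyH (residualH N (c tau))) * Num.sqrt (energyH h))).
  + by apply: nearW => N; rewrite normr_ge0 ipE.
  + exact: cvg_cst.
  + rewrite -(mul0r (Num.sqrt (energyH h))); apply: cvgMr_tmp.
    rewrite -[X in _ --> X](sqrtr0 R); apply: continuous_cvg; first exact: sqrt_continuous.
    exact: (expands_wave tau m).2.
- exact: rintegrableZl.
- move=> N tau; rewrite normrM mulrC; apply: ler_pM => //.
    apply: le_trans (ipE N tau) _; rewrite ler_wpM2r ?sqrtr_ge0// ler_wsqrtr//.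
    exact: le_trans (energy_residual_le se oe us N (sc tau)) (cE tau).
  by apply: damped_le; exact: ltW.
rewrite [X in _ --> X]/Rintegral integral0 in H.
by under eq_fun do rewrite EN.
Qed.

Lemma expands_itv (c d : R) : c < d ->
  expandsH (fun x => gauss pi x * \1_(`]c, d]%classic) x).
Proof.
move=> cd; pose m := (c + d) / 2; pose a := (d - c) / 2.
have a0 : 0 < a by rewrite divr_gt0// subr_gt0.
apply: (@expands_dominated _ _ _ leb _ _ _ se oe us
  (fun n x => gauss pi x * mollified n a (x - m)) _ (gauss pi)).
- by move=> n; exact: expands_mollified.
- by apply: measurable_funM; [exact: measurable_gauss|exact: measurable_indic].
- exists ([set c] `|` [set d]); split.
  + exact: measurableU.
  + rewrite measureU0//; exact: lebesgue_measure_set1.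
  + move=> x /= nx; apply: contrapT => /not_orP[xc xd]; apply: nx.
    apply: cvgMl_tmp.
    have xm : `|x - m| != a.
      apply/eqP => E; have := eqr_norml (x - m) a; rewrite E eqxx (ltW a0) andbT.
      rewrite /m /a => /esym/orP[] /eqP h; [apply: xd|apply: xc]; lra.
    have := mollified_cvg xm; rewrite windowE indicE mem_setE/= in_itv/=.
    suff -> : (`|x - m| <= a) = (c < x <= d) by [].
    rewrite ler_norml /m /a; apply/andP/andP => -[h1 h2]; split; try lra.
- exact: gauss_pi.
- by move=> n x; exact: gauss_mollified_le.
- move=> x; rewrite normrM !ger0_norm ?gauss_ge0 ?indicE//.
  by rewrite ler_piMr ?gauss_ge0//; case: (_ \in _).
Qed.

Lemma hermite_complete (f : R -> R) : sqintegrable leb f -> expandsH f.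
Proof.
apply: (@expands_all _ _ _ leb _ _ _ se oe us (gauss pi) (@ocitv R)).
- exact: gauss_pi.
- by move=> x; exact: gauss_gt0.
- rewrite (_ : (fun x => _) = gauss (- pi)); first exact: measurable_gauss.
  by apply/funext => x; rewrite /gauss -expRN mulNr.
- by [].
- exact: ocitvI.
- have [ec _] := expands_wavec 0.
  by move: ec; congr expandsH; apply/funext => x; rewrite /wavec mul0r cos0 mulr1.
- move=> A /ocitvP[->|[[c d]/= cd ->]]; last exact: expands_itv.
  under eq_fun do rewrite indic0 mulr0.
  exact: expands0.
Qed.

End hermite_parseval.

(** * Hermite functions of several variables *)

Section hermite_row.
Context {R : realType}.
Variable n : nat.
Local Notation lam := (@lebesgue_row R n).
Local Notation En := 'rV[R]_n.
Local Notation mindex := {ffun 'I_n -> nat}.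
Implicit Types (alpha beta : mindex).

Definition hermite_row alpha (x : En) : R := \prod_j hermite (alpha j) (x ord0 j).

Lemma measurable_row_prod (f : 'I_n -> R -> R) :
  (forall j, measurable_fun [set: R] (f j)) ->
  measurable_fun [set: En] (fun x => \prod_j f j (x ord0 j)).
Proof.
move=> mf; apply: measurable_prod => j _.
exact: (measurableT_comp (mf j) (measurable_coord j)).
Qed.

Lemma sqintegrable_row_prod (f : 'I_n -> R -> R) :
  (forall j, sqintegrable leb (f j)) ->
  sqintegrable lam (fun x => \prod_j f j (x ord0 j)).
Proof.
move=> sf; split; first by apply: measurable_row_prod => j; exact: (sf j).1.
under eq_fun do rewrite -prodrXl.
by have [] := @Rintegral_row_prod R n (fun j t => f j t ^+ 2) (fun j => (sf j).2).
Qed.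

Lemma ip_row_prod (f g : 'I_n -> R -> R) :
  (forall j, sqintegrable leb (f j)) -> (forall j, sqintegrable leb (g j)) ->
  ip lam (fun x => \prod_j f j (x ord0 j)) (fun x => \prod_j g j (x ord0 j)) =
  \prod_j ip leb (f j) (g j).
Proof.
move=> sf sg; rewrite /ip; under eq_Rintegral do rewrite -big_split/=.
by have [_] := @Rintegral_row_prod R n (fun j t => f j t * g j t)
  (fun j => rintegrableM (sf j) (sg j)).
Qed.

Lemma sqintegrable_hermite_row alpha : sqintegrable lam (hermite_row alpha).
Proof.
apply: (@sqintegrable_row_prod (fun j => @hermite R (alpha j))) => j.
exact: sqintegrable_hermite.
Qed.

Lemma hermite_row_orthonormal alpha beta :
  ip lam (hermite_row alpha) (hermite_row beta) = (alpha == beta)%:R.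
Proof.
rewrite (@ip_row_prod (fun j => @hermite R (alpha j)) (fun j => @hermite R (beta j)));
  [|by move=> j; exact: sqintegrable_hermite..].
under eq_bigr do rewrite hermite_orthonormal.
have [->|ab] := eqVneq alpha beta; first by rewrite big1// => j _; rewrite eqxx.
have [j abj] : exists j, alpha j != beta j.
  apply/existsP; rewrite -negb_forall; apply: contra ab => /forallP h.
  by apply/eqP/ffunP => j; exact/eqP.
by rewrite (bigD1 j)//= (negbTE abj) mul0r.
Qed.

Definition mindex_of N (b : {ffun 'I_n -> 'I_N}) : mindex := [ffun j => val (b j)].

Lemma mindex_of_inj N : injective (@mindex_of N).
Proof.
move=> b c /ffunP h; apply/ffunP => j.
by have := h j; rewrite !ffunE; exact: val_inj.
Qed.

(** Entries of a multi-index of order less than [N] are less than [N], so these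
    multi-indices are found among finitely many. *)
Definition mindices N : seq mindex :=
  [seq mindex_of b | b : {ffun 'I_n -> 'I_N} <- enum {: {ffun 'I_n -> 'I_N}}
     & (\sum_j b j < N)%N].

Lemma mem_mindices N alpha : (alpha \in mindices N) = (\sum_j alpha j < N)%N.
Proof.
apply/idP/idP => [/mapP[b]|H].
  rewrite mem_filter => /andP[h _] ->.
  by under eq_bigr do rewrite ffunE.
have aN j : (alpha j < N)%N.
  by rewrite (leq_ltn_trans _ H)// (bigD1 j)//= leq_addr.
apply/mapP; exists [ffun j => Ordinal (aN j)].
  by rewrite mem_filter mem_enum andbT; under eq_bigr do rewrite ffunE.
by apply/ffunP => j; rewrite !ffunE.
Qed.

Lemma uniq_mindices N : uniq (mindices N).
Proof.
rewrite map_inj_uniq; last exact: mindex_of_inj.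
by rewrite filter_uniq ?enum_uniq.
Qed.

Local Notation expandsH := (expands lam hermite_row mindices).
Local Notation residualH := (residual lam hermite_row mindices).
Local Notation energyH := (energy lam).

Let se := sqintegrable_hermite_row.
Let oe := hermite_row_orthonormal.
Let us := uniq_mindices.

Lemma ler_sum_subset (I : eqType) (r s : seq I) (G : I -> R) :
  uniq r -> uniq s -> {subset r <= s} -> (forall i, 0 <= G i) ->
  \sum_(i <- r) G i <= \sum_(i <- s) G i.
Proof.
move=> ur us' rs G0; rewrite [leRHS](bigID (mem r))/= -[X in _ <= X + _]big_filter.
have P : perm_eq [seq i <- s | i \in r] r.
  apply: uniq_perm; rewrite ?filter_uniq// => i; rewrite mem_filter.
  by case: (boolP (i \in r)) => // /rs.
by rewrite (perm_big _ P)/= lerDl sumr_ge0.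
Qed.

(** Completeness passes to tensor products: the boxes of multi-indices, over
    which the sum of squared coefficients factorises, are cofinal. *)
Lemma expands_row_prod (f : 'I_n -> R -> R) :
  (forall j, sqintegrable leb (f j)) ->
  expandsH (fun x => \prod_j f j (x ord0 j)).
Proof.
move=> sf; have sF := sqintegrable_row_prod sf.
set F := fun x => _ in sF *; split; first exact: sF.
pose T j M := \sum_(k < M) ip leb (f j) (@hermite R k) ^+ 2.
have cT j : T j M @[M --> \oo] --> ip leb (f j) (f j).
  have [_ H] := hermite_complete (sf j).
  have E M : T j M = ip leb (f j) (f j) -
      energy leb (residual leb (@hermite R) (iota 0) M (f j)).
    rewrite energy_residual//; first by rewrite subKr /T -(big_mkord xpredT (fun k =>
      ip leb (f j) (@hermite R k) ^+ 2)) /index_iota subn0.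
    - exact: sqintegrable_hermite.
    - exact: hermite_orthonormal.
    - by move=> N; exact: iota_uniq.
  under eq_fun do rewrite E.
  have := cvgB (cvg_cst (ip leb (f j) (f j))) H; rewrite subr0; exact.
have cP : \prod_j T j M @[M --> \oo] --> \prod_j ip leb (f j) (f j).
  elim: (index_enum _) => [|j r IH].
    by rewrite big_nil; under eq_fun do rewrite big_nil; exact: cvg_cst.
  rewrite big_cons; under eq_fun do rewrite big_cons.
  by apply: cvgM; [exact: cT|exact: IH].
apply/cvgr0Pnorm_le => eps e0.
have [M HM] : exists M, \prod_j ip leb (f j) (f j) - \prod_j T j M <= eps.
  have /cvgrPdist_le/(_ _ e0)[M _ HM] := cP.
  by exists M; apply: le_trans (ler_norm _) _; exact: (HM M (leqnn M)).
exists (n * M).+1 => // N /= MN; rewrite ger0_norm ?ip_ge0//.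
rewrite energy_residual//; apply: le_trans HM.
rewrite /energy ip_row_prod// lerD2l lerN2.
rewrite /T bigA_distr_bigA/=.
have ipF alpha : ip lam F (hermite_row alpha) =
    \prod_j ip leb (f j) (@hermite R (alpha j)).
  by apply: ip_row_prod => // j; exact: sqintegrable_hermite.
pose r := [seq mindex_of c | c <- enum {: {ffun 'I_n -> 'I_M}}].
have -> : \sum_(c : {ffun 'I_n -> 'I_M}) \prod_j ip leb (f j) (@hermite R (c j)) ^+ 2 =
    \sum_(alpha <- r) ip lam F (hermite_row alpha) ^+ 2.
  rewrite /r big_map -big_enum/=; apply: eq_bigr => c _.
  by rewrite ipF prodrXl; congr (_ ^+ 2); apply: eq_bigr => j _; rewrite ffunE.
apply: ler_sum_subset.
- rewrite map_inj_uniq ?enum_uniq//.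
  exact: mindex_of_inj.
- exact: us.
- move=> _ /mapP[c _ ->]; rewrite mem_mindices.
  under eq_bigr do rewrite ffunE.
  rewrite (leq_trans _ MN)// ltnS.
  apply: (@leq_trans (\sum_(j < n) M)%N); last by rewrite sum_nat_const card_ord.
  by apply: leq_sum => j _; exact: ltnW (ltn_ord (c j)).
- by move=> alpha; exact: sqr_ge0.
Qed.

Lemma measurable_row_rect (B : 'I_n -> set R) : (forall j, measurable (B j)) ->
  measurable [set x : En | forall j, B j (x ord0 j)].
Proof.
move=> mB; rewrite (_ : [set _ | _] = \bigcap_(i in [set: 'I_n])
  ((fun x : 'rV[R]_n => x ord0 i) @^-1` B i)).
  apply: fin_bigcap_measurable => // i _.
  by rewrite -[X in measurable X]setTI; apply: measurable_row_coord.
by apply/seteqP; split => x xk i => [_|]; exact: xk.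
Qed.

Definition row_rects : set (set En) :=
  [set [set x : En | forall j, B j (x ord0 j)] |
    B in [set B : 'I_n -> set R | forall j, measurable (B j)]].

(** The coordinate preimages generating the sigma-algebra are rectangles;
    rectangles have the advantage of being stable under intersection. *)
Lemma row_rectsE : @measurable _ En = <<s row_rects >>.
Proof.
apply/seteqP; split.
- apply: smallest_sub; first exact: smallest_sigma_algebra.
  have H (i : 'I_n) : preimage_set_system setT (fun x : En => x ord0 i) measurable
      `<=` <<s row_rects >>.
    move=> _ [B mB <-]; rewrite setTI; apply: sub_sigma_algebra.
    exists (fun j => if j == i then B else setT).
      by move=> j /=; case: ifP => // _; exact: measurableT.
    apply/seteqP; split=> x /= h; first by have := h i; rewrite eqxx.
    by move=> j; case: eqP => [->|].
  elim/big_ind : _ => [//|A B hA hB|i _]; last exact: H.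
  by move=> X [/hA|/hB].
- apply: smallest_sub; first exact: sigma_algebra_measurable.
  by move=> _ [B mB <-]; exact: measurable_row_rect.
Qed.

(** Weighted by a Gaussian, the indicator of a rectangle is a product of
    functions of one variable. *)
Lemma hermite_row_complete (f : En -> R) : sqintegrable lam f -> expandsH f.
Proof.
apply: (@expands_all _ _ _ lam _ _ _ se oe us (fun x => \prod_j gauss pi (x ord0 j)) row_rects).
- apply: (sqintegrable_row_prod (f := fun _ => gauss pi)) => j.
  by apply: sqintegrable_gauss; exact: pi_gt0.
- by move=> x; apply: prodr_gt0 => j _; exact: gauss_gt0.
- rewrite (_ : (fun x => _) = fun x : En => \prod_j gauss (- pi) (x ord0 j)).
    by apply: (measurable_row_prod (f := fun _ => gauss (- pi))) => j; exact: measurable_gauss.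
  apply/funext => x; rewrite -prodfV; apply: eq_bigr => j _.
  by rewrite /gauss -expRN mulNr.
- exact: row_rectsE.
- move=> _ _ [A mA <-] [B mB <-]; exists (fun j => A j `&` B j).
    by move=> j; exact: measurableI.
  by apply/seteqP; split=> x /=; [move=> h; split=> j; have [] := h j|case=> h1 h2 j; split].
- apply: (expands_row_prod (f := fun _ => gauss pi)) => j.
  by apply: sqintegrable_gauss; exact: pi_gt0.
- move=> _ [B mB <-].
  rewrite (_ : (fun x => _) = fun x : En => \prod_j (gauss pi (x ord0 j) * \1_(B j) (x ord0 j))).
    apply: (expands_row_prod (f := fun j t => gauss pi t * \1_(B j) t)) => j.
    have sg : sqintegrable leb (gauss (pi : R)) by apply: sqintegrable_gauss; exact: pi_gt0.
    apply: (@sqintegrable_dominated _ _ R leb _ (gauss pi) _ sg).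
      apply: measurable_funM; first exact: measurable_gauss.
      by apply: measurable_indic; exact: mB.
    by move=> t; rewrite normrM ler_piMr// indicE; case: (_ \in _); rewrite ?normr1 ?normr0.
  apply/funext => x; rewrite big_split/=; congr (_ * _).
  rewrite indicE; case: (boolP (x \in _)) => [|] /=.
    by rewrite inE/= => h; rewrite big1// => j _; rewrite indicE mem_set.
  rewrite notin_setE/= => /existsNP[j nB].
  by rewrite (bigD1 j)//= indicE memNset// mul0r.
Qed.

End hermite_row.

(** * Hermite functions are Schwartz functions *)

Section schwartz_hermite.
Context {R : realType}.
Variable n : nat.
Local Notation En := 'rV[R]_n.
Implicit Types (p : 'I_n -> {poly R}).

Lemma coord_le_norm (x : En) j : `|x ord0 j| <= `|x|.
Proof.
rewrite [leRHS]/Num.Def.normr/= mx_normrE.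
exact: (le_bigmax _ (fun i : 'I_1 * 'I_n => `|x i.1 i.2|) (ord0, j)).
Qed.

Lemma norm_row_le (x : En) (B : R) : 0 <= B -> (forall j, `|x ord0 j| <= B) -> `|x| <= B.
Proof.
move=> B0 H; rewrite [leLHS]/Num.Def.normr/= mx_normrE.
by apply: bigmax_le => // -[i j] _ /=; rewrite ord1.
Qed.

(** A class of functions closed under partial derivatives that contains the
    Hermite functions. *)
Definition pgauss p (x : En) : R := \prod_j ((p j).[x ord0 j] * gauss pi (x ord0 j)).

Let is_derive_pgauss1 (q : {poly R}) (t : R) :
  is_derive t (1 : R) (fun t => q.[t] * gauss pi t)
    ((q^`() - (2 * pi)%:P * 'X * q).[t] * gauss pi t).
Proof.
apply: is_derive_eq (is_derive_mul (is_derive_horner q t) (is_derive_gauss pi t)) _.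
rewrite !(hornerD, hornerN, hornerM, hornerC, hornerX).
move: (gauss _ t) (q^`().[t]) (q.[t]) => g a b; move: (pi : R) => v; ring.
Qed.

Lemma differentiable_pgauss p x : differentiable (pgauss p) x.
Proof.
rewrite /pgauss; elim: (index_enum _) => [|j r IH].
  by under eq_fun do rewrite big_nil; exact: differentiable_cst.
under eq_fun do rewrite big_cons.
apply: differentiableM; last exact: IH.
apply: (differentiable_comp (f := fun x : En => x ord0 j : R)
  (g := fun t : R => (p j).[t] * gauss pi t)); first exact: differentiable_coord.
by apply/derivable1_diffP; have [] := is_derive_pgauss1 (p j) (x ord0 j).
Qed.

Definition pgauss_deriv i p : 'I_n -> {poly R} := fun j =>
  if j == i then (p j)^`() - (2 * pi)%:P * 'X * p j else p j.

Lemma derive_pgauss p i :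
  'D_(delta_mx ord0 i) (pgauss p) = pgauss (pgauss_deriv i p).
Proof.
apply/funext => x; pose g t := (p i).[t] * gauss pi t.
pose c := \prod_(j | j != i) ((p j).[x ord0 j] * gauss pi (x ord0 j)).
have [dg gE] := is_derive_pgauss1 (p i) (x ord0 i).
rewrite /derive (_ : (fun h => _) = fun h : R =>
    c * (h^-1 *: ((g \o shift (x ord0 i)) (h *: 1) - g (x ord0 i)))); last first.
  apply/funext => h /=; rewrite /pgauss (bigD1 i)//= [X in _ - X](bigD1 i)//=.
  rewrite !mxE !eqxx/= -/c.
  rewrite (_ : \prod_(_ < n | _) _ = c); last first.
    by apply: eq_bigr => j ji; rewrite !mxE/= (negbTE ji) ?andbF mulr0 add0r.
  by rewrite /g /GRing.scale/= !mulr1; move: (_.[_]) (_.[_]) => *; ring.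
transitivity (c * 'D_1 g (x ord0 i)).
  by apply/cvg_lim => //; apply: cvgMl_tmp; exact: dg.
rewrite gE /c /pgauss [RHS](bigD1 i)//= /pgauss_deriv eqxx mulrC; congr (_ * _).
by apply: eq_bigr => j /negbTE ->.
Qed.

Lemma partials_pgauss s p : exists q, partials s (pgauss p) = pgauss q.
Proof.
elim: s => [|i s [q IH]]; first by exists p.
by exists (pgauss_deriv i q); rewrite /= IH derive_pgauss.
Qed.

Lemma partials_cst0 (s : seq 'I_n) : partials s (fun=> 0 : R) = fun=> 0.
Proof.
by elim: s => [|i s IH] //=; rewrite IH; apply/funext => x; exact: derive_cst.
Qed.

(** The norm is at most the product of the [2 + x_j^2], each factor of which is
    absorbed by the Gaussian in its own variable. *)
Lemma pgauss_bounded p k : exists M : R, forall x : En, `|x| ^+ k * `|pgauss p x| <= M.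
Proof.
have H j : exists M : R, 0 <= M /\ forall t : R,
    (2 + t ^+ 2) ^+ k * `|(p j).[t] * gauss pi t| <= M.
  have [M [M0 HM]] := horner_gauss_le (map_poly (real_complex R)
    ((2%:P + 'X ^+ 2) ^+ k * p j)) (@pi_gt0 R).
  have E (q : {poly R}) t : (map_poly (real_complex R) q).[t%:C] = (q.[t])%:C.
    by rewrite horner_map.
  exists M; split => // t; have := HM t; rewrite E normc_realE => h.
  apply: le_trans (_ : M * gauss (pi / 2) t <= _); last first.
    by rewrite ler_piMr// gauss_le1// divr_ge0// pi_ge0.
  apply: le_trans h; rewrite hornerM horner_exp !hornerE !normrM mulrA.
  rewrite (ger0_norm (gauss_ge0 _ _)) ler_wpM2r ?gauss_ge0// ler_wpM2r//.
  by rewrite ger0_norm// exprn_ge0// addr_ge0// sqr_ge0.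
have /choice[M HM] := H.
have b1 (t : R) : 1 <= 2 + t ^+ 2 by have := sqr_ge0 t; lra.
exists (\prod_j M j) => x.
apply: le_trans (_ : \prod_j (2 + x ord0 j ^+ 2) ^+ k * `|pgauss p x| <= _).
  rewrite ler_wpM2r// prodrXl lerXn2r ?nnegrE ?prodr_ge0//.
    by move=> j _; apply: le_trans (b1 _).
  apply: norm_row_le; first by apply: prodr_ge0 => j _; apply: le_trans (b1 _).
  move=> j; rewrite (bigD1 j)//= -[leLHS]mulr1; apply: ler_pM => //.
    by rewrite -[x ord0 j ^+ 2]real_normK ?num_real//; have := sqr_ge0 (`|x ord0 j| - 1); nra.
  elim/big_ind : _ => // u v u1 v1.
  by rewrite -[leLHS]mulr1 ler_pM.
rewrite /pgauss normr_prod -big_split/=.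
apply: ler_prod => j _; rewrite (HM j).2 andbT mulr_ge0// exprn_ge0//.
by rewrite addr_ge0// sqr_ge0.
Qed.

Lemma schwartz_Hermite (alpha : {ffun 'I_n -> nat}) : schwartz (@Hermite R n alpha).
Proof.
pose p j := (hermite_norm (alpha j))%:P * hermite_poly (pi : R) (alpha j).
have RE : @complex.Re R \o Hermite alpha = pgauss p.
  apply/funext => x; rewrite /= /pgauss; apply: eq_bigr => j _.
  by rewrite hermiteE /p hornerM hornerC mulrA.
have IE : @complex.Im R \o @Hermite R n alpha = fun=> 0 by [].
split.
- by move=> s x; rewrite RE; have [q ->] := partials_pgauss s p; exact: differentiable_pgauss.
- by move=> s x; rewrite IE partials_cst0; exact: differentiable_cst.
- move=> s k; rewrite /Cpartials RE IE partials_cst0.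
  have [q ->] := partials_pgauss s p; have [M HM] := pgauss_bounded q k.
  by exists M => x; rewrite -[X in normc X]/((pgauss q x)%:C) normc_realE.
Qed.

End schwartz_hermite.

(** * The phase-space integral over the ball *)

Section complex_limits.
Context d (T : measurableType d) {R : realType}.
Variable mu : {measure set T -> \bar R}.

Lemma Cintegral_mul_cvg (b : T -> R[i]) (r_ : nat -> T -> R) (r : T -> R) :
  Cintegrable mu b -> (forall m, measurable_fun [set: T] (r_ m)) ->
  measurable_fun [set: T] r -> {ae mu, forall x, r_ m x @[m --> \oo] --> r x} ->
  (forall m x, `|r_ m x| <= 1) ->
  complex.Re (Cintegral mu (fun x => b x * (r_ m x)%:C)) @[m --> \oo] -->
    complex.Re (Cintegral mu (fun x => b x * (r x)%:C)) /\
  complex.Im (Cintegral mu (fun x => b x * (r_ m x)%:C)) @[m --> \oo] -->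
    complex.Im (Cintegral mu (fun x => b x * (r x)%:C)).
Proof.
move=> [b1 b2] mr_ mr cr r1; rewrite /Cintegral /=.
have R_ (h : T -> R) : (fun x => complex.Re (b x * (h x)%:C)) = fun x => complex.Re (b x) * h x.
  by apply/funext => x; rewrite ReCM /= mulr0 subr0.
have I_ (h : T -> R) : (fun x => complex.Im (b x * (h x)%:C)) = fun x => complex.Im (b x) * h x.
  by apply/funext => x; rewrite ImCM /= mulr0 add0r.
have key (h : T -> R) : rintegrable mu h ->
    \int[mu]_x (h x * r_ m x) @[m --> \oo] --> \int[mu]_x (h x * r x).
  move=> hi; have mh := rintegrable_measurable hi.
  have [|||||_ L] := @Rintegral_dominated_cvg _ _ R mu (fun m x => h x * r_ m x)
    (fun x => h x * r x) (fun x => `|h x|).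
  - by move=> m; exact: measurable_funM.
  - exact: measurable_funM.
  - by apply: filterS cr => x cx; exact: cvgMl_tmp.
  - exact: rintegrable_norm.
  - by move=> m x; rewrite normrM ler_piMr.
  exact: L.
split.
- by under eq_fun do rewrite R_; rewrite R_; exact: key.
- by under eq_fun do rewrite I_; rewrite I_; exact: key.
Qed.

End complex_limits.

Section phase_space_integral.
Context {R : realType}.
Local Notation C := R[i].
Local Notation lam n := (@lebesgue_row R n).

Lemma rintegrable_oneDsqr : rintegrable leb (fun t : R => (1 + t ^+ 2)^-1).
Proof.
have d0 (t : R) : 0 < 1 + t ^+ 2 by rewrite ltr_pwDl// sqr_ge0.
apply: rintegrable_ge0.
- exact: (continuous_measurable_fun (@continuous_oneDsqrV R)).
- by move=> t; rewrite invr_ge0 ltW.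
- rewrite ge0_symfun_integralT//.
  + by rewrite -set_itvcy (integral0y_oneDsqr R) -EFinM ltry.
  + by move=> t; rewrite invr_ge0 ltW.
  + exact: continuous_oneDsqrV.
  + by move=> t /=; rewrite sqrrN.
Qed.

(** The factor with index [j] gives the decay in [z]; the other one is bounded. *)
Lemma wigner1_integrable j k (x y : R) : Cintegrable leb (fun z : R =>
  cis (- (2 * pi * (z * y))) * (hermite j (x + 2^-1 * z))%:C * (hermite k (x - 2^-1 * z))%:C).
Proof.
have [M [M0 HM]] := hermite_le (R := R) j; have [N [N0 HN]] := hermite_le (R := R) k.
have p2 : 0 < pi / 2 :> R by rewrite divr_gt0// pi_gt0.
have mg : measurable_fun [set: R] (fun z : R => gauss (pi / 2) (x + 2^-1 * z)).
  apply: (measurableT_comp (measurable_gauss _)).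
  by apply: measurable_funD => //; exact: measurable_funM.
have ig : rintegrable leb (fun z => gauss (pi / 2) (x + 2^-1 * z)).
  apply: rintegrable_ge0 => //; first by move=> z; exact: gauss_ge0.
  rewrite (ge0_integral_affine x _ (f := fun t => (gauss (pi / 2) t)%:E))//.
  - apply: lte_mul_pinfty; [by rewrite lee_fin|by []|].
    exact: rintegrable_lty (rintegrable_gauss p2).
  - by apply/measurable_EFinP; exact: measurable_gauss.
  - by move=> t; rewrite lee_fin gauss_ge0.
apply: (Cintegrable_dominated _ (rintegrableZl (M * N) ig)).
- apply: CmeasurableM; first apply: CmeasurableM.
  + apply: Cmeasurable_cis; apply: measurableT_comp => //.
    by apply: measurable_funM => //; exact: measurable_funM.
  + apply: Cmeasurable_real; apply: (measurableT_comp (measurable_hermite j)).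
    by apply: measurable_funD => //; exact: measurable_funM.
  + apply: Cmeasurable_real; apply: (measurableT_comp (measurable_hermite k)).
    by apply: measurable_funB => //; exact: measurable_funM.
- move=> z; rewrite !normcM normc_cis mul1r !normc_realE [leRHS]mulrAC.
  apply: ler_pM; [exact: normr_ge0..|exact: HM|].
  by apply: le_trans (HN _) _; rewrite ler_piMr// gauss_le1// ltW.
Qed.

Variable n : nat.
Local Notation En := 'rV[R]_n.
Local Notation E2n := 'rV[R]_(n + n).
Local Notation mindex := {ffun 'I_n -> nat}.
Implicit Types (alpha beta : mindex).

Definition energy_form (X : E2n) : R :=
  2 * pi * (dotr (lsubmx X) (lsubmx X) + dotr (rsubmx X) (rsubmx X)).

Lemma wigner_Hermite alpha beta (X : E2n) :
  wigner (@Hermite R n alpha) (@Hermite R n beta) X =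
  \prod_j wigner1 (alpha j) (beta j) (lsubmx X ord0 j) (rsubmx X ord0 j).
Proof.
have [_ <-] := Cintegral_row_prod (fun j => wigner1_integrable (alpha j) (beta j)
  (lsubmx X ord0 j) (rsubmx X ord0 j)).
apply: eq_Cintegral => z; rewrite [RHS](_ : _ = \prod_j cis (- (2 * pi * (z ord0 j * rsubmx X ord0 j))) *
    (\prod_j (hermite (alpha j) (lsubmx X ord0 j + 2^-1 * z ord0 j))%:C) *
    (\prod_j (hermite (beta j) (lsubmx X ord0 j - 2^-1 * z ord0 j))%:C)); last first.
  by rewrite -!big_split.
rewrite /Hermite.
congr (_ * _ * _).
- rewrite -cis_sum /dotr; congr cis; rewrite mulr_sumr -sumrN.
  by apply: eq_bigr => j _.
- by rewrite (rmorph_prod (real_complex R)); apply: eq_bigr => j _; rewrite !mxE.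
- rewrite -(rmorph_prod (real_complex R)); apply: complex_ext; rewrite /= ?oppr0//.
  by apply: eq_bigr => j _; rewrite !mxE.
Qed.

Let WH alpha beta (X : E2n) : C :=
  \prod_j wigner1 (alpha j) (beta j) (lsubmx X ord0 j) (rsubmx X ord0 j).

Lemma Cmeasurable_wigner_Hermite alpha beta :
  Cmeasurable (wigner (@Hermite R n alpha) (@Hermite R n beta)).
Proof.
rewrite (_ : wigner _ _ = WH alpha beta); last by apply/funext => X; exact: wigner_Hermite.
apply: (Cmeasurable_prod _ (F := fun j (X : E2n) =>
  wigner1 (alpha j) (beta j) (lsubmx X ord0 j) (rsubmx X ord0 j))) => j.
apply: (Cmeasurable_comp (phi := fun X : E2n => (lsubmx X ord0 j, rsubmx X ord0 j))
  _ (Cmeasurable_wigner1 (alpha j) (beta j))).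
apply: measurable_fun_pair.
- by under eq_fun do rewrite mxE; exact: measurable_coord.
- by under eq_fun do rewrite mxE; exact: measurable_coord.
Qed.

Lemma wigner_Hermite_le alpha beta : exists M : R, 0 <= M /\ forall X,
  normc (wigner (@Hermite R n alpha) (@Hermite R n beta) X) <=
  M * \prod_i gauss pi (X ord0 i).
Proof.
have /choice[M HM] j := wigner1_le (R := R) (alpha j) (beta j).
exists (\prod_j M j); split=> [|X]; first by apply: prodr_ge0 => j _; exact: (HM j).1.
rewrite wigner_Hermite normc_prod.
rewrite [leRHS](_ : _ = \prod_j (M j *
    (gauss pi (lsubmx X ord0 j) * gauss pi (rsubmx X ord0 j)))); last first.
  rewrite big_split_ord/= -!big_split/=.
  by apply: eq_bigr => j _; rewrite !mxE.
apply: ler_prod => j _; apply/andP; split; first exact: normc_ge0.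
exact: (HM j).2.
Qed.

Lemma rintegrable_gauss_row m : rintegrable (lam m) (fun X => \prod_i gauss pi (X ord0 i)).
Proof.
by have [] := @Rintegral_row_prod R m (fun _ => gauss pi)
  (fun _ => rintegrable_gauss (@pi_gt0 R)).
Qed.

Lemma Cintegrable_wigner_Hermite alpha beta :
  Cintegrable (lam (n + n)) (wigner (@Hermite R n alpha) (@Hermite R n beta)).
Proof.
have [M [M0 HM]] := wigner_Hermite_le alpha beta.
apply: (Cintegrable_dominated _ (rintegrableZl M (rintegrable_gauss_row (n + n))) HM).
exact: Cmeasurable_wigner_Hermite.
Qed.

Lemma measurable_energy_form : measurable_fun [set: E2n] energy_form.
Proof.
apply: measurable_funM => //; apply: measurable_funD.
- apply: measurable_sum => j; under eq_fun do rewrite !mxE.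
  by apply: measurable_funM; exact: measurable_coord.
- apply: measurable_sum => j; under eq_fun do rewrite !mxE.
  by apply: measurable_funM; exact: measurable_coord.
Qed.

Lemma energy_formE (X : E2n) : energy_form X = 2 * pi * \sum_i X ord0 i ^+ 2.
Proof.
rewrite /energy_form big_split_ord/= /dotr.
by congr (_ * (_ + _)); apply: eq_bigr => j _; rewrite !mxE expr2.
Qed.

Lemma energy_form_ge0 X : 0 <= energy_form X.
Proof.
by rewrite energy_formE !mulr_ge0 ?pi_ge0// sumr_ge0// => i _; exact: sqr_ge0.
Qed.

Let chirp1 j k (tau : R) (z : R * R) : C :=
  wigner1 j k z.1 z.2 * cis (tau * (2 * pi * (z.1 ^+ 2 + z.2 ^+ 2))).

Let Cmeasurable_chirp1 j k tau : Cmeasurable (chirp1 j k tau).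
Proof.
apply: CmeasurableM; first exact: Cmeasurable_wigner1.
apply: Cmeasurable_cis; apply: measurable_funM => //; apply: measurable_funM => //.
by apply: measurable_funD; apply: measurable_funX; [exact: measurable_fst|exact: measurable_snd].
Qed.

Let Cintegrable_chirp1 j k tau : Cintegrable (leb \x leb)%E (chirp1 j k tau).
Proof.
have [M [M0 HM]] := wigner1_le (R := R) j k; have pi0 := @pi_gt0 R.
apply: (Cintegrable_dominated _ (rintegrableZl M
  (rintegrable_prod (rintegrable_gauss pi0) (rintegrable_gauss pi0)))).
- exact: Cmeasurable_chirp1.
- by move=> z; rewrite normcM normc_cis mulr1; exact: HM.
Qed.

Let Cintegrable_chirp1_slice j k tau x : Cintegrable leb (fun y => chirp1 j k tau (x, y)).
Proof.
have [M [M0 HM]] := wigner1_le (R := R) j k.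
apply: (Cintegrable_dominated _ (rintegrableZl (M * gauss pi x) (rintegrable_gauss (@pi_gt0 R)))).
- have mx : measurable_fun [set: R] (fun y : R => (x, y)) by exact: measurable_fun_pair.
  exact: (Cmeasurable_comp mx (Cmeasurable_chirp1 j k tau)).
- by move=> y; rewrite normcM normc_cis mulr1 -mulrA; exact: HM.
Qed.

Lemma Cmeasurable_chirp alpha beta tau : Cmeasurable (fun X =>
  wigner (@Hermite R n alpha) (@Hermite R n beta) X * cis (tau * energy_form X)).
Proof.
apply: CmeasurableM; first exact: Cmeasurable_wigner_Hermite.
by apply: Cmeasurable_cis; apply: measurable_funM => //; exact: measurable_energy_form.
Qed.

Lemma Cintegrable_chirp alpha beta tau : Cintegrable (lam (n + n)) (fun X =>
  wigner (@Hermite R n alpha) (@Hermite R n beta) X * cis (tau * energy_form X)).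
Proof.
apply: (Cintegrable_dominated _ (Cintegrable_normc (Cintegrable_wigner_Hermite alpha beta))).
- exact: Cmeasurable_chirp.
- by move=> X; rewrite normcM normc_cis mulr1.
Qed.

Definition chirp_value k (tau : R) : C := (1 +i* tau) ^+ k / (1 -i* tau) ^+ (k + n).

(** Both the Wigner distribution and the chirp are products over the
    coordinates, so that [wigner1_chirp] applies to each factor. *)
Lemma wigner_Hermite_chirp alpha beta (tau : R) :
  Cintegral (lam (n + n)) (fun X =>
    wigner (@Hermite R n alpha) (@Hermite R n beta) X * cis (tau * energy_form X)) =
  (alpha == beta)%:R * chirp_value (\sum_j alpha j) tau.
Proof.
have mf := Cmeasurable_chirp alpha beta tau.
have fi := Cintegrable_chirp alpha beta tau.
rewrite (Cintegral_transport (@measurable_row_pair R n n) (@lebesgue_row_pairE R n n) mf).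
have {}fi := (Cintegrable_transport (@measurable_row_pair R n n)
  (@lebesgue_row_pairE R n n) mf).2 fi.
rewrite (Cintegral_prod fi).
have E (x y : En) : wigner (Hermite alpha) (Hermite beta) (row_pair (x, y)) *
    cis (tau * energy_form (row_pair (x, y))) =
    \prod_j chirp1 (alpha j) (beta j) tau (x ord0 j, y ord0 j).
  rewrite big_split wigner_Hermite -cis_sum; congr (_ * cis _).
    by apply: eq_bigr => j _; rewrite row_mxKl row_mxKr.
  rewrite /energy_form row_mxKl row_mxKr -!mulr_sumr /dotr -big_split/=.
  by congr (_ * (_ * _)); apply: eq_bigr => j _; rewrite !expr2.
under eq_Cintegral => x.
  under eq_Cintegral do rewrite E.
  have [_ ->] := Cintegral_row_prod (fun j =>
    Cintegrable_chirp1_slice (alpha j) (beta j) tau (x ord0 j)).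
  over.
have vi j : Cintegrable leb (fun s => Cintegral leb (fun t => chirp1 (alpha j) (beta j) tau (s, t))).
  have [h1 h2] := Cintegrable_chirp1 (alpha j) (beta j) tau.
  by split; [exact: rintegrable_partial_integral1 h1|exact: rintegrable_partial_integral1 h2].
have [_ ->] := Cintegral_row_prod vi.
under eq_bigr do rewrite wigner1_chirp.
have [->|ab] := eqVneq alpha beta; last first.
  have [j abj] : exists j, alpha j != beta j.
    apply/existsP; rewrite -negb_forall; apply: contra ab => /forallP h.
    by apply/eqP/ffunP => j; exact/eqP.
  by rewrite (bigD1 j)//= (negbTE abj) !mul0r.
under eq_bigr do rewrite eqxx mul1r.
rewrite mul1r /chirp_value big_split/= prodfV !prodrXr; congr (_ / _ ^+ _).
by under eq_bigr do rewrite -addn1; rewrite big_split/= sum_nat_const card_ord muln1.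
Qed.

Lemma ball_symbolE (a : R) (X : E2n) : ball_symbol a X = (window a (energy_form X))%:C.
Proof.
rewrite windowE ger0_norm ?energy_form_ge0// /ball_symbol indicE.
by congr (_%:C); congr (_%:R); congr nat_of_bool; apply/idP/idP; rewrite inE.
Qed.

(** The level set is a sphere. *)
Lemma ae_energy_form_neq (a : R) : (1 <= n)%N ->
  {ae lam (n + n), forall X, energy_form X != a}.
Proof.
move=> n1; have [m nm] : exists m, (n + n)%N = m.+1 by exists (n + n).-1; rewrite prednK// addn_gt0 n1.
exists [set X : E2n | \sum_i X ord0 i ^+ 2 = a / (2 * pi)]; split.
- rewrite -[X in measurable X]setTI.
  exact: (@measurable_sqnorm R (n + n) measurableT _ (measurable_set1 _)).
- have := lebesgue_row_sphere m (a / (2 * pi)); rewrite -nm; exact.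
- move=> X /= /negP; rewrite negbK energy_formE => /eqP <-.
  by rewrite /= mulrAC divff ?mul1r// mulf_neq0// gt_eqF// pi_gt0.
Qed.

Lemma normcXn (z : C) k : normc (z ^+ k) = normc z ^+ k.
Proof. by elim: k => [|k IH]; rewrite ?expr0 ?normc1// !exprS normcM IH. Qed.

(** The quotient [(1 + i tau) / (1 - i tau)] has modulus 1, and [n >= 1] leaves at
    least one factor of the denominator. *)
Lemma normc_chirp_value k (tau : R) : (1 <= n)%N ->
  normc (chirp_value k tau) <= (Num.sqrt (1 + tau ^+ 2))^-1.
Proof.
move=> n1; pose s := Num.sqrt (1 + tau ^+ 2).
have s1 : 1 <= s by rewrite -sqrtr1 ler_wsqrtr// lerDl sqr_ge0.
have s0 : 0 < s by exact: lt_le_trans s1.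
have z0 : (1 -i* tau : C) != 0 by rewrite eq_complex/= negb_and oner_eq0.
have : normc (chirp_value k tau * (1 -i* tau) ^+ (k + n)) = s ^+ k.
  by rewrite /chirp_value divfK ?expf_neq0// normcXn/= expr1n.
rewrite normcM normcXn/= expr1n sqrrN -/s exprD => h.
have sk : 0 < s ^+ k by rewrite exprn_gt0.
have {h} h : normc (chirp_value k tau) * s ^+ n = 1.
  by apply: (mulIf (lt0r_neq0 sk)); rewrite mul1r -[RHS]h -mulrA (mulrC (s ^+ n)).
rewrite -/s -[leRHS]mul1r ler_pdivlMr// -h ler_wpM2l ?normc_ge0//.
by rewrite -[leLHS]expr1 ler_weXn2l.
Qed.

(** Multiplying by conjugates leaves a polynomial over a power of [1 + tau^2]. *)
Lemma Cmeasurable_chirp_value k : Cmeasurable (chirp_value k).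
Proof.
have E : chirp_value k = fun tau : R =>
    (1 +i* tau) ^+ (k + (k + n)) * (((1 + tau ^+ 2)^-1) ^+ (k + n))%:C.
  apply/funext => tau; rewrite /chirp_value.
  have d0 : 1 + tau ^+ 2 != 0 by rewrite gt_eqF// ltr_pwDl// sqr_ge0.
  have z0 : (1 -i* tau : C) != 0 by rewrite eq_complex/= negb_and oner_eq0.
  have -> : (1 -i* tau : C) = (1 +i* tau)^-1 * (1 + tau ^+ 2)%:C.
    have w0 : (1 +i* tau : C) != 0 by rewrite eq_complex/= negb_and oner_eq0.
    apply: (mulfI w0); rewrite mulrA divff// mul1r.
    by apply: complex_ext => /=; ring.
  rewrite [(1 +i* tau) ^+ (k + _)]exprD exprMn invfM !exprVn invrK -mulrA; congr (_ * (_ * _)).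
  by rewrite fmorphV rmorphXn.
have mz : Cmeasurable (fun tau : R => (1 +i* tau : C)).
  by split; [exact: measurable_cst|exact: measurable_id].
have mzk l : Cmeasurable (fun tau : R => (1 +i* tau : C) ^+ l).
  elim: l => [|l IH]; first by under eq_fun do rewrite expr0; exact: Cmeasurable_cst.
  by under eq_fun do rewrite exprS; exact: CmeasurableM.
rewrite E; apply: CmeasurableM; first exact: mzk.
apply: Cmeasurable_real; apply: measurable_funX.
exact: (continuous_measurable_fun (@continuous_oneDsqrV R)).
Qed.

(** Both factors decay like [1 / |tau|] at infinity and are bounded near 0, so the
    product is dominated by [1 / (1 + tau^2)]. *)
Lemma dirichlet_chirp_integrable k (a : R) : (1 <= n)%N -> 0 <= a ->
  Cintegrable leb (fun tau => (dirichlet a tau)%:C * chirp_value k tau).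
Proof.
move=> n1 a0.
apply: (Cintegrable_dominated _ (rintegrableZl (Num.sqrt (a ^+ 2 + 1)) rintegrable_oneDsqr)).
  apply: CmeasurableM; last exact: Cmeasurable_chirp_value.
  by apply: Cmeasurable_real; exact: measurable_dirichlet.
move=> tau; rewrite normcM normc_realE.
have d0 : 0 < 1 + tau ^+ 2 by rewrite ltr_pwDl// sqr_ge0.
have s0 : 0 < Num.sqrt (1 + tau ^+ 2) by rewrite sqrtr_gt0.
apply: le_trans (ler_wpM2l (normr_ge0 _) (normc_chirp_value k tau n1)) _.
rewrite ler_pdivrMr// -mulrA -[X in X^-1](sqr_sqrtr (ltW d0)) expr2 invfM.
rewrite mulfVK ?gt_eqF// ler_pdivlMr// -[X in X * _](sqrtr_sqr) -sqrtrM ?sqr_ge0//.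
rewrite ler_wsqrtr// mulrDr mulr1.
have h1 : dirichlet a tau ^+ 2 <= a ^+ 2.
  by rewrite -real_normK ?num_real// lerXn2r ?nnegrE ?dirichlet_le.
have h2 : dirichlet a tau ^+ 2 * tau ^+ 2 <= 1.
  rewrite -exprMn -real_normK ?num_real// normrM expr_le1// ?mulr_ge0//.
  have [->|t0] := eqVneq tau 0; first by rewrite normr0 mulr0.
  by rewrite -ler_pdivlMr ?normr_gt0// mul1r dirichlet_decay.
exact: lerD.
Qed.

Lemma Cmeasurable_ball_symbol (a : R) : Cmeasurable (@ball_symbol R n a).
Proof.
rewrite (_ : ball_symbol a = fun X => (window a (energy_form X))%:C); last first.
  by apply/funext => X; exact: ball_symbolE.
apply: Cmeasurable_real.
exact: (measurableT_comp (measurable_window a) measurable_energy_form).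
Qed.

(** With the damping factor, Fubini exchanges the integral over the frequency
    with the one over phase space and [wigner_Hermite_chirp] evaluates the
    latter.  Both sides then converge as the damping disappears.  For [a = 0] the
    ball is a point and both sides vanish. *)
Lemma ball_wigner_Hermite alpha beta (a : R) : (1 <= n)%N -> 0 <= a ->
  distribution_of (@ball_symbol R n a) (wigner (@Hermite R n alpha) (@Hermite R n beta)) =
  (alpha == beta)%:R * F (\sum_j alpha j) n a.
Proof.
move=> n1; rewrite le_eqVlt => /predU1P[<-|a0].
  rewrite /F [X in _ = _ * X](_ : _ = 0) ?mulr0; last first.
    rewrite -[RHS](@Cintegral0 _ _ R leb); apply: eq_Cintegral => tau.
    by rewrite mul0r sin0 !mul0r.
  rewrite -[RHS](@Cintegral0 _ _ R (lam (n + n))); apply: ae_eq_Cintegral.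
  - by apply: CmeasurableM; [exact: Cmeasurable_ball_symbol|exact: Cmeasurable_wigner_Hermite].
  - exact: Cmeasurable_cst.
  - apply: filterS (ae_energy_form_neq 0 n1) => X X0.
    rewrite ball_symbolE windowE ger0_norm ?energy_form_ge0//.
    by rewrite le_eqVlt (negbTE X0) ltNge energy_form_ge0 mul0r.
set W := wigner _ _; set k := (\sum_j alpha j)%N.
have Wi : Cintegrable (lam (n + n)) W by exact: Cintegrable_wigner_Hermite.
pose b tau : C := (alpha == beta)%:R * ((dirichlet a tau)%:C * chirp_value k tau).
have bi : Cintegrable leb b by apply: CintegrableZl; exact: dirichlet_chirp_integrable (ltW a0).
have -> : distribution_of (ball_symbol a) W =
    Cintegral (lam (n + n)) (fun X => W X * (window a (energy_form X))%:C).
  by apply: eq_Cintegral => X; rewrite ball_symbolE mulrC.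
have -> : (alpha == beta)%:R * F k n a = Cintegral leb (fun tau => b tau * (1 : R)%:C).
  rewrite /F -CintegralZl; last exact: dirichlet_chirp_integrable (ltW a0).
  by apply: eq_Cintegral => tau; rewrite mulr1.
have key m : Cintegral (lam (n + n)) (fun X => W X * (mollified m a (energy_form X))%:C) =
    Cintegral leb (fun tau => b tau * (gauss (damping m) tau)%:C).
  pose f (z : E2n * R) : C := W z.1 * ((damped m a z.2)%:C * cis (z.2 * energy_form z.1)).
  have fi : Cintegrable (lam (n + n) \x leb)%E f.
    have id : rintegrable leb (fun tau => a * gauss (damping m) tau).
      by apply: rintegrableZl; apply: rintegrable_gauss; exact: damping_gt0.
    apply: (Cintegrable_dominated _ (rintegrable_prod (Cintegrable_normc Wi) id)).
      apply: CmeasurableM.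
        exact: (Cmeasurable_comp measurable_fst (Cmeasurable_wigner_Hermite alpha beta)).
      apply: CmeasurableM.
        by apply: Cmeasurable_real; exact: (measurableT_comp (measurable_damped m a) measurable_snd).
      apply: Cmeasurable_cis; apply: measurable_funM; first exact: measurable_snd.
      exact: (measurableT_comp measurable_energy_form measurable_fst).
    move=> z; rewrite !normcM normc_cis mulr1 normc_realE ler_wpM2l ?normc_ge0//.
    by apply: damped_le; exact: ltW.
  transitivity (Cintegral (lam (n + n)) (fun X => Cintegral leb (fun tau => f (X, tau)))).
    apply: eq_Cintegral => X; rewrite /f/= CintegralZl; last exact: damped_integrable (ltW a0).
    by rewrite damped_fourier.
  rewrite (Cintegral_fubini fi); apply: eq_Cintegral => tau; rewrite /f/=.
  transitivity ((damped m a tau)%:C * Cintegral (lam (n + n)) (fun X => W X * cis (tau * energy_form X))).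
    rewrite -CintegralZl; last exact: Cintegrable_chirp.
    by apply: eq_Cintegral => X; rewrite mulrCA.
  rewrite wigner_Hermite_chirp /b /damped real_complexM.
  by move: (_%:C) (_%:C) (chirp_value _ _) (_ == _)%:R => *; ring.
have mq := measurable_energy_form.
have [|||| L1 L2] := @Cintegral_mul_cvg _ _ R (lam (n + n)) W
  (fun m X => mollified m a (energy_form X)) (fun X => window a (energy_form X)) Wi.
- move=> m; have := measurable_mollified m a 0; under eq_fun do rewrite subr0.
  by move=> mm; exact: (measurableT_comp mm mq).
- exact: (measurableT_comp (measurable_window a) mq).
- apply: filterS (ae_energy_form_neq a n1) => X Xa.
  by apply: mollified_cvg; rewrite ger0_norm ?energy_form_ge0.
- by move=> m X; rewrite ger0_norm ?mollified_ge0 ?mollified_le1.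
have [|||| L3 L4] := @Cintegral_mul_cvg _ _ R leb b (fun m => gauss (damping m)) (fun=> 1) bi.
- by move=> m; exact: measurable_gauss.
- exact: measurable_cst.
- apply: aeW => tau; rewrite /gauss -[X in _ --> X]expR0.
  apply: continuous_cvg; first exact: continuous_expR.
  have -> : (fun m => - (damping m * tau ^+ 2)) = fun m => - (harmonic m * harmonic m * tau ^+ 2).
    by apply/funext => m; rewrite /damping /harmonic/= expr2 invfM.
  have := cvgN (cvgMr_tmp (b := tau ^+ 2) (cvgM (@cvg_harmonic R) (@cvg_harmonic R))).
  by rewrite mulr0 mul0r oppr0; exact.
- by move=> m tau; rewrite ger0_norm ?gauss_ge0 ?gauss_le1// ltW// damping_gt0.
have keyE : (fun m => Cintegral (lam (n + n)) (fun X => W X * (mollified m a (energy_form X))%:C)) =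
    fun m => Cintegral leb (fun tau => b tau * (gauss (damping m) tau)%:C).
  exact/funext.
move/(congr1 (fun f m => complex.Re (f m))): (keyE) => keyR.
move/(congr1 (fun f m => complex.Im (f m))): (keyE) => keyI.
rewrite keyR in L1; rewrite keyI in L2.
by apply: complex_ext; [exact: (cvg_unique _ L1 L3)|exact: (cvg_unique _ L2 L4)].
Qed.

End phase_space_integral.

(** * Complex square-integrable functions and Schwartz functions *)

Section square_integrable_complex.
Context {R : realType}.
Variable n : nat.
Local Notation C := R[i].
Local Notation lam := (@lebesgue_row R n).
Local Notation En := 'rV[R]_n.
Implicit Types (u v : En -> C).

(** The squared norm, with values in the extended reals, is an integral to which
    Tonelli applies directly. *)
Definition sqnorm u : \bar R := \int[lam]_x (normc (u x) ^+ 2)%:E.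

Lemma sqnorm_ge0 u : (0 <= sqnorm u)%E.
Proof. by apply: integral_ge0 => x _; rewrite lee_fin sqr_ge0. Qed.

Lemma L2normE u : L2norm u = (sqnorm u `^ 2^-1)%E.
Proof.
rewrite /L2norm unlock /sqnorm; congr (_ `^ _)%E.
apply: eq_integral => x _; rewrite -powR_mulrn ?normc_ge0//.
by rewrite /= ger0_norm// normc_ge0.
Qed.

Lemma L2P u : L2 u <-> Cmeasurable u /\ (sqnorm u < +oo)%E.
Proof.
have E : (L2norm u < +oo)%E <-> (sqnorm u < +oo)%E.
  rewrite L2normE; split => [|h]; last exact: poweR_lty.
  by apply: lty_poweRy; rewrite invr_eq0.
split=> [[h1 h2 /E h3]|[[h1 h2] /E h3]]; by [].
Qed.

Lemma L2_parts u : L2 u ->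
  sqintegrable lam (fun x => complex.Re (u x)) /\
  sqintegrable lam (fun x => complex.Im (u x)).
Proof.
move/L2P => [[m1 m2] fin].
have le (h : En -> R) : measurable_fun [set: En] h ->
    (forall x, h x ^+ 2 <= normc (u x) ^+ 2) -> sqintegrable lam h.
  move=> mh hu; apply: sqintegrable_ge0 => //; apply: le_lt_trans fin.
  apply: ge0_le_integral => //.
  - by move=> x _; rewrite lee_fin sqr_ge0.
  - by apply/measurable_EFinP; exact: measurable_funX.
  - by apply/measurable_EFinP; apply: measurable_funX; exact: measurable_normc.
  - by move=> x _; rewrite lee_fin.
split; apply: le => // x; rewrite normc_sqrE; [rewrite lerDl|rewrite lerDr]; exact: sqr_ge0.
Qed.

Lemma sqnormE u : sqintegrable lam (fun x => complex.Re (u x)) ->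
  sqintegrable lam (fun x => complex.Im (u x)) ->
  sqnorm u = (energy lam (fun x => complex.Re (u x)) +
              energy lam (fun x => complex.Im (u x)))%:E.
Proof.
move=> s1 s2; rewrite /energy !ip_sqr -rintegralD; [|exact: s1.2|exact: s2.2].
rewrite EFin_Rintegral; last exact: rintegrableD s1.2 s2.2.
by apply: eq_integral => x _; rewrite normc_sqrE.
Qed.

Lemma L2_of_parts u : sqintegrable lam (fun x => complex.Re (u x)) ->
  sqintegrable lam (fun x => complex.Im (u x)) -> L2 u.
Proof.
move=> s1 s2; apply/L2P; split; first by split; [exact: s1.1|exact: s2.1].
by rewrite sqnormE// ltry.
Qed.

Lemma L2_measurable u : L2 u -> Cmeasurable u.
Proof. by move/L2P => []. Qed.

Lemma L2D u v : L2 u -> L2 v -> L2 (fun x => u x + v x).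
Proof.
move=> /L2_parts[u1 u2] /L2_parts[v1 v2]; apply: L2_of_parts.
- by under eq_fun do rewrite ReCD; exact: sqintegrableD.
- by under eq_fun do rewrite ImCD; exact: sqintegrableD.
Qed.

Lemma L2Z (c : C) u : L2 u -> L2 (fun x => c * u x).
Proof.
move=> /L2_parts[u1 u2]; apply: L2_of_parts.
- by under eq_fun do rewrite ReCM; apply: sqintegrableB; exact: sqintegrableZl.
- by under eq_fun do rewrite ImCM; apply: sqintegrableD; exact: sqintegrableZl.
Qed.

Lemma L20 : L2 (fun _ : En => 0 : C).
Proof. by apply: L2_of_parts; exact: sqintegrable0. Qed.

Lemma L2_sum I (s : seq I) (f : I -> En -> C) : (forall i, L2 (f i)) ->
  L2 (fun x => \sum_(i <- s) f i x).
Proof.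
move=> Lf; elim: s => [|i s IH].
  by under eq_fun do rewrite big_nil; exact: L20.
by under eq_fun do rewrite big_cons; exact: (L2D (Lf i) IH).
Qed.

Lemma ae_eq_L2norm u v : Cmeasurable u -> Cmeasurable v ->
  {ae lam, forall x, u x = v x} -> L2norm u = L2norm v.
Proof.
move=> mu mv uv; rewrite !L2normE /sqnorm; congr (_ `^ _)%E.
apply: ae_eq_integral => //.
- by apply/measurable_EFinP; apply: measurable_funX; exact: measurable_normc.
- by apply/measurable_EFinP; apply: measurable_funX; exact: measurable_normc.
- by apply: filterS uv => x ->.
Qed.

End square_integrable_complex.

Section schwartz_facts.
Context {R : realType}.
Variable n : nat.
Local Notation C := R[i].
Local Notation lam := (@lebesgue_row R n).
Local Notation En := 'rV[R]_n.
Implicit Types (phi : En -> C).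

Lemma schwartz_measurable phi : schwartz phi -> Cmeasurable phi.
Proof.
move=> [s1 s2 _]; split; apply: continuous_row_measurable => x.
- by apply: differentiable_continuous; exact: (s1 [::] x).
- by apply: differentiable_continuous; exact: (s2 [::] x).
Qed.

Lemma Cpartials_nil phi x : Cpartials [::] phi x = phi x.
Proof. by rewrite /Cpartials/=; case: (phi x). Qed.

Lemma schwartz_bounded phi : schwartz phi ->
  exists M : R, 0 <= M /\ forall x, normc (phi x) <= M.
Proof.
move=> [_ _ /(_ [::] 0%N)[M HM]].
have H x : normc (phi x) <= M by have := HM x; rewrite expr0 mul1r Cpartials_nil.
by exists M; split=> //; apply: le_trans (H 0); exact: normc_ge0.
Qed.

(** The product of the [1 + x_j^2] is at most [2^n (1 + |x|^(2 n))], and its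
    inverse is integrable. *)
Lemma schwartz_integrable phi : schwartz phi -> Cintegrable lam phi.
Proof.
move=> sphi; have mphi := schwartz_measurable sphi.
have [M [M0 HM]] := schwartz_bounded sphi.
have [_ _ /(_ [::] (2 * n)%N)[N HN]] := sphi.
have [I1 _] := @Rintegral_row_prod R n (fun _ t => (1 + t ^+ 2)^-1)
  (fun _ => rintegrable_oneDsqr).
apply: (Cintegrable_dominated mphi (rintegrableZl (2 ^+ n * (M + N)) I1)) => x.
have d0 (t : R) : 0 < 1 + t ^+ 2 by rewrite ltr_pwDl// sqr_ge0.
rewrite prodfV ler_pdivlMr; last by apply: prodr_gt0 => j _.
have P : \prod_j (1 + x ord0 j ^+ 2) <= 2 ^+ n * (1 + `|x| ^+ (2 * n)).
  apply: (@le_trans _ _ (\prod_(j < n) (1 + `|x| ^+ 2))).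
    apply: ler_prod => j _; rewrite ltW//= lerD2l -real_normK ?num_real//.
    by rewrite lerXn2r ?nnegrE// coord_le_norm.
  rewrite prodr_const card_ord exprM; move: (`|x| ^+ 2) (exprn_ge0 2 (normr_ge0 x)) => t t0.
  have [t1|/ltW t1] := leP t 1.
    apply: (@le_trans _ _ (2 ^+ n)); first by rewrite lerXn2r ?nnegrE ?addr_ge0//; lra.
    by rewrite ler_peMr ?exprn_ge0// lerDl exprn_ge0.
  apply: (@le_trans _ _ ((2 * t) ^+ n)); first by rewrite lerXn2r ?nnegrE ?addr_ge0 ?mulr_ge0//; lra.
  by rewrite exprMn ler_wpM2l ?exprn_ge0// lerDr.
apply: le_trans (ler_wpM2l (normc_ge0 _) P) _.
rewrite mulrCA ler_wpM2l ?exprn_ge0// mulrDr mulr1 lerD//.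
by have := HN x; rewrite Cpartials_nil mulrC.
Qed.

End schwartz_facts.

(** * The quantization of the ball as an average of reflections *)

Section weyl_ball.
Context {R : realType}.
Variables (n : nat) (a : R).
Local Notation C := R[i].
Local Notation lam m := (@lebesgue_row R m).
Local Notation En := 'rV[R]_n.
Local Notation E2n := 'rV[R]_(n + n).
Implicit Types (u v phi : En -> C).

Definition ball_ind (X : E2n) : R := window a (energy_form X).

Local Notation vol := (\int[lam (n + n)]_X ball_ind X).

Lemma ball_ind_ge0 X : 0 <= ball_ind X. Proof. exact: window_ge0. Qed.

Lemma ball_ind_sqr X : ball_ind X ^+ 2 = ball_ind X.
Proof. by rewrite /ball_ind windowE; case: (_ <= _); rewrite ?expr1n ?expr0n. Qed.

Lemma measurable_ball_ind : measurable_fun [set: E2n] ball_ind.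
Proof. exact: (measurableT_comp (measurable_window a) (@measurable_energy_form R n)). Qed.

Lemma rintegrable_ball_ind : rintegrable (lam (n + n)) ball_ind.
Proof.
apply: rintegrable_ge0; [exact: measurable_ball_ind|exact: ball_ind_ge0|].
have p2 : 0 < 2 * pi :> R by rewrite mulr_gt0// pi_gt0.
pose B := [set X : E2n | \sum_i X ord0 i ^+ 2 <= a / (2 * pi)].
have E X : ball_ind X = \1_B X.
  rewrite /ball_ind windowE ger0_norm ?energy_form_ge0// indicE energy_formE mulrC.
  by rewrite -ler_pdivlMr//; congr (_%:R); congr nat_of_bool; apply/idP/idP; rewrite inE.
have mB : measurable B.
  rewrite (_ : B = (fun X : E2n => \sum_i X ord0 i ^+ 2) @^-1` `]-oo, (a / (2 * pi))]%classic); last first.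
    by apply/seteqP; split=> X /=; rewrite in_itv.
  rewrite -[X in measurable X]setTI; apply: measurable_sqnorm => //.
under eq_integral do rewrite E.
rewrite integral_indic// setIT; exact: lebesgue_row_ball_lty.
Qed.

Lemma rintegrable_ball_mul (phi : E2n -> C) (M : R) : Cmeasurable phi ->
  (forall X, normc (phi X) <= M) ->
  Cintegrable (lam (n + n)) (fun X => ball_symbol a X * phi X).
Proof.
move=> mphi HM; apply: (Cintegrable_dominated _ (rintegrableZl M rintegrable_ball_ind)).
  by apply: CmeasurableM => //; exact: Cmeasurable_ball_symbol.
move=> X; rewrite ball_symbolE normcM normc_realE ger0_norm ?ball_ind_ge0// mulrC.
by rewrite ler_wpM2r// ball_ind_ge0.
Qed.

(** The symbol is bounded with support of finite volume, so the seminorm of order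
    0 controls the distribution. *)
Lemma tempered_ball : tempered (distribution_of (@ball_symbol R n a)).
Proof.
split=> [c phi psi sphi spsi|].
  have [M [_ HM]] := schwartz_bounded sphi; have [N [_ HN]] := schwartz_bounded spsi.
  have i1 := rintegrable_ball_mul (schwartz_measurable sphi) HM.
  have i2 := rintegrable_ball_mul (schwartz_measurable spsi) HN.
  rewrite /distribution_of -(CintegralZl _ i1) -(CintegralD (CintegrableZl c i1) i2).
  by apply: eq_Cintegral => X; rewrite mulrDr mulrCA.
exists 0%N, (2 * vol) => phi B sphi HB.
have H X : normc (phi X) <= B.
  by have := HB [::] 0%N X (leqnn _) (leqnn _); rewrite expr0 mul1r Cpartials_nil.
have fi := rintegrable_ball_mul (schwartz_measurable sphi) H.
apply: le_trans (normc_Cintegral_le fi) _; rewrite -mulrA ler_wpM2l//.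
rewrite mulrC -(rintegralZl _ rintegrable_ball_ind); apply: le_Rintegral.
- exact: measurableT.
- exact: Cintegrable_normc fi.
- exact: rintegrableZl rintegrable_ball_ind.
- move=> X _; rewrite ball_symbolE normcM normc_realE ger0_norm ?ball_ind_ge0// mulrC.
  by rewrite ler_wpM2r// ball_ind_ge0.
Qed.

(** The Weyl quantization as an average, over the ball, of the unitary
    operators [u |-> cis (4 pi (y - x) . xi) u (2 x - y)]. *)
Definition weyl_kernel u (z : En * E2n) : C :=
  ball_symbol a z.2 * (cis (4 * pi * dotr (z.1 - lsubmx z.2) (rsubmx z.2))
    * u (2 *: lsubmx z.2 - z.1)).

Definition weyl_ball u (y : En) : C :=
  (2 ^+ n)%:C * Cintegral (lam (n + n)) (fun X => weyl_kernel u (y, X)).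

Lemma measurable_fstj j : measurable_fun [set: En * E2n] (fun z => z.1 ord0 j).
Proof. exact: (measurableT_comp (measurable_coord j) measurable_fst). Qed.

Lemma measurable_lsub j : measurable_fun [set: En * E2n] (fun z => lsubmx z.2 ord0 j).
Proof.
under eq_fun do rewrite mxE.
exact: (measurableT_comp (measurable_coord _) measurable_snd).
Qed.

Lemma measurable_rsub j : measurable_fun [set: En * E2n] (fun z => rsubmx z.2 ord0 j).
Proof.
under eq_fun do rewrite mxE.
exact: (measurableT_comp (measurable_coord _) measurable_snd).
Qed.

Lemma measurable_reflect :
  measurable_fun [set: En * E2n] (fun z => 2 *: lsubmx z.2 - z.1 : En).
Proof.
apply: measurable_fun_row => j.
rewrite (_ : (fun z => _) = fun z : En * E2n => 2 * lsubmx z.2 ord0 j - z.1 ord0 j); last first.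
  by apply/funext => z; rewrite !mxE.
apply: measurable_funB; last exact: measurable_fstj.
by apply: measurable_funM => //; exact: measurable_lsub.
Qed.

Lemma Cmeasurable_weyl_kernel u : Cmeasurable u -> Cmeasurable (weyl_kernel u).
Proof.
move=> mu; apply: CmeasurableM.
  exact: (Cmeasurable_comp measurable_snd (Cmeasurable_ball_symbol n a)).
apply: CmeasurableM; last exact: (Cmeasurable_comp measurable_reflect mu).
apply: Cmeasurable_cis; apply: measurable_funM => //.
apply: measurable_sum => j; apply: measurable_funM; last exact: measurable_rsub.
under eq_fun do rewrite mxE [X in _ + X]mxE.
by apply: measurable_funB; [exact: measurable_fstj|exact: measurable_lsub].
Qed.

Let mass u (y : En) : \bar R :=
  \int[lam (n + n)]_X (ball_ind X * normc (u (2 *: lsubmx X - y)) ^+ 2)%:E.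

Let measurable_mass_integrand u : Cmeasurable u ->
  measurable_fun [set: En * E2n] (fun z =>
    ball_ind z.2 * normc (u (2 *: lsubmx z.2 - z.1)) ^+ 2).
Proof.
move=> mu; apply: measurable_funM.
  exact: (measurableT_comp measurable_ball_ind measurable_snd).
apply: measurable_funX.
exact: (measurable_normc (Cmeasurable_comp measurable_reflect mu)).
Qed.

Let mass_ge0 u y : (0 <= mass u y)%E.
Proof.
by apply: integral_ge0 => X _; rewrite lee_fin mulr_ge0 ?sqr_ge0 ?ball_ind_ge0.
Qed.

(** Each reflection [y |-> 2 x - y] preserves Lebesgue measure, so integrating
    in [y] first leaves the volume of the ball. *)
Lemma integral_mass u : Cmeasurable u ->
  (\int[lam n]_y mass u y = vol%:E * sqnorm u)%E.
Proof.
move=> mu; have mz := measurable_mass_integrand mu.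
have mu2 : measurable_fun [set: En] (fun y => (normc (u y) ^+ 2)%:E).
  by apply/measurable_EFinP; apply: measurable_funX; exact: measurable_normc.
rewrite (@fubini_tonelli _ _ _ _ R (lam n) (lam (n + n)) (fun z : En * E2n =>
  (ball_ind z.2 * normc (u (2 *: lsubmx z.2 - z.1)) ^+ 2)%:E)).
- transitivity (\int[lam (n + n)]_X (ball_ind X)%:E * sqnorm u)%E.
    rewrite -ge0_integralZr//.
    + apply: eq_integral => X _ /=.
      under eq_integral do rewrite EFinM.
      rewrite ge0_integralZl//.
      * congr (_ * _)%E; rewrite /sqnorm.
        rewrite (ge0_integral_row_affine (2 *: lsubmx X) (r := -1)
          (f := fun y => (normc (u y) ^+ 2)%:E))//.
          rewrite normrN1 expr1n mul1e.
          by apply: eq_integral => y _; rewrite scaleN1r.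
        by move=> y; rewrite lee_fin sqr_ge0.
      * apply/measurable_EFinP; apply: measurable_funX; apply: measurable_normc.
        apply: (Cmeasurable_comp _ mu); apply: (measurableT_comp measurable_reflect
          (g := fun y : En => (y, X))).
        by apply: measurable_fun_pair => //; exact: measurable_cst.
      * by move=> y _; rewrite lee_fin sqr_ge0.
      * by rewrite lee_fin ball_ind_ge0.
    + by apply/measurable_EFinP; exact: measurable_ball_ind.
    + by move=> X _; rewrite lee_fin ball_ind_ge0.
    + exact: sqnorm_ge0.
  by rewrite EFin_Rintegral//; exact: rintegrable_ball_ind.
- exact/measurable_EFinP.
- by move=> z; rewrite lee_fin mulr_ge0 ?sqr_ge0 ?ball_ind_ge0.
Qed.

Let normc_kernel u y X :
  normc (weyl_kernel u (y, X)) = ball_ind X * normc (u (2 *: lsubmx X - y)).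
Proof.
rewrite /weyl_kernel/= ball_symbolE !normcM normc_cis mul1r normc_realE.
by rewrite ger0_norm ?ball_ind_ge0.
Qed.

Let Cmeasurable_slice u y : Cmeasurable u -> Cmeasurable (fun X => weyl_kernel u (y, X)).
Proof.
move=> mu; have my : measurable_fun [set: E2n] (fun X : E2n => (y, X)).
  by apply: measurable_fun_pair => //; exact: measurable_cst.
exact: (Cmeasurable_comp my (Cmeasurable_weyl_kernel mu)).
Qed.

Let sqintegrable_slice u y : Cmeasurable u -> (mass u y < +oo)%E ->
  sqintegrable (lam (n + n)) (fun X => normc (weyl_kernel u (y, X))).
Proof.
move=> mu fin; apply: sqintegrable_ge0.
  by apply: measurable_normc; exact: Cmeasurable_slice.
apply: le_lt_trans fin; rewrite le_eqVlt; apply/orP; left; apply/eqP.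
by apply: eq_integral => X _; rewrite normc_kernel exprMn ball_ind_sqr.
Qed.

Let sqintegrable_ball : sqintegrable (lam (n + n)) ball_ind.
Proof.
split; first exact: measurable_ball_ind.
by under eq_fun do rewrite ball_ind_sqr; exact: rintegrable_ball_ind.
Qed.

Let ball_kernel u y X : ball_ind X * normc (weyl_kernel u (y, X)) = normc (weyl_kernel u (y, X)).
Proof. by rewrite normc_kernel mulrA -expr2 ball_ind_sqr. Qed.

Let Cintegrable_slice u y : Cmeasurable u -> (mass u y < +oo)%E ->
  Cintegrable (lam (n + n)) (fun X => weyl_kernel u (y, X)).
Proof.
move=> mu fin.
have := rintegrableM sqintegrable_ball (sqintegrable_slice mu fin).
under eq_fun do rewrite ball_kernel.
move=> ik; apply: (Cintegrable_dominated _ ik) => //; exact: Cmeasurable_slice.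
Qed.

(** The factor [2^n] is the one of [weyl_ball], the factor 2 that of
    [normc_Cintegral_le], and adding 1 to the volume makes the constant positive,
    as [weyl_ball_le] requires when [mass u y] is infinite. *)
Let opnorm2 : R := (2 ^+ n * 2) ^+ 2 * (vol + 1).

Let vol_ge0 : 0 <= vol.
Proof. by apply: Rintegral_ge0 => X _; exact: ball_ind_ge0. Qed.

Let opnorm2_gt0 : 0 < opnorm2.
Proof. by rewrite /opnorm2 mulr_gt0 ?exprn_gt0 ?mulr_gt0 ?exprn_gt0// ltr_wpDl. Qed.

(** Cauchy-Schwarz against the indicator of the ball.  Where [mass u y] is
    infinite there is nothing to prove. *)
Lemma weyl_ball_le u : Cmeasurable u -> forall y,
  ((normc (weyl_ball u y) ^+ 2)%:E <= opnorm2%:E * mass u y)%E.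
Proof.
move=> mu y; have [fin|] := boolP (mass u y < +oo)%E; last first.
  by rewrite -leNgt leye_eq => /eqP ->; rewrite gt0_muley ?lte_fin ?leey.
have sk := sqintegrable_slice mu fin.
have mE : mass u y = (ip (lam (n + n)) (fun X => normc (weyl_kernel u (y, X)))
    (fun X => normc (weyl_kernel u (y, X))))%:E.
  rewrite ip_sqr (EFin_Rintegral sk.2).
  by apply: eq_integral => X _; rewrite normc_kernel exprMn ball_ind_sqr.
rewrite mE -EFinM lee_fin; set m := ip _ _ _.
have m0 : 0 <= m by exact: ip_ge0.
have CS := cauchy_schwarz sqintegrable_ball sk.
have bE : ip (lam (n + n)) ball_ind (fun X => normc (weyl_kernel u (y, X))) =
    \int[lam (n + n)]_X normc (weyl_kernel u (y, X)).
  by rewrite /ip; under eq_Rintegral do rewrite ball_kernel.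
have vE : ip (lam (n + n)) ball_ind ball_ind = vol.
  by rewrite ip_sqr; under eq_Rintegral do rewrite ball_ind_sqr.
rewrite bE vE -/m in CS.
have N := normc_Cintegral_le (Cintegrable_slice mu fin).
rewrite /weyl_ball normcM normc_realE ger0_norm ?exprn_ge0//.
rewrite /opnorm2.
move: (normc_ge0 (Cintegral (lam (n + n)) (fun X => weyl_kernel u (y, X)))) N CS vol_ge0.
move: (normc (Cintegral _ _)) (\int[_]_X normc _) vol (2 ^+ n : R) => c I V A c0 cI II V0.
have cI2 : c ^+ 2 <= 4 * I ^+ 2.
  rewrite (_ : 4 * I ^+ 2 = (2 * I) ^+ 2); last by ring.
  by rewrite lerXn2r ?nnegrE ?(le_trans c0 cI).
rewrite (_ : (A * 2) ^+ 2 * (V + 1) * m = A ^+ 2 * (4 * (V * m + m))); last by ring.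
by rewrite exprMn ler_wpM2l ?sqr_ge0//; lra.
Qed.

Let measurable_mass u : Cmeasurable u -> measurable_fun [set: En] (mass u).
Proof.
move=> mu; apply: (emeasurable_partial_integral1 (lam (n + n)) (f := fun z : En * E2n =>
  (ball_ind z.2 * normc (u (2 *: lsubmx z.2 - z.1)) ^+ 2)%:E)).
by apply/measurable_EFinP; exact: measurable_mass_integrand.
Qed.

Let integral_mass_lty u : L2 u -> (\int[lam n]_y mass u y < +oo)%E.
Proof.
move=> /L2P[mu fin]; rewrite integral_mass//.
by apply: lte_mul_pinfty => //; rewrite lee_fin.
Qed.

(** The integral of [mass u] is finite, hence so is [mass u] almost everywhere. *)
Lemma Cintegrable_weyl_kernel u : L2 u ->
  {ae lam n, forall y, Cintegrable (lam (n + n)) (fun X => weyl_kernel u (y, X))}.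
Proof.
move=> Lu; have mu := L2_measurable Lu.
have im : (lam n).-integrable [set: En] (mass u).
  apply/integrableP; split; first exact: measurable_mass.
  under eq_integral do rewrite gee0_abs ?mass_ge0//.
  exact: integral_mass_lty.
have := integrable_ae measurableT im; apply: filterS => y /(_ I) fy.
by apply: Cintegrable_slice => //; rewrite ltey_eq fy.
Qed.

Lemma Cmeasurable_weyl_ball u : Cmeasurable u -> Cmeasurable (weyl_ball u).
Proof.
move=> mu; apply: CmeasurableM; first exact: Cmeasurable_cst.
have [m1 m2] := Cmeasurable_weyl_kernel mu.
by split; [exact: measurable_partial_integral1 m1|exact: measurable_partial_integral1 m2].
Qed.

Lemma sqnorm_weyl_ball u : Cmeasurable u ->
  (sqnorm (weyl_ball u) <= (opnorm2 * vol)%:E * sqnorm u)%E.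
Proof.
move=> mu; rewrite EFinM -muleA -integral_mass//.
have mm := measurable_mass mu.
rewrite -ge0_integralZl//; last by rewrite lee_fin ltW.
apply: ge0_le_integral => //.
- by move=> y _; rewrite lee_fin sqr_ge0.
- apply/measurable_EFinP; apply: measurable_funX; apply: measurable_normc.
  exact: Cmeasurable_weyl_ball.
- exact: measurable_funeM.
- by move=> y _; exact: weyl_ball_le.
Qed.

Lemma bounded_weyl_ball : bounded_L2_operator weyl_ball.
Proof.
split.
- move=> u /L2P[mu fin]; apply/L2P; split; first exact: Cmeasurable_weyl_ball.
  apply: le_lt_trans (sqnorm_weyl_ball mu) _.
  by apply: lte_mul_pinfty => //; rewrite lee_fin mulr_ge0// ltW.
- move=> c u v Lu Lv.
  apply: filterS2 (Cintegrable_weyl_kernel Lu) (Cintegrable_weyl_kernel Lv) => y iu iv.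
  rewrite /weyl_ball mulrCA -mulrDr -(CintegralZl _ iu) -(CintegralD (CintegrableZl c iu) iv).
  congr (_ * _); apply: eq_Cintegral => X; rewrite /weyl_kernel/=.
  by move: (ball_symbol _ _) (cis _) (u _) (v _) => *; ring.
- exists ((opnorm2 * vol) `^ 2^-1) => u Lu.
  have mu := L2_measurable Lu.
  have ov : 0 <= opnorm2 * vol by rewrite mulr_ge0// ltW.
  rewrite !L2normE -poweR_EFin -poweRM ?lee_fin ?sqnorm_ge0//.
  apply: gt0_ler_poweR => //.
  + by rewrite in_itv/= sqnorm_ge0 leey.
  + by rewrite in_itv/= leey andbT mule_ge0 ?lee_fin ?sqnorm_ge0.
  + exact: sqnorm_weyl_ball.
Qed.

(** Integrating in [y] first, the substitution [z = 2 (x - y)], of Jacobian [2^n],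
    recovers the Wigner distribution at [(x, xi)]. *)
Lemma weyl_ball_Op u phi : schwartz u -> schwartz phi ->
  distribution_of (weyl_ball u) phi = Op_w (distribution_of (@ball_symbol R n a)) u phi.
Proof.
move=> su sphi; have mu := schwartz_measurable su; have mphi := schwartz_measurable sphi.
have [M [M0 HM]] := schwartz_bounded su; have iphi := schwartz_integrable sphi.
pose f (z : En * E2n) : C := weyl_kernel u z * phi z.1.
have fi : Cintegrable (lam n \x lam (n + n))%E f.
  apply: (Cintegrable_dominated _ (rintegrable_prod (Cintegrable_normc iphi)
    (rintegrableZl M rintegrable_ball_ind))).
    apply: CmeasurableM; first exact: Cmeasurable_weyl_kernel.
    exact: (Cmeasurable_comp measurable_fst mphi).
  move=> [y X]; rewrite normcM normc_kernel/= mulrC ler_wpM2l ?normc_ge0// mulrC.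
  by rewrite ler_wpM2r ?ball_ind_ge0.
have ik y : Cintegrable (lam (n + n)) (fun X => weyl_kernel u (y, X)).
  apply: (Cintegrable_dominated _ (rintegrableZl M rintegrable_ball_ind)).
    exact: Cmeasurable_slice.
  by move=> X; rewrite normc_kernel mulrC ler_wpM2r ?ball_ind_ge0.
transitivity ((2 ^+ n)%:C * Cintegral (lam n) (fun y => Cintegral (lam (n + n)) (fun X => f (y, X)))).
  have iF : Cintegrable (lam n) (fun y => Cintegral (lam (n + n)) (fun X => f (y, X))).
    by split; [exact: rintegrable_partial_integral1 fi.1|exact: rintegrable_partial_integral1 fi.2].
  rewrite -(CintegralZl _ iF); apply: eq_Cintegral => y; rewrite /weyl_ball -mulrA.
  congr (_ * _); rewrite mulrC -CintegralZl//; apply: eq_Cintegral => X.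
  by rewrite /f mulrC.
rewrite (Cintegral_fubini fi).
have iG : Cintegrable (lam (n + n)) (fun X => Cintegral (lam n) (fun y => f (y, X))).
  by split; [exact: rintegrable_partial_integral2 fi.1|exact: rintegrable_partial_integral2 fi.2].
rewrite -(CintegralZl _ iG); apply: eq_Cintegral => X.
set x := lsubmx X; set xi := rsubmx X.
pose g (z : En) : C := cis (- (2 * pi * dotr z xi)) * u (x + 2^-1 *: z)
  * (((phi (x - 2^-1 *: z))^*)^*)%C.
have mx (c r : R) : measurable_fun [set: En] (fun z : En => c *: x + r *: z).
  apply: measurable_fun_row => j.
  rewrite (_ : (fun z => _) = fun z : En => c * x ord0 j + r * z ord0 j); last first.
    by apply/funext => z; rewrite !mxE.
  by apply: measurable_funD => //; apply: measurable_funM => //; exact: measurable_coord.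
have mg : Cmeasurable g.
  apply: CmeasurableM; first apply: CmeasurableM.
  - apply: Cmeasurable_cis; apply: measurableT_comp => //; apply: measurable_funM => //.
    by apply: measurable_sum => j; apply: measurable_funM => //; exact: measurable_coord.
  - by have := Cmeasurable_comp (mx 1 2^-1) mu; under eq_fun do rewrite scale1r.
  - apply: Cmeasurable_conj; apply: Cmeasurable_conj.
    have := Cmeasurable_comp (mx 1 (- 2^-1)) mphi.
    by under eq_fun do rewrite scale1r scaleNr.
have n2 : (- 2 : R) != 0 by rewrite oppr_eq0 pnatr_eq0.
have E y : g (2 *: x + - 2 *: y) =
    cis (4 * pi * dotr (y - x) xi) * u (2 *: x - y) * phi y.
  have h : 2^-1 *: (2 *: x + - 2 *: y) = x - y.
    by rewrite scalerDr !scalerA mulVf// scale1r mulrN mulVf// scaleN1r.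
  rewrite /g h (_ : x - (x - y) = y); last by rewrite opprB addrC subrK.
  rewrite (_ : x + (x - y) = 2 *: x - y); last by rewrite addrA -mulr2n scaler_nat.
  congr (_ * _ * _); last by apply: complex_ext; rewrite /= ?ReC_conj ?ImC_conj ?opprK.
  congr cis; rewrite /dotr !mulr_sumr -sumrN; apply: eq_bigr => j _.
  by rewrite !mxE; move: (pi : R) => v; ring.
have ih : Cintegrable (lam n) (fun y => g (2 *: x + - 2 *: y)).
  apply: (Cintegrable_dominated (Cmeasurable_comp (mx 2 (- 2)) mg)
    (rintegrableZl M (Cintegrable_normc iphi))) => y.
  by rewrite E !normcM normc_cis mul1r ler_wpM2r ?normc_ge0.
rewrite /wigner -/x -/xi -/g (Cintegral_row_affine (2 *: x) n2 mg).
rewrite normrN ger0_norm// mulrCA; congr (_ * _).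
rewrite /f /weyl_kernel/= -CintegralZl//; apply: eq_Cintegral => y.
by rewrite -/x -/xi -mulrA E.
Qed.

Lemma Op_w_L2_ball : Op_w_L2 (distribution_of (@ball_symbol R n a)) weyl_ball.
Proof.
split; [exact: tempered_ball|exact: bounded_weyl_ball|].
by move=> u phi su sphi; exact: weyl_ball_Op.
Qed.

End weyl_ball.

(** * Diagonalization *)

Section hermite_expansion.
Context {R : realType}.
Variable n : nat.
Local Notation C := R[i].
Local Notation lam := (@lebesgue_row R n).
Local Notation En := 'rV[R]_n.
Local Notation mindex := {ffun 'I_n -> nat}.
Local Notation residualH := (residual lam (@hermite_row R n) (mindices n)).
Local Notation energyH := (energy lam).
Implicit Types (u v : En -> C) (alpha beta : mindex).

Let se := @sqintegrable_hermite_row R n.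
Let oe := @hermite_row_orthonormal R n.
Let us := @uniq_mindices n.

Let ReCN (z : C) : complex.Re (- z) = - complex.Re z. Proof. by case: z. Qed.

Let ImCN (z : C) : complex.Im (- z) = - complex.Im z. Proof. by case: z. Qed.

Definition hermite_coef u alpha : C := L2inner u (Hermite alpha).

Lemma hermite_coefE u alpha : hermite_coef u alpha =
  ip lam (fun x => complex.Re (u x)) (hermite_row alpha) +i*
  ip lam (fun x => complex.Im (u x)) (hermite_row alpha).
Proof.
rewrite /hermite_coef /L2inner /Cintegral; congr (_ +i* _); apply: eq_Rintegral => x _.
- by rewrite ReCM ImC_conj /= oppr0 mulr0 subr0.
- by rewrite ImCM ImC_conj /= oppr0 mulr0 add0r.
Qed.

Lemma Cintegrable_hermite_coef u alpha : L2 u ->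
  Cintegrable lam (fun x => u x * ((@Hermite R n alpha x)^*)%C).
Proof.
move=> /L2_parts[u1 u2]; split.
- rewrite (_ : (fun x => _) = fun x => complex.Re (u x) * hermite_row alpha x).
    by apply: rintegrableM.
  by apply/funext => x; rewrite ReCM ImC_conj /= oppr0 mulr0 subr0.
- rewrite (_ : (fun x => _) = fun x => complex.Im (u x) * hermite_row alpha x).
    by apply: rintegrableM.
  by apply/funext => x; rewrite ImCM ImC_conj /= oppr0 mulr0 add0r.
Qed.

Lemma hermite_coef_lin c u v alpha : L2 u -> L2 v ->
  hermite_coef (fun x => u x + c * v x) alpha = hermite_coef u alpha + c * hermite_coef v alpha.
Proof.
move=> Lu Lv; have iu := Cintegrable_hermite_coef alpha Lu.
have iv := Cintegrable_hermite_coef alpha Lv.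
rewrite /hermite_coef /L2inner -(CintegralZl c iv) -(CintegralD iu (CintegrableZl c iv)).
by apply: eq_Cintegral => x; rewrite mulrDl mulrA.
Qed.

Definition hermite_sum N u (x : En) : C :=
  \sum_(alpha <- mindices n N) hermite_coef u alpha * Hermite alpha x.

Lemma L2_Hermite alpha : L2 (@Hermite R n alpha).
Proof. by apply: L2_of_parts; [exact: se|exact: sqintegrable0]. Qed.

Lemma L2_hermite_sum N u : L2 (hermite_sum N u).
Proof.
apply: (@L2_sum _ _ _ _ (fun alpha x => hermite_coef u alpha * Hermite alpha x)) => alpha.
exact: L2Z (L2_Hermite alpha).
Qed.

Lemma Re_hermite_residual N u :
  (fun x => complex.Re (u x - hermite_sum N u x)) = residualH N (fun x => complex.Re (u x)).
Proof.
apply/funext => x; rewrite ReCD ReCN.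
rewrite /hermite_sum ReC_sum; congr (_ - _); apply: eq_bigr => alpha _.
by rewrite ReCM hermite_coefE/= mulr0 subr0.
Qed.

Lemma Im_hermite_residual N u :
  (fun x => complex.Im (u x - hermite_sum N u x)) = residualH N (fun x => complex.Im (u x)).
Proof.
apply/funext => x; rewrite ImCD ImCN.
rewrite /hermite_sum ImC_sum; congr (_ - _); apply: eq_bigr => alpha _.
by rewrite ImCM hermite_coefE/= mulr0 add0r.
Qed.

(** The Hermite functions are real, so the real and imaginary parts are expanded
    separately. *)
Lemma L2norm_hermite_residual u : L2 u ->
  exists r : nat -> R, (forall N, L2norm (fun x => u x - hermite_sum N u x) = (r N)%:E)
    /\ r N @[N --> \oo] --> 0.
Proof.
move=> /L2_parts[u1 u2].
have [_ c1] := hermite_row_complete u1; have [_ c2] := hermite_row_complete u2.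
exists (fun N => Num.sqrt (energyH (residualH N (fun x => complex.Re (u x))) +
  energyH (residualH N (fun x => complex.Im (u x))))); split=> [N|].
- have s1 : sqintegrable lam (residualH N (fun x => complex.Re (u x))).
    exact: sqintegrable_residual.
  have s2 : sqintegrable lam (residualH N (fun x => complex.Im (u x))).
    exact: sqintegrable_residual.
  rewrite L2normE sqnormE ?Re_hermite_residual ?Im_hermite_residual//.
  by rewrite poweR_EFin powR12_sqrt// addr_ge0// ip_ge0.
- rewrite -[X in _ --> X](sqrtr0 R); apply: continuous_cvg; first exact: sqrt_continuous.
  by have := cvgD c1 c2; rewrite addr0; exact.
Qed.

(** All partial sums vanish, so by completeness the energy is 0. *)
Lemma hermite_coef_eq0 u : L2 u -> (forall alpha, hermite_coef u alpha = 0) ->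
  {ae lam, forall x, u x = 0}.
Proof.
move=> /L2_parts[u1 u2] c0.
have key (f : En -> R) : sqintegrable lam f ->
    (forall alpha, ip lam f (hermite_row alpha) = 0) -> {ae lam, forall x, f x = 0}.
  move=> sf f0; apply: (ip_eq0_ae sf).
  have [_ cf] := hermite_row_complete sf.
  have E N : energyH (residualH N f) = ip lam f f.
    rewrite (energy_residual se oe us)// big1 ?subr0// => alpha _.
    by rewrite f0 expr0n.
  rewrite (_ : (fun N => _) = fun=> ip lam f f) in cf; last exact/funext.
  exact: (cvg_unique _ (cvg_cst _) cf).
have {}c0 alpha := etrans (esym (hermite_coefE u alpha)) (c0 alpha).
have h1 : {ae lam, forall x, complex.Re (u x) = 0}.
  by apply: key => // alpha; exact: (congr1 (@complex.Re R) (c0 alpha)).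
have h2 : {ae lam, forall x, complex.Im (u x) = 0}.
  by apply: key => // alpha; exact: (congr1 (@complex.Im R) (c0 alpha)).
by apply: filterS2 h1 h2 => x x1 x2; apply: complex_ext.
Qed.

Lemma L2inner_Hermite alpha beta :
  L2inner (@Hermite R n alpha) (@Hermite R n beta) = (alpha == beta)%:R.
Proof.
rewrite -/(hermite_coef _ _) hermite_coefE.
have -> : ip lam (fun x => complex.Im (@Hermite R n alpha x)) (hermite_row beta) = 0.
  by rewrite /ip; under eq_Rintegral do rewrite /= mul0r; rewrite /Rintegral integral0.
have -> : ip lam (fun x => complex.Re (@Hermite R n alpha x)) (hermite_row beta) =
    (alpha == beta)%:R by exact: oe.
by case: (_ == _).
Qed.

(** Grouping by order: a multi-index of order [k] has entries at most [k], which
    is how [hermite_proj] enumerates them. *)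
Lemma sum_mindices (V : zmodType) (G : mindex -> V) N :
  \sum_(alpha <- mindices n N) G alpha =
  \sum_(k < N) \sum_(b : {ffun 'I_n -> 'I_k.+1} | (\sum_j b j == k)%N) G (mindex_of b).
Proof.
transitivity (\sum_(k < N) \sum_(alpha <- mindices n N | (\sum_j alpha j == k)%N) G alpha).
  rewrite (exchange_big_dep xpredT)//= !big_seq; apply: eq_bigr => alpha.
  rewrite mem_mindices => aN.
  by rewrite (big_pred1 (Ordinal aN))// => k /=; rewrite eq_sym -val_eqE.
apply: eq_bigr => k _; rewrite -big_filter.
pose r := [seq mindex_of b | b : {ffun 'I_n -> 'I_k.+1} <- enum {: {ffun 'I_n -> 'I_k.+1}}
  & (\sum_j b j == k)%N].
have P : perm_eq [seq alpha : mindex <- mindices n N | (\sum_j alpha j == k)%N] r.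
  apply: uniq_perm.
  - by rewrite filter_uniq.
  - rewrite map_inj_uniq; last exact: mindex_of_inj.
    by rewrite filter_uniq ?enum_uniq.
  - move=> alpha; rewrite mem_filter mem_mindices; apply/andP/mapP.
    + move=> [/eqP ak aN].
      have aj j : (alpha j < k.+1)%N by rewrite ltnS -ak (bigD1 j)//= leq_addr.
      exists [ffun j => Ordinal (aj j)].
        rewrite mem_filter mem_enum andbT; under eq_bigr do rewrite ffunE.
        exact/eqP.
      by apply/ffunP => j; rewrite !ffunE.
    + move=> [b]; rewrite mem_filter => /andP[/eqP bk _] ->.
      by under eq_bigr do rewrite ffunE; rewrite bk.
by rewrite (perm_big _ P)/= big_map big_filter big_enum_cond.
Qed.

Lemma hermite_proj_sum (c : nat -> C) N u x :
  \sum_(k < N) c k * hermite_proj k u x =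
  \sum_(alpha <- mindices n N) c (\sum_j alpha j)%N * (hermite_coef u alpha * Hermite alpha x).
Proof.
rewrite (sum_mindices (fun alpha =>
  c (\sum_j alpha j)%N * (hermite_coef u alpha * Hermite alpha x))).
apply: eq_bigr => k _; rewrite /hermite_proj mulr_sumr; apply: eq_bigr => b /eqP bk.
have -> : (\sum_j mindex_of b j)%N = k by under eq_bigr do rewrite ffunE.
have E : @Hermite R n (fun j => b j : nat) = Hermite (mindex_of b).
  apply/funext => y; rewrite /Hermite; congr (_%:C).
  by apply: eq_bigr => j _; rewrite ffunE.
by rewrite /line_proj E L2inner_Hermite eqxx divr1.
Qed.

End hermite_expansion.

Section diagonalization.
Context {R : realType}.
Variables (n : nat) (a : R).
Hypotheses (n1 : (1 <= n)%N) (a0 : 0 <= a).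
Local Notation C := R[i].
Local Notation lam := (@lebesgue_row R n).
Local Notation En := 'rV[R]_n.
Local Notation mindex := {ffun 'I_n -> nat}.
Variable Q : (En -> C) -> En -> C.
Hypothesis QOp : Op_w_L2 (distribution_of (@ball_symbol R n a)) Q.
Implicit Types (u v : En -> C) (alpha beta : mindex).

Let QL2 u : L2 u -> L2 (Q u).
Proof. by have [_ [h _ _] _] := QOp; exact: h. Qed.

Let Qlin (c : C) u v : L2 u -> L2 v ->
  {ae lam, forall x, Q (fun y => c * u y + v y) x = c * Q u x + Q v x}.
Proof. by have [_ [_ h _] _] := QOp; exact: h. Qed.

Let eigenvalue alpha : C := F (\sum_j alpha j) n a.

(** The Hermite functions being real Schwartz functions, the weak definition of
    the operator expresses the coefficients as phase-space integrals. *)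
Lemma coef_quantized_Hermite alpha beta :
  hermite_coef (Q (Hermite alpha)) beta = (alpha == beta)%:R * eigenvalue alpha.
Proof.
have [_ _ h] := QOp.
have := h _ _ (schwartz_Hermite alpha) (schwartz_Hermite beta).
have E : (fun x => ((@Hermite R n beta x)^*)%C) = Hermite beta.
  by apply/funext => x; apply: complex_ext; rewrite ?ReC_conj ?ImC_conj//= oppr0.
rewrite /Op_w E ball_wigner_Hermite// /eigenvalue => <-.
apply: eq_Cintegral => x; congr (_ * _).
by have := congr1 (fun f => f x) E.
Qed.

(** Both sides have the same Hermite coefficients. *)
Lemma quantized_Hermite alpha :
  {ae lam, forall x, Q (Hermite alpha) x = eigenvalue alpha * Hermite alpha x}.
Proof.
have LQ := QL2 (L2_Hermite alpha).
have Lw : L2 (fun x => Q (Hermite alpha) x + (- eigenvalue alpha) * Hermite alpha x).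
  by apply: L2D => //; apply: L2Z; exact: L2_Hermite.
have : {ae lam, forall x, Q (Hermite alpha) x + (- eigenvalue alpha) * Hermite alpha x = 0}.
  apply: (hermite_coef_eq0 Lw) => beta.
  rewrite (hermite_coef_lin (- eigenvalue alpha) beta LQ (L2_Hermite alpha)).
  have hc : hermite_coef (Hermite alpha) beta = (alpha == beta)%:R := L2inner_Hermite alpha beta.
  by rewrite coef_quantized_Hermite hc mulrC -mulrDl subrr mul0r.
by apply: filterS => x /eqP; rewrite mulNr subr_eq0 => /eqP.
Qed.

(** Operators act on representatives, and their linearity, which holds almost
    everywhere, is what gives the value at 0. *)
Lemma quantized0 : {ae lam, forall x, Q (fun=> 0) x = 0}.
Proof.
have := Qlin 1 (@L20 R n) (@L20 R n).
rewrite (_ : (fun y => _) = fun=> 0); last by apply/funext => x; rewrite mulr0 addr0.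
by apply: filterS => x /eqP; rewrite mul1r -subr_eq0 opprD addrA subrr sub0r oppr_eq0 => /eqP.
Qed.

Lemma quantized_sum (s : seq mindex) (c : mindex -> C) :
  {ae lam, forall x, Q (fun y => \sum_(alpha <- s) c alpha * Hermite alpha y) x =
    \sum_(alpha <- s) eigenvalue alpha * (c alpha * Hermite alpha x)}.
Proof.
elim: s => [|alpha s IH].
  rewrite (_ : (fun y => _) = fun=> 0); last by apply/funext => x; rewrite big_nil.
  by apply: filterS quantized0 => x ->; rewrite big_nil.
rewrite (_ : (fun y => _) = fun y =>
  c alpha * Hermite alpha y + \sum_(beta <- s) c beta * Hermite beta y); last first.
  by apply/funext => x; rewrite big_cons.
have Ls : L2 (fun y => \sum_(beta <- s) c beta * @Hermite R n beta y).
  apply: (@L2_sum _ _ _ _ (fun beta y => c beta * Hermite beta y)) => beta.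
  exact: L2Z (L2_Hermite beta).
have L := Qlin (c alpha) (L2_Hermite alpha) Ls.
apply: filterS3 L IH (quantized_Hermite alpha) => x -> -> ->.
by rewrite big_cons mulrCA.
Qed.

(** Up to a null set the difference is the image by [Q] of the residual of the
    Hermite expansion of [u], whose norm tends to 0. *)
Lemma quantized_expansion u : L2 u ->
  (fun N : nat => L2norm (fun x =>
     Q u x - \sum_(k < N) F k n a * hermite_proj k u x)) @ \oo --> 0%E.
Proof.
move=> Lu; have [_ [_ _ [M HM]] _] := QOp.
have [r [rE r0]] := L2norm_hermite_residual Lu.
have Lres N : L2 (fun x => u x - hermite_sum N u x).
  have := L2D Lu (L2Z (-1) (L2_hermite_sum N u)).
  by under eq_fun do rewrite mulN1r.
have E N : L2norm (fun x => Q u x - \sum_(k < N) F k n a * hermite_proj k u x) =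
    L2norm (Q (fun x => u x - hermite_sum N u x)).
  have LF : L2 (fun x => Q u x - \sum_(k < N) F k n a * hermite_proj k u x).
    have LS : L2 (fun x => \sum_(alpha <- mindices n N)
        (eigenvalue alpha * hermite_coef u alpha) * @Hermite R n alpha x).
      apply: (@L2_sum _ _ _ _ (fun alpha x =>
        (eigenvalue alpha * hermite_coef u alpha) * @Hermite R n alpha x)) => alpha.
      exact: L2Z (L2_Hermite alpha).
    rewrite (_ : (fun x => _) = fun x => Q u x + -1 * \sum_(alpha <- mindices n N)
        (eigenvalue alpha * hermite_coef u alpha) * @Hermite R n alpha x).
      exact: (L2D (QL2 Lu) (L2Z (-1) LS)).
    apply/funext => x; rewrite (hermite_proj_sum (fun k => F k n a)) mulN1r.
    by congr (_ - _); apply: eq_bigr => alpha _; rewrite mulrA.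
  apply: ae_eq_L2norm; [exact: L2_measurable|exact: L2_measurable (QL2 (Lres N))|].
  have L1 := Qlin (-1) (L2_hermite_sum N u) Lu.
  have L2' := quantized_sum (mindices n N) (hermite_coef u).
  apply: filterS2 L1 L2' => x h1 h2.
  rewrite (hermite_proj_sum (fun k => F k n a)).
  rewrite (_ : (fun x => u x - hermite_sum N u x) = fun y => -1 * hermite_sum N u y + u y).
    by rewrite h1 mulN1r addrC h2.
  by apply/funext => y; rewrite mulN1r addrC.
under eq_fun do rewrite E.
apply: (@squeeze_cvge _ _ _ _ (fun=> 0%E) _ (fun N => (M * r N)%:E)).
- apply: nearW => N; rewrite Lnorm_ge0/=.
  by apply: le_trans (HM _ (Lres N)) _; rewrite rE EFinM.
- exact: cvg_cst.
- apply: cvg_EFin; first exact: nearW.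
  by rewrite -(mulr0 M); exact: cvgMl_tmp.
Qed.

End diagonalization.

Theorem theorem3p6 (R : realType) (n : nat) (a : R) :
  (1 <= n)%N -> 0 <= a ->
  let symbol := distribution_of (@ball_symbol R n a) in
  (exists Q, Op_w_L2 symbol Q) /\
  (forall Q, Op_w_L2 symbol Q -> forall u : 'rV[R]_n -> R[i], L2 u ->
     (fun N : nat => L2norm (fun x =>
        Q u x - \sum_(k < N) F k n a * hermite_proj k u x)) @ \oo --> 0%E).
Proof.
move=> n1 a0 symbol; split; first by exists (weyl_ball a); exact: Op_w_L2_ball.
by move=> Q QOp u Lu; exact: (quantized_expansion n1 a0 QOp Lu).
Qed.
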